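(* Let $\mathcal{X}=[0,1]^d$, let $(P,Q)\in\mathcal{P}_{\mathsf{KL}}(\mathcal{X})$, let $f_{\mathsf{KL}}:=\log\big(\frac{dP}{dQ}\big)$, and let $X^n=(X_1,\dots,X_n)$ and $Y^n=(Y_1,\dots,Y_n)$ be i.i.d. samples from $P$ and $Q$, respectively. For any $\alpha>0$: (i) If $f_{\mathsf{KL}}\in\mathsf{C}(\mathcal{X})$ (continuous on $\mathcal{X}$), then for $\{k_n\}_{n\in\mathbb{N}}$ such that $k_n\to\infty$ and $k_n\le(\frac12-\alpha)\log n$, $$\hat D_{\mathcal{G}_{k_n}(\mathbf{1})}(X^n,Y^n)\xrightarrow[n\to\infty]{}\mathsf{D}_{\mathsf{KL}}(P\|Q),\quad\mathbb{P}\text{-a.s.}$$ (ii) Suppose there exists an $M$ such that $f_{\mathsf{KL}}\in\mathcal{I}(M)$. Then, for $k$ and $n$ such that $k^3=O(n^{1-\alpha})$, $$\mathbb{E}\Big[\big|\hat D_{\mathcal{G}^*_k(0.5\log k)}(X^n,Y^n)-\mathsf{D}_{\mathsf{KL}}(P\|Q)\big|\Big]=O\big(k^{-\frac12}+k^{\frac32}n^{-\frac12}\big).$$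
   Context: For $P\ll Q$ in $\mathcal{P}(\mathcal{X})$ (Borel probability measures on $\mathcal{X}$), $\mathsf{D}_{\mathsf{KL}}(P\|Q)=\mathbb{E}_P[\log\frac{dP}{dQ}]$. $\mathcal{P}_{\mathsf{KL}}(\mathcal{X})$ is the set of pairs $(P,Q)\in\mathcal{P}(\mathcal{X})\times\mathcal{P}(\mathcal{X})$ with $P\ll Q$ and $\mathsf{D}_{\mathsf{KL}}(P\|Q)<\infty$. Neural network class: let $\phi(x)=\frac{1}{1+e^{-x}}$. For $k\in\mathbb{N}$ and $\mathbf{a}=(a_1,a_2,a_3)\in\mathbb{R}^3_{\ge0}$, $\mathcal{G}_k(\mathbf{a})$ is the set of functions $g:\mathbb{R}^d\to\mathbb{R}$ of the form $g(x)=\sum_{i=1}^k\beta_i\phi(w_i\cdot x+b_i)+b_0$ with $w_i\in\mathbb{R}^d$, $b_0,b_i,\beta_i\in\mathbb{R}$, $\max_{i=1,\dots,k,\,j=1,\dots,d}\{|w_{i,j}|,|b_i|\}\le a_1$, $|\beta_i|\le a_2$ for $i=1,\dots,k$, and $|b_0|\le a_3$. $\mathbf{1}=(1,1,1)$, and $\mathcal{G}_k^*(c):=\mathcal{G}_k(\sqrt k\log k,2k^{-1}c,c)$ for $c\ge0$. Neural estimator: $\hat D_{\mathcal{G}}(X^n,Y^n):=\sup_{g\in\mathcal{G}}\frac1n\sum_{i=1}^n\big[g(X_i)-(e^{g(Y_i)}-1)\big]$. Barron class: for $f:\mathbb{R}^d\to\mathbb{R}$ having a Fourier representation $f(x)=\int_{\mathbb{R}^d}e^{i\omega\cdot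 x}\tilde F(d\omega)$, with $\tilde F$ a complex Borel measure on $\mathbb{R}^d$ with magnitude $F$, set $B(f):=\int_{\mathbb{R}^d}\sup_{x\in\mathcal{X}}|\omega\cdot x|\,F(d\omega)$. For $c\ge0$, $\mathcal{B}_c$ is the set of such $f$ with $B(f)\vee|f(0)|\le c$. For $\tilde f:\mathcal{X}\to\mathbb{R}$, $c_B^\star(\tilde f):=\inf\{c:\exists f\in\mathcal{B}_c,\ \tilde f=f|_{\mathcal{X}}\}$ (with $\inf\emptyset=\infty$). $\mathcal{I}(m):=\{f:\mathcal{X}\to\mathbb{R}:\ c_B^\star(f)\vee\|f\|_\infty\le m\}$, with $\|\cdot\|_\infty$ the sup norm on $\mathcal{X}$ and $a\vee b=\max\{a,b\}$. Constants implied by $O(\cdot)$ do not depend on $k,n$. *)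

(* Defs.v *)
From HB Require Import structures.
From mathcomp Require Import all_boot all_order all_algebra finmap complex.
From mathcomp Require Import all_classical all_reals all_analysis.

Set Implicit Arguments.
Unset Strict Implicit.
Unset Printing Implicit Defensive.

Import Order.TTheory GRing.Theory Num.Theory.
Import numFieldNormedType.Exports.

Local Open Scope classical_set_scope.
Local Open Scope ring_scope.
Local Open Scope charge_scope.

(* R^d with its Borel sigma-algebra: the measurable structure on the carrier
   'rV[R]_d generated by the open sets. *)
Notation borel_rV R d := (g_sigma_algebraType (@open 'rV[R]_d)).

Definition dotrv (R : realType) (d : nat) (u v : 'rV[R]_d) : R :=
  \sum_(j < d) u 0 j * v 0 j.

Definition unit_cube (R : realType) (d : nat) : set 'rV[R]_d :=
  [set x | forall j, 0 <= x 0 j <= 1].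

Definition log_ratio (R : realType) (d : nat)
    (P Q : probability (borel_rV R d) R) (x : borel_rV R d) : \bar R :=
  lne (('d (charge_of_finite_measure P) '/d Q) x).

Definition KL (R : realType) (d : nat)
    (P Q : probability (borel_rV R d) R) : \bar R :=
  (\int[P]_x log_ratio P Q x)%E.

(* A Borel probability measure on the cube is represented by a Borel
   probability measure on R^d giving mass 1 to the cube. *)
Definition KL_pair (R : realType) (d : nat)
    (P Q : probability (borel_rV R d) R) : Prop :=
  [/\ P (@unit_cube R d) = 1%E, Q (@unit_cube R d) = 1%E,
      P `<< Q & (KL P Q < +oo)%E].

(* dP/dQ is only determined Q-almost everywhere: a real function is a version
   of log(dP/dQ) when it agrees with log_ratio Q-almost everywhere. *)
Definition is_log_ratio (R : realType) (d : nat)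
    (P Q : probability (borel_rV R d) R) (f : 'rV[R]_d -> R) : Prop :=
  {ae Q, forall x, log_ratio P Q x = (f x)%:E}.

Definition mutually_independent (R : realType) (d1 d2 : measure_display)
    (Omega : measurableType d1) (T : measurableType d2)
    (Pr : probability Omega R) (X : nat -> {RV Pr >-> T}) : Prop :=
  forall (J : {fset nat}) (A : nat -> set T),
    (forall i, i \in J -> measurable (A i)) ->
    Pr (\bigcap_(i in [set` J]) (X i @^-1` A i)) =
    (\prod_(i <- J) Pr (X i @^-1` A i))%E.

Definition iid_from (R : realType) (d1 d2 : measure_display)
    (Omega : measurableType d1) (T : measurableType d2)
    (Pr : probability Omega R) (X : nat -> {RV Pr >-> T})
    (P : probability T R) : Prop :=
  mutually_independent X /\
  forall i (A : set T), measurable A -> distribution Pr (X i) A = P A.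

Definition sigmoid (R : realType) (x : R) : R := (1 + expR (- x))^-1.

Definition NN (R : realType) (d k : nat) (a1 a2 a3 : R)
    : set ('rV[R]_d -> R) :=
  [set g | exists (beta : 'I_k -> R) (w : 'I_k -> 'rV[R]_d) (b : 'I_k -> R)
             (b0 : R),
    [/\ forall x, g x =
          \sum_(i < k) beta i * sigmoid (dotrv (w i) x + b i) + b0,
        forall i j, `|w i 0 j| <= a1,
        forall i, `|b i| <= a1,
        forall i, `|beta i| <= a2 &
        `|b0| <= a3]].

Definition NNstar (R : realType) (d k : nat) (c : R) : set ('rV[R]_d -> R) :=
  @NN R d k (Num.sqrt k%:R * ln k%:R) (2 * k%:R^-1 * c) c.

(* The samples (X_1, ..., X_n) and (Y_1, ..., Y_n) are the first n terms of x
   and y. *)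
Definition KL_estimator (R : realType) (d : nat) (G : set ('rV[R]_d -> R))
    (n : nat) (x y : nat -> 'rV[R]_d) : \bar R :=
  ereal_sup [set (n%:R^-1 *
      \sum_(i < n) (g (x i) - (expR (g (y i)) - 1)))%:E | g in G].

Record complex_measure (R : realType) (d : measure_display)
    (T : measurableType d) := ComplexMeasure {
  re_charge : {charge set T -> \bar R};
  im_charge : {charge set T -> \bar R} }.

Definition cmeas (R : realType) (d : measure_display) (T : measurableType d)
    (nu : complex_measure R T) (A : set T) : R[i] :=
  (fine (re_charge nu A) +i* fine (im_charge nu A))%C.

(* F is the total variation measure of nu, with the supremum over countable
   measurable partitions of A. *)
Definition is_magnitude (R : realType) (d : measure_display)
    (T : measurableType d) (nu : complex_measure R T)
    (F : {measure set T -> \bar R}) : Prop :=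
  forall A, measurable A ->
    F A = ereal_sup [set (\sum_(0 <= i <oo) (Normc.normc (cmeas nu (E i)))%:E)%E
            | E in [set E : nat -> set T |
                [/\ forall i, measurable (E i), trivIset setT E &
                    \bigcup_i E i = A]]].

(* Integral against a signed measure through its Jordan decomposition, which
   does not depend on the chosen Hahn decomposition. *)
Definition charge_integral (R : realType) (d : measure_display)
    (T : measurableType d) (nu : {charge set T -> \bar R}) (h : T -> R) : R :=
  let P := cid (Hahn_decomposition nu) in
  let nuPN := svalP (cid (svalP P)) in
  (\int[jordan_pos nuPN]_x h x) - (\int[jordan_neg nuPN]_x h x).

Definition complex_integral (R : realType) (d : measure_display)
    (T : measurableType d) (nu : complex_measure R T) (h : T -> R[i]) : R[i] :=
  let a := @complex.Re R \o h in let b := @complex.Im R \o h in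
  ((charge_integral (re_charge nu) a - charge_integral (im_charge nu) b) +i*
   (charge_integral (re_charge nu) b + charge_integral (im_charge nu) a))%C.

Definition fourier_rep (R : realType) (d : nat)
    (nu : complex_measure R (borel_rV R d)) (f : 'rV[R]_d -> R) : Prop :=
  forall x : 'rV[R]_d, (f x)%:C%C =
    complex_integral nu
      (fun omega => (cos (dotrv omega x) +i* sin (dotrv omega x))%C).

(* The finite complex measure representing f is unique, hence so is B(f). *)
Definition barron (R : realType) (d : nat) (c : R) : set ('rV[R]_d -> R) :=
  [set f | exists (nu : complex_measure R (borel_rV R d))
             (F : {measure set (borel_rV R d) -> \bar R}),
    [/\ fourier_rep nu f, is_magnitude nu F &
        (maxe (\int[F]_omega
            ereal_sup [set `|dotrv omega x|%:E | x in @unit_cube R d])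
          `|f 0|%:E <= c%:E)%E]].

Definition barron_coef (R : realType) (d : nat) (f : 'rV[R]_d -> R) : \bar R :=
  ereal_inf [set c%:E | c in [set c : R | 0 <= c /\
    exists2 g, @barron R d c g & forall x, @unit_cube R d x -> f x = g x]].

Definition barron_ball (R : realType) (d : nat) (m : R)
    : set ('rV[R]_d -> R) :=
  [set f | (maxe (barron_coef f)
      (ereal_sup [set `|f x|%:E | x in @unit_cube R d]) <= m%:E)%E].

(* Main.v *)
Require Import Defs.
From HB Require Import structures.
From mathcomp Require Import all_boot all_order all_algebra.
From mathcomp Require Import all_classical all_reals all_analysis.
From mathcomp Require Import measurable_realfun.
From mathcomp Require Import ring lra.
From mathcomp Require Import finmap complex.

(* Write D for the divergence and f for the (bounded) log-density.  For bounded g,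
   D - (E_P g - E_Q (e^g - 1)) = E_Q [e^f (e^(g-f) - 1 - (g-f))], the gap of g, is
   nonnegative and at most C E_Q (g-f)^2.  So the estimator exceeds D by no more than
   the deviation, over a finite net of the network class, of the two empirical means,
   where the gap itself absorbs the variance of the e^g term; a Chernoff bound at
   scale lam and a union bound over the net control it, in expectation for (ii) and
   summably in n (Borel-Cantelli) for (i).  It falls below D by no more than the gap
   and the deviation of one network g approximating f.
   For (i), g is uniformly close to f: monomials in x times derivatives of the sigmoid
   at w.x + b are limits of difference quotients in w of networks with inner weights
   below 1; taking w = 0 yields the monomials themselves, and multivariate Bernstein
   polynomials are dense in C(cube).
   For (ii), g is built greedily in L^2(Q): a ridge function cos or sin of w.x is
   approximated, on a grid of m ~ sqrt k steps, by telescoping steep sigmoids, hence a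
   linear functional that is small on all sigmoids of slope m is small on f; therefore
   some neuron makes the next residual nonpositively correlated with the accumulated
   one, up to O(1/m), and the squared norm of the k-term sum grows linearly in k. *)

Set Implicit Arguments.
Unset Strict Implicit.
Unset Printing Implicit Defensive.

Import Order.TTheory GRing.Theory Num.Theory.
Import numFieldNormedType.Exports.

Local Open Scope classical_set_scope.
Local Open Scope ring_scope.

(** * Integration of bounded measurable functions *)

(** In (ii) the class contains networks bounded only by [H = 3/2 * ln k], so e^g can reach k^(3/2)
    and its square k^3, too large for the rate. Bounding the second moment of e^g by e^H times its
    mean, hence by 2 e^H (gap + 1), leaves a single factor e^H: at a scale lam of order n^(-1/2) the
    cost is lam e^H, of order k^(3/2) n^(-1/2), and the growth condition on k keeps lam e^H bounded.
    The one network approximating f has no such relief, but its bound H' does not grow with k. The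
    entropy of the net adds k (1 + ln n) n^(-1/2), whose logarithm is absorbed by the two terms of
    the rate. In (i), H = k + 1 and e^H is at most e n^(1/2 - alpha), so the exponents of the tail
    bounds are dominated by -n lam e, of order -sqrt n. The supremum over the uncountable class is
    not shown to be measurable. The estimator is therefore always compared with a bounded measurable
    random variable, and only the latter is integrated or used in a Markov bound. *)

Section bounded_measurable.
Context {d : measure_display} {T : measurableType d} {R : realType}.
Implicit Types f g : T -> R.

(** Such functions are integrable for every finite measure and stable under the operations used, so
    integrals can be treated as real-valued linear functionals. Networks and the clipped log-density
    are all of this kind. *)
Definition bmf f := measurable_fun setT f /\ exists M, forall x, `|f x| <= M.

Lemma bmf_cst (c : R) : bmf (fun=> c).
Proof. by split; [exact: measurable_cst|exists `|c|]. Qed.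

Lemma bmfN f : bmf f -> bmf (fun x => - f x).
Proof.
move=> [mf [M fM]]; split; first exact: measurableT_comp.
by exists M => x; rewrite normrN.
Qed.

Lemma bmfD f g : bmf f -> bmf g -> bmf (fun x => f x + g x).
Proof.
move=> [mf [M fM]] [mg [N gN]]; split; first exact: measurable_funD.
by exists (M + N) => x; rewrite (le_trans (ler_normD _ _))// lerD.
Qed.

Lemma bmfB f g : bmf f -> bmf g -> bmf (fun x => f x - g x).
Proof. by move=> bf bg; exact: bmfD bf (bmfN bg). Qed.

Lemma bmfM f g : bmf f -> bmf g -> bmf (fun x => f x * g x).
Proof.
move=> [mf [M fM]] [mg [N gN]]; split; first exact: measurable_funM.
by exists (M * N) => x; rewrite normrM ler_pM.
Qed.

Lemma bmf_sqr f : bmf f -> bmf (fun x => f x ^+ 2).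
Proof. by move=> bf; under eq_fun do rewrite expr2; exact: bmfM. Qed.

Lemma bmfZ (c : R) f : bmf f -> bmf (fun x => c * f x).
Proof. by move=> bf; exact: bmfM (bmf_cst c) bf. Qed.

Lemma bmf_expR f : bmf f -> bmf (fun x => expR (f x)).
Proof.
move=> [mf [M fM]]; split.
  by apply: measurableT_comp mf; exact: measurable_expR.
exists (expR M) => x; rewrite ger0_norm ?expR_ge0// ler_expR.
exact: le_trans (ler_norm _) (fM x).
Qed.

Lemma bmf_sum (I : Type) (s : seq I) (h : I -> T -> R) :
  (forall i, bmf (h i)) -> bmf (fun x => \sum_(i <- s) h i x).
Proof.
move=> bh; split; first by apply: measurable_sum => i; exact: (bh i).1.
elim: s => [|i s [M sM]]; first by exists 0 => x; rewrite big_nil normr0.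
have [_ [N hN]] := bh i.
exists (N + M) => x; rewrite big_cons.
by rewrite (le_trans (ler_normD _ _))// lerD.
Qed.

Lemma bmf_prod (I : eqType) (s : seq I) (h : I -> T -> R) :
  (forall i, bmf (h i)) -> bmf (fun x => \prod_(i <- s) h i x).
Proof.
move=> bh; split; first by apply: measurable_prod => i _; exact: (bh i).1.
elim: s => [|i s [M sM]]; first by exists 1 => x; rewrite big_nil normr1.
have [_ [N hN]] := bh i.
by exists (N * M) => x; rewrite big_cons normrM ler_pM.
Qed.

Lemma bmf_indic (A : set T) : measurable A -> bmf (\1_A : T -> R).
Proof.
move=> mA; split; first exact: measurable_indic.
by exists 1 => x; rewrite indicE; case: (_ \in _); rewrite ?normr1 ?normr0 ?ler01.
Qed.

Lemma bmf_norm f : bmf f -> bmf (fun x => `|f x|).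
Proof.
move=> [mf [M fM]]; split; first exact: measurableT_comp.
by exists M => x; rewrite normr_id.
Qed.

Section finite.
Variable mu : {finite_measure set T -> \bar R}.

Lemma bmf_integrable f : bmf f -> mu.-integrable setT (EFin \o f).
Proof.
move=> [mf [M fM]]; apply: measurable_bounded_integrable => //.
  by rewrite ltey_eq fin_num_measure.
exists M; split; first by rewrite num_real.
by move=> N MN x _ /=; rewrite (le_trans (fM x))// ltW.
Qed.

Lemma RintD f g : bmf f -> bmf g ->
  \int[mu]_x (f x + g x) = \int[mu]_x f x + \int[mu]_x g x.
Proof. by move=> bf bg; rewrite RintegralD//; exact: bmf_integrable. Qed.

Lemma RintB f g : bmf f -> bmf g ->
  \int[mu]_x (f x - g x) = \int[mu]_x f x - \int[mu]_x g x.
Proof. by move=> bf bg; rewrite RintegralB//; exact: bmf_integrable. Qed.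

Lemma RintZ (c : R) f : bmf f -> \int[mu]_x (c * f x) = c * \int[mu]_x f x.
Proof. by move=> bf; rewrite RintegralZl//; exact: bmf_integrable. Qed.

Lemma RintN f : bmf f -> \int[mu]_x (- f x) = - \int[mu]_x f x.
Proof.
move=> bf; rewrite -mulN1r -RintZ//; apply: eq_Rintegral => x _.
by rewrite mulN1r.
Qed.

Lemma Rint_sum (I : Type) (s : seq I) (h : I -> T -> R) :
  (forall i, bmf (h i)) ->
  \int[mu]_x (\sum_(i <- s) h i x) = \sum_(i <- s) \int[mu]_x h i x.
Proof.
move=> bh; elim: s => [|i s IH].
  rewrite big_nil; transitivity (\int[mu]_x (0 : R)).
    by apply: eq_Rintegral => x _; rewrite big_nil.
  by rewrite Rintegral_cst// mul0r.
rewrite big_cons -IH -RintD//; last exact: bmf_sum.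
by apply: eq_Rintegral => x _; rewrite big_cons.
Qed.

Lemma le_Rint f g : bmf f -> bmf g -> (forall x, f x <= g x) ->
  \int[mu]_x f x <= \int[mu]_x g x.
Proof. by move=> bf bg fg; apply: le_Rintegral => //; exact: bmf_integrable. Qed.

Lemma le_Rint_on (D : set T) f g : measurable D -> mu (~` D) = 0%E ->
  bmf f -> bmf g -> (forall x, D x -> f x <= g x) ->
  \int[mu]_x f x <= \int[mu]_x g x.
Proof.
move=> mD D0 bf bg fg.
have eqD h : bmf h -> \int[mu]_x h x = \int[mu]_(x in D) h x.
  move=> bh; rewrite /Rintegral; congr fine.
  rewrite (negligible_integral (measurableC mD) measurableT _ D0)//.
    by rewrite setTD setCK.
  exact: bmf_integrable.
rewrite (eqD f)// (eqD g)//; apply: le_Rintegral => //.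
- by apply: integrableS (bmf_integrable bf).
- by apply: integrableS (bmf_integrable bg).
Qed.

Lemma le_norm_Rint f g : bmf f -> bmf g -> (forall x, `|f x| <= g x) ->
  `|\int[mu]_x f x| <= \int[mu]_x g x.
Proof.
move=> bf bg fg; apply: le_trans (le_normr_Rintegral _ _) _ => //.
  exact: bmf_integrable.
by apply: le_Rint => //; exact: bmf_norm.
Qed.

End finite.
End bounded_measurable.

Lemma bmf_comp {d d'} {T : measurableType d} {T' : measurableType d'}
    {R : realType} (f : T' -> R) (X : T -> T') :
  measurable_fun setT X -> bmf f -> bmf (fun x => f (X x)).
Proof.
move=> mX [mf [M fM]]; split; first exact: measurableT_comp.
by exists M.
Qed.
Arguments bmf_comp {d d' T T' R} f X.

Section probability_Rint.
Context {d : measure_display} {T : measurableType d} {R : realType}.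
Variable P : probability T R.

Lemma Rint_cst (c : R) : \int[P]_x c = c.
Proof.
rewrite Rintegral_cst// (_ : fine _ = 1) ?mulr1//.
by have := probability_setT P => /(congr1 fine).
Qed.

Lemma Rint_indic (A : set T) : measurable A -> (\int[P]_x (\1_A x : R)) = fine (P A).
Proof. by move=> mA; rewrite /Rintegral integral_indic// setIT. Qed.
End probability_Rint.

Section layer_cake.
Context {R : realType}.

(** The sum counts the integers 1, ..., J that are at most u, so it is the floor of u. *)
Lemma layer_cake_nat (J : nat) (u : R) : 0 <= u <= J%:R ->
  `|u - \sum_(j < J) (j.+1%:R <= u)%R%:R| <= 1.
Proof.
elim: J => [|J IH] /andP[u0 uJ].
  by rewrite big_ord0 subr0 (_ : u = 0) ?normr0//; apply/le_anti; rewrite u0 uJ.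
rewrite big_ord_recr/=.
have [uJ'|Ju] := leP u J%:R.
  rewrite (_ : (J.+1%:R <= u) = false) ?addr0 ?IH ?u0//.
  by apply/negbTE; rewrite -ltNge (le_lt_trans uJ')// ltr_nat.
rewrite (eq_bigr (fun=> 1)); last first.
  by move=> j _; rewrite (le_trans _ (ltW Ju))// ler_nat.
rewrite sumr_const card_ord.
have := @natr1 R J; case: (leP J.+1%:R u) => /= b Jn; rewrite ler_norml; lra.
Qed.

(* The layer-cake step functions approximate a bounded function uniformly, so a
   linear identity known for indicators extends to bounded functions. *)
Lemma Rint_weighted_comp {d d'} {Omega : measurableType d} {T : measurableType d'}
    (Pr : {finite_measure set Omega -> \bar R}) (P : {finite_measure set T -> \bar R})
    (W : Omega -> R) (X : Omega -> T) (c : R) :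
  bmf W -> measurable_fun setT X ->
  (forall A, measurable A ->
    \int[Pr]_w (W w * \1_A (X w)) = c * \int[P]_x \1_A x) ->
  forall h, bmf h -> \int[Pr]_w (W w * h (X w)) = c * \int[P]_x h x.
Proof.
move=> bW mX HA h bh; have [mh [M hM]] := bh.
have [_ [MW WM]] := bW.
pose b : R := `|M|.
have hb x : 0 <= h x + b <= 2 * b.
  have /ler_normlP[h1 h2] := hM x.
  have := ler_norm M; rewrite -/b => Mb; apply/andP; split; lra.
have const (e : R) : \int[Pr]_w (W w * e) = c * \int[P]_x e.
  have := HA setT measurableT.
  under eq_Rintegral do rewrite indicT mulr1.
  under [in RHS]eq_Rintegral do rewrite indicT.
  move=> H1; under eq_Rintegral do rewrite mulrC.
  rewrite RintZ// {}H1 mulrCA; congr (c * _).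
  rewrite -[in LHS]RintZ; last exact: bmf_cst.
  by apply: eq_Rintegral => x _; rewrite mulr1.
pose A (N j : nat) := [set x | j.+1%:R <= N.+1%:R * (h x + b)].
have mA N j : measurable (A N j).
  rewrite -[A N j]setTI.
  apply: (@measurable_fun_le _ _ _ setT (fun=> j.+1%:R)
            (fun x => N.+1%:R * (h x + b))) => //.
  by apply: (bmfZ _ (bmfD bh (bmf_cst b))).1.
(* The shift by [b] makes the function nonnegative; the levels (j+1)/(N+1) then give a uniform error
   of at most 1/(N+1). *)
pose s N J x : R := N.+1%:R^-1 * (\sum_(j < J) \1_(A N j) x) - b.
have bs N J : bmf (s N J).
  by apply: bmfB (bmf_cst _); apply: bmfZ; apply: bmf_sum => i; exact: bmf_indic.
have sE N J : \int[Pr]_w (W w * s N J (X w)) = c * \int[P]_x s N J x.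
  have e1 w : W w * s N J (X w) =
      N.+1%:R^-1 * (\sum_(j < J) W w * \1_(A N j) (X w)) - W w * b.
    by rewrite /s mulrBr mulrCA mulr_sumr.
  have bWi j : bmf (fun w => W w * \1_(A N j) (X w)).
    by apply: bmfM => //; apply: (bmf_comp (\1_(A N j))) => //; exact: bmf_indic.
  under eq_Rintegral do rewrite e1.
  rewrite RintB; last 2 first.
  - by apply: bmfZ; exact: bmf_sum.
  - by apply: bmfM => //; exact: bmf_cst.
  rewrite const RintZ; last exact: bmf_sum.
  rewrite Rint_sum//.
  under eq_bigr do rewrite HA//.
  rewrite RintB; last 2 first.
  - by apply: bmfZ; apply: bmf_sum => j; exact: bmf_indic.
  - exact: bmf_cst.
  rewrite RintZ; last by apply: bmf_sum => j; exact: bmf_indic.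
  rewrite Rint_sum; last by move=> j; exact: bmf_indic.
  by rewrite -mulr_sumr mulrBr mulrCA.
have hK N : exists J, forall x, `|h x - s N J x| <= N.+1%:R^-1.
  exists (Num.bound (N.+1%:R * (2 * b))) => x.
  have N0 : 0 < N.+1%:R :> R by rewrite ltr0n.
  rewrite -(ler_pM2l N0) mulfV ?gt_eqF// -[X in X * `|_|]gtr0_norm// -normrM.
  have SE : \sum_(j < Num.bound (N.+1%:R * (2 * b))) \1_(A N j) x =
      \sum_(j < Num.bound (N.+1%:R * (2 * b)))
        (j.+1%:R <= N.+1%:R * (h x + b))%R%:R :> R.
    apply: eq_bigr => j _; rewrite indicE /A; congr (nat_of_bool _)%:R.
    by apply/idP/idP => [/set_mem//|?]; exact: mem_set.
  rewrite /s SE.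
  rewrite (_ : N.+1%:R * (h x - _) = N.+1%:R * (h x + b) - \sum_(j < Num.bound (N.+1%:R * (2 * b)))
        (j.+1%:R <= N.+1%:R * (h x + b))%R%:R); last first.
    by rewrite !mulrBr mulVKf ?gt_eqF// mulrDr opprB addrA.
  apply: layer_cake_nat; have /andP[h0 h1] := hb x.
  rewrite mulr_ge0 ?ler0n//=.
  apply: le_trans (ltW (archi_boundP _)).
    by rewrite ler_pM2l.
  by rewrite !mulr_ge0 ?ler0n ?normr_ge0.
apply/eqP; rewrite -subr_eq0 -normr_le0; apply/ler_addgt0Pr => e e0.
rewrite add0r.
pose C := \int[Pr]_w `|W w| + `|c| * \int[P]_x 1.
have C0 : 0 <= C.
  by rewrite addr_ge0 ?mulr_ge0//; apply: Rintegral_ge0.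
pose N := Num.bound (C / e).
have [J HJ] := hK N.
rewrite -(subrKA (\int[Pr]_w (W w * s N J (X w)))) {2}sE.
rewrite -RintB; last 2 first.
- by apply: bmfM => //; exact: bmf_comp.
- by apply: bmfM => //; exact: bmf_comp.
rewrite -mulrBr -RintB//.
apply: (le_trans (ler_normD _ _)).
apply: (@le_trans _ _ (N.+1%:R^-1 * C)); last first.
  rewrite ler_pdivrMl ?ltr0n// -ler_pdivrMr//.
  have Ce : 0 <= C / e by rewrite divr_ge0 // ltW.
  rewrite (le_trans (ltW (archi_boundP Ce)))// ler_nat.
  exact: leqnSn.
rewrite mulrDr lerD//.
  rewrite -RintZ; last exact: bmf_norm.
  apply: le_norm_Rint.
  - by apply: bmfB; apply: bmfM => //; exact: bmf_comp.
  - by apply: bmfZ; exact: bmf_norm.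
  by move=> w; rewrite -mulrBr normrM mulrC ler_wpM2r.
rewrite normrM mulrCA ler_wpM2l//.
rewrite -RintZ; last exact: bmf_cst.
apply: le_norm_Rint => [||x].
- exact: bmfB.
- exact: (bmfZ _ (bmf_cst _)).
- by rewrite mulr1 distrC; exact: HJ.
Qed.

End layer_cake.

(** * Independent samples *)

Section iid_product.
Context {R : realType} {d1 d2 : measure_display}.
Context {Omega : measurableType d1} {T : measurableType d2}.
Variables (Pr : probability Omega R) (X : nat -> {RV Pr >-> T}).
Variables (P : probability T R) (hX : iid_from X P).

Lemma iid_Rint_indic_prod (n : nat) (A : nat -> set T) :
  (forall i, measurable (A i)) ->
  \int[Pr]_w (\prod_(i < n) \1_(A i) (X i w)) =
  \prod_(i < n) \int[P]_x (\1_(A i) x : R).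
Proof.
move=> mA; have [indX disX] := hX.
pose J : {fset nat} := [fset i in iota 0 n]%fset.
have memJ i : (i \in J) = (i < n)%N by rewrite in_fset mem_iota.
have mXA i : measurable (X i @^-1` A i) by apply: measurable_funPTI.
have mB : measurable (\bigcap_(i in [set` J]) (X i @^-1` A i)).
  by apply: bigcap_measurableType => i _.
have -> : (fun w => \prod_(i < n) \1_(A i) (X i w) : R) =
    \1_(\bigcap_(i in [set` J]) (X i @^-1` A i)).
  apply/funext => w; rewrite indicE; case: (pselect (forall i, (i < n)%N -> A i (X i w))) => H.
    rewrite mem_set; last by move=> i /=; rewrite memJ => /H.
    by rewrite big1// => i _; rewrite indicE mem_set//; exact: H.
  rewrite memNset; last by move=> K; apply: H => i lt_i; apply: K; rewrite /= memJ.
  move/existsNP: H => [i /not_implyP[lt_i nA]].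
  by rewrite (bigD1 (Ordinal lt_i))//= indicE memNset// mul0r.
rewrite Rint_indic// indX; last by [].
transitivity (fine (\prod_(i <- J) (\int[P]_x (\1_(A i) x : R))%:E)%E).
  congr fine; apply: eq_bigr => i _; rewrite Rint_indic// fineK ?fin_num_measure//.
  exact: disX.
rewrite -(big_morph EFin EFinM erefl)/=.
rewrite (perm_big (iota 0 n)).
  by rewrite -{1}(subn0 n) -/(index_iota 0 n) big_mkord.
apply: uniq_perm; [exact: fset_uniq|exact: iota_uniq|move=> i].
by rewrite [LHS]memJ mem_iota.
Qed.

(** Indicators are replaced by the functions [h i] one index at a time: in [step m] the first m
    factors are already general. Passing to m + 1 is [Rint_weighted_comp] with the product of all
    other factors as weight. *)
Lemma iid_Rint_prod (n : nat) (h : nat -> T -> R) : (forall i, bmf (h i)) ->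
  \int[Pr]_w (\prod_(i < n) h i (X i w)) = \prod_(i < n) \int[P]_x h i x.
Proof.
move=> bh.
suff step m (A : nat -> set T) : (forall i, measurable (A i)) ->
    \int[Pr]_w (\prod_(i < n) (if (i < m)%N then h i else \1_(A i)) (X i w)) =
    \prod_(i < n) \int[P]_x (if (i < m)%N then h i else \1_(A i)) x.
  have := step n (fun=> setT) (fun=> measurableT).
  under eq_Rintegral do under eq_bigr do rewrite ltn_ord.
  by under [in RHS]eq_bigr do rewrite ltn_ord.
elim: m A => [|m IH] A mA; first exact: iid_Rint_indic_prod.
have [nm|mn] := leqP n m.
  have ltS (i : 'I_n) : (i < m.+1)%N = (i < m)%N.
    by rewrite !(leq_trans (ltn_ord i))// leqW.
  under eq_Rintegral do under eq_bigr do rewrite ltS.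
  under [in RHS]eq_bigr do rewrite ltS.
  exact: IH.
pose i0 := Ordinal mn.
pose F i := if (i < m)%N then h i else \1_(A i).
pose F' i := if (i < m.+1)%N then h i else \1_(A i).
have F'E (i : 'I_n) : i != i0 -> F' i = F i.
  rewrite /F' /F ltnS leq_eqVlt => ne; case: eqP => //= im.
  by move: ne; rewrite -val_eqE/= im eqxx.
have bF i : bmf (F i) by rewrite /F; case: ifP => _ //; exact: bmf_indic.
rewrite [RHS](bigD1 i0)//= ltnSn mulrC.
rewrite (eq_bigr (fun i : 'I_n => \int[P]_x F i x)); last first.
  by move=> i /F'E FE; rewrite -/(F' i) FE.
rewrite -(@Rint_weighted_comp _ _ _ _ _ Pr P
    (fun w => \prod_(i < n | i != i0) F i (X i w)) (X m)) //.
- apply: eq_Rintegral => w _; rewrite (bigD1 i0)//= ltnSn mulrC; congr (_ * _).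
  by apply: eq_bigr => i ii0; move: (F'E i ii0); rewrite /F' => ->.
- rewrite (_ : (fun w => _) = (fun w => \prod_(i < n)
      (if i != i0 then F i (X i w) else 1))); last first.
    by apply/funext => w; rewrite [LHS]big_mkcond.
  apply: bmf_prod => i; case: (i != i0); last exact: bmf_cst.
  exact: bmf_comp.
- move=> B mB.
  (* For an indicator in position m the identity is the induction hypothesis with [A m] replaced by
     [B]; this is why the induction quantifies over [A]. *)
  pose A' i := if i == m then B else A i.
  have mA' i : measurable (A' i) by rewrite /A'; case: ifP.
  have := IH A' mA'.
  have A'm : A' m = B by rewrite /A' eqxx.
  rewrite [in RHS](bigD1 i0)//= ltnn A'm mulrC.
  have A'E (i : 'I_n) : i != i0 -> A' i = A i.
    by rewrite /A' -val_eqE /= => /negbTE ->.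
  rewrite (eq_bigr (fun i : 'I_n => \int[P]_x F i x)); last first.
    by move=> i /A'E ->.
  move=> <-.
  apply: eq_Rintegral => w _; rewrite [in RHS](bigD1 i0)//= ltnn A'm mulrC.
  by congr (_ * _); apply: eq_bigr => i /A'E ->.
Qed.

End iid_product.

Section exponential_moment.
Context {R : realType}.

(** Since e^(-z) >= (1 - z/2)^2, it suffices that (1 - z/2)^2 (1 + z + z^2) = 1 + z^2/4 (1 - 3z +
    z^2) is at least 1. No lower bound on z is required, which later admits the very negative values
    of -e^g. *)
Lemma expR_le_quad (z : R) : z <= 3^-1 -> expR z <= 1 + z + z ^+ 2.
Proof.
move=> z3.
have h1 : (1 - z / 2) ^+ 2 <= expR (- z).
  rewrite (_ : - z = 2%:R * (- z / 2)); last by field.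
  rewrite expRM_natl lerXn2r ?nnegrE ?expR_ge0//; first lra.
  by rewrite (le_trans _ (expR_ge1Dx _))// mulNr.
have h2 : 0 <= 1 + z + z ^+ 2 by nra.
have h3 : 1 <= (1 - z / 2) ^+ 2 * (1 + z + z ^+ 2).
  rewrite (_ : _ ^+ 2 * _ = 1 + z ^+ 2 / 4 * (1 - 3 * z + z ^+ 2)); last by field.
  rewrite lerDl mulr_ge0 ?divr_ge0 ?sqr_ge0//.
  by have := sqr_ge0 z; lra.
rewrite -[leLHS]invrK -expRN invf_ple ?posrE ?expR_gt0//; last by nra.
rewrite -[X in X <= _]mul1r ler_pdivrMr; last by nra.
by apply: (le_trans h3); rewrite ler_wpM2r.
Qed.

Context {d1 d2 : measure_display}.
Context {Omega : measurableType d1} {T : measurableType d2}.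
Variables (Pr : probability Omega R) (X : nat -> {RV Pr >-> T}).
Variables (P : probability T R) (hX : iid_from X P).

(** A Bernstein-type bound: it is one-sided in [W] and involves the second moment rather than the
    range, which is what lets the gap pay for it in [exp_loss_mgf]. *)
Lemma iid_mgf_le (n : nat) (lam : R) (W : T -> R) : bmf W ->
  (forall x, lam * W x <= 3^-1) ->
  \int[Pr]_w expR (lam * \sum_(i < n) (W (X i w) - \int[P]_x W x)) <=
  expR (n%:R * lam ^+ 2 * \int[P]_x (W x) ^+ 2).
Proof.
move=> bW lW.
set m := \int[P]_x W x.
have bh : bmf (fun x => expR (lam * (W x - m))).
  by apply: bmf_expR; apply: bmfZ; apply: bmfB => //; exact: bmf_cst.
have bW2 : bmf (fun x => W x ^+ 2).
  exact: bmf_sqr.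
under eq_Rintegral do rewrite mulr_sumr expR_sum.
rewrite (@iid_Rint_prod _ _ _ _ _ _ _ _ hX n (fun=> _) (fun=> bh)).
rewrite prodr_const card_ord -mulrA expRM_natl.
rewrite lerXn2r ?nnegrE ?expR_ge0//.
  by apply: Rintegral_ge0 => x _; exact: expR_ge0.
have -> : (fun x => expR (lam * (W x - m))) =
    (fun x => expR (- (lam * m)) * expR (lam * W x)).
  by apply/funext => x; rewrite -expRD; congr expR; ring.
rewrite RintZ; last by apply: bmf_expR; exact: bmfZ.
have le1 : \int[P]_x expR (lam * W x) <= 1 + lam * m + lam ^+ 2 * \int[P]_x (W x) ^+ 2.
  rewrite -(Rint_cst P 1) -!RintZ// -!RintD//.
  - apply: le_Rint.
    + by apply: bmf_expR; exact: bmfZ.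
    + apply: bmfD; last exact: bmfZ.
      by apply: bmfD; [exact: bmf_cst|exact: bmfZ].
    + by move=> x; rewrite -exprMn; exact: expR_le_quad.
  all: try exact: bmfZ.
  - by apply: bmfD; [exact: bmf_cst|exact: bmfZ].
  - exact: bmf_cst.
rewrite expRN ler_pdivrMl ?expR_gt0// -expRD.
apply: (le_trans le1); rewrite -addrA; exact: expR_ge1Dx.
Qed.

End exponential_moment.

(** * Networks and their finite nets *)

Section measurable_rV.
Context {R : realType} {d : nat}.

Lemma measurable_coord (j : 'I_d) :
  measurable_fun setT (fun x : borel_rV R d => (x : 'rV[R]_d) 0 j).
Proof.
apply: (measurability _ (RGenOInfty.measurableE R)) => _ [_ [a ->] <-].
rewrite setTI; apply: sub_sigma_algebra.
have co : continuous (fun x : 'rV[R]_d => x 0 j) by exact: coord_continuous.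
have -> : (fun x : 'rV[R]_d => x 0 j) @^-1` `]a, +oo[ =
    (fun x : 'rV[R]_d => x 0 j) @^-1` [set y | a < y].
  by apply/seteqP; split => x /=; rewrite in_itv/= andbT.
by move/continuousP : co; apply; exact: open_gt.
Qed.

Lemma measurable_dotrv (w : 'rV[R]_d) :
  measurable_fun setT (fun x : borel_rV R d => dotrv w x).
Proof.
apply: measurable_sum => j; apply: measurable_funM; first exact: measurable_cst.
exact: measurable_coord.
Qed.

Lemma measurable_cube : measurable (@unit_cube R d : set (borel_rV R d)).
Proof.
have -> : @unit_cube R d = \bigcap_(j in [set: 'I_d])
    [set x : borel_rV R d | 0 <= (x : 'rV[R]_d) 0 j <= 1].
  by apply/seteqP; split => x /= H j => [_|]; exact: H.
apply: fin_bigcap_measurable => // j _.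
have -> : [set x : borel_rV R d | 0 <= (x : 'rV[R]_d) 0 j <= 1] =
   setT `&` (fun x : borel_rV R d => (x : 'rV[R]_d) 0 j) @^-1` `[0, 1].
  by apply/seteqP; split => x /=; rewrite in_itv/=; [split|case].
exact: measurable_coord.
Qed.
End measurable_rV.

Section sigmoid_theory.
Context {R : realType}.
Implicit Types a b : R.

Lemma sigmoid_gt0 a : 0 < sigmoid a.
Proof. by rewrite invr_gt0 ltr_wpDr ?expR_ge0. Qed.

Lemma sigmoid_le1 a : sigmoid a <= 1.
Proof. by rewrite invf_le1 ?lerDl ?expR_ge0// ltr_wpDr ?expR_ge0. Qed.

Lemma norm_sigmoid_le1 a : `|sigmoid a| <= 1.
Proof. by rewrite ger0_norm ?sigmoid_le1// ltW// sigmoid_gt0. Qed.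

Lemma le_sigmoid a b : a <= b -> sigmoid a <= sigmoid b.
Proof.
move=> ab; rewrite lef_pV2 ?posrE ?ltr_wpDr ?expR_ge0//.
by rewrite lerD2l ler_expR lerN2.
Qed.

Lemma sigmoid_lip_le a b : b <= a -> sigmoid a - sigmoid b <= a - b.
Proof.
move=> ba; rewrite /sigmoid.
have eb := expR_gt0 (- b); have ea := expR_gt0 (- a).
have h : 1 - (a - b) <= expR (- a) / expR (- b).
  rewrite -expRN -expRD opprK; apply: le_trans (expR_ge1Dx _); lra.
move: h; rewrite ler_pdivlMr// => h.
have -> : (1 + expR (- a))^-1 - (1 + expR (- b))^-1 =
   (expR (- b) - expR (- a)) / ((1 + expR (- a)) * (1 + expR (- b))).
  by field; rewrite !gt_eqF ?addr_gt0.
rewrite ler_pdivrMr ?mulr_gt0 ?addr_gt0//.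
have c0 : 0 <= a - b by rewrite subr_ge0.
have c1 := mulr_ge0 c0 (ltW ea).
have c2 := mulr_ge0 c1 (ltW eb).
nra.
Qed.

Lemma sigmoid_lip a b : `|sigmoid a - sigmoid b| <= `|a - b|.
Proof.
wlog ba : a b / b <= a.
  by move=> H; case: (leP b a) => [/H//|/ltW /H]; rewrite distrC (distrC b).
rewrite !ger0_norm ?subr_ge0//; last exact: le_sigmoid.
exact: sigmoid_lip_le.
Qed.

Lemma measurable_sigmoid : measurable_fun setT (@sigmoid R).
Proof.
apply: continuous_measurable_fun => x.
apply: cvgV; first by rewrite gt_eqF// ltr_wpDr ?expR_ge0.
apply: cvgD; first exact: cvg_cst.
apply: continuous_comp; first exact: opp_continuous.
exact: continuous_expR.
Qed.
End sigmoid_theory.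

Section network.
Context {R : realType} {d : nat}.

Definition unit_fun (w : 'rV[R]_d) (b : R) (x : 'rV[R]_d) : R :=
  sigmoid (dotrv w x + b).

Definition nn (k : nat) (beta : 'I_k -> R) (w : 'I_k -> 'rV[R]_d) (b : 'I_k -> R)
    (b0 : R) (x : 'rV[R]_d) : R :=
  \sum_(i < k) beta i * unit_fun (w i) (b i) x + b0.

Lemma bmf_unit_fun (w : 'rV[R]_d) (b : R) :
  bmf (unit_fun w b : borel_rV R d -> R).
Proof.
split; last by exists 1 => x; exact: norm_sigmoid_le1.
apply: measurableT_comp; first exact: measurable_sigmoid.
by apply: measurable_funD; [exact: measurable_dotrv|exact: measurable_cst].
Qed.

Lemma bmf_NN (k : nat) (a1 a2 a3 : R) g : @NN R d k a1 a2 a3 g ->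
  bmf (g : borel_rV R d -> R).
Proof.
move=> [beta [w [b [b0 [gE _ _ _ _]]]]].
have -> : g = nn beta w b b0 by apply/funext => x; exact: gE.
apply: bmfD; last exact: bmf_cst.
by apply: bmf_sum => i; apply: bmfZ; exact: bmf_unit_fun.
Qed.

Lemma norm_NN_le (k : nat) (a1 a2 a3 : R) g x : @NN R d k a1 a2 a3 g ->
  `|g x| <= k%:R * a2 + a3.
Proof.
move=> [beta [w [b [b0 [-> _ _ hbeta hb0]]]]].
rewrite (le_trans (ler_normD _ _))// lerD//.
rewrite (le_trans (ler_norm_sum _ _ _))//.
rewrite (@le_trans _ _ (\sum_(i < k) a2))//; last first.
  by rewrite sumr_const card_ord mulr_natl.
apply: ler_sum => i _; rewrite normrM -[leRHS]mulr1.
by apply: ler_pM => //; exact: norm_sigmoid_le1.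
Qed.

Lemma dotrv_diff_cube (w w' x : 'rV[R]_d) (e : R) :
  unit_cube x -> (forall j, `|w 0 j - w' 0 j| <= e) ->
  `|dotrv w x - dotrv w' x| <= d%:R * e.
Proof.
move=> xc we; rewrite /dotrv -sumrB (le_trans (ler_norm_sum _ _ _))//.
rewrite (@le_trans _ _ (\sum_(j < d) e))//; last first.
  by rewrite sumr_const card_ord mulr_natl.
apply: ler_sum => j _; rewrite -mulrBl normrM -[leRHS]mulr1.
apply: ler_pM => //; have /andP[x0 x1] := xc j.
by rewrite ger0_norm.
Qed.

Definition grid_val (m : nat) (a : R) (i : 'I_(2 * m).+1) : R :=
  a * (i%:R - m%:R) / m%:R.

Lemma grid_val_le m a i : 0 <= a -> `|@grid_val m a i| <= a.
Proof.
move=> a0; have := ltn_ord i; rewrite ltnS /grid_val => im.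
case: m i im => [|m] i im.
  by rewrite invr0 mulr0 normr0.
rewrite !normrM -mulrA -[leRHS]mulr1 ger0_norm// ler_wpM2l//.
rewrite normfV ler_pdivrMr ?mul1r ?normr_gt0 ?pnatr_eq0//.
rewrite [leRHS]ger0_norm ?ler0n// ler_norml.
have : (i%:R : R) <= (2 * m.+1)%:R by rewrite ler_nat.
rewrite natrM; have : (0:R) <= i%:R by rewrite ler0n.
by move: (i%:R : R) (m.+1%:R : R) => u v *; lra.
Qed.

Lemma grid_val_approx m a r : (0 < m)%N -> `|r| <= a ->
  exists i, `|r - @grid_val m a i| <= a / m%:R.
Proof.
move=> m0 ra; have a0 : 0 <= a by exact: le_trans ra.
move: (a0); rewrite le_eqVlt => /orP[/eqP a00|apos].
  exists ord0; move: ra; rewrite -a00 normr_le0 => /eqP ->.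
  by rewrite /grid_val !mul0r subr0 normr0.
have m0' : 0 < m%:R :> R by rewrite ltr0n.
pose u := (r / a + 1) * m%:R.
have ra1 : -1 <= r / a <= 1.
  by rewrite ler_pdivlMr// ler_pdivrMr// mulN1r mul1r -ler_norml.
have u0 : 0 <= u by rewrite mulr_ge0 ?ler0n//; lra.
have u2 : u <= (2 * m)%:R.
  by rewrite natrM ler_wpM2r ?ler0n//; lra.
have /andP[nu1 nu2] := truncn_itv u0.
have nlt : (Num.truncn u < (2 * m).+1)%N.
  by rewrite ltnS -(ler_nat R) (le_trans nu1).
exists (Ordinal nlt); rewrite /grid_val/=.
have -> : r - a * ((Num.truncn u)%:R - m%:R) / m%:R = (u - (Num.truncn u)%:R) * (a / m%:R).
  by rewrite /u; field; rewrite !gt_eqF.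
have : 0 <= a / m%:R by rewrite divr_ge0.
move: nu1 nu2; rewrite -natr1.
move: ((Num.truncn u)%:R) (a / _) => v c *.
rewrite normrM (ger0_norm (_ : 0 <= c))// ger0_norm ?subr_ge0//.
by rewrite ler_piMl//; lra.
Qed.

Lemma norm_beta_unit_diff (be be' a1 a2 e1 e2 : R) (w w' : 'rV[R]_d) (b b' : R) x :
  unit_cube x -> `|be' | <= a2 -> `|be - be'| <= e2 ->
  (forall j, `|w 0 j - w' 0 j| <= e1) -> `|b - b'| <= e1 ->
  `|be * unit_fun w b x - be' * unit_fun w' b' x| <= e2 + a2 * (d.+1%:R * e1).
Proof.
move=> xc be'a bee we be1.
have -> : be * unit_fun w b x - be' * unit_fun w' b' x =
  (be - be') * unit_fun w b x + be' * (unit_fun w b x - unit_fun w' b' x) by ring.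
rewrite (le_trans (ler_normD _ _))// lerD//.
  by rewrite normrM -[leRHS]mulr1; apply: ler_pM => //; exact: norm_sigmoid_le1.
rewrite normrM; apply: ler_pM => //.
apply: (le_trans (sigmoid_lip _ _)).
rewrite (_ : _ - _ = (dotrv w x - dotrv w' x) + (b - b')); last by ring.
rewrite (le_trans (ler_normD _ _))// -natr1 mulrDl mul1r lerD//.
exact: dotrv_diff_cube.
Qed.

(** Every parameter is rounded to a grid of 2m + 1 points; a neuron has d + 2 parameters and the
    network one more. On the cube the sigmoid is moved by at most (d + 1) a1 / m, as it is
    1-Lipschitz and coordinates are at most 1. *)
Lemma NN_net (k m : nat) (a1 a2 a3 : R) : (0 < m)%N ->
  0 <= a1 -> 0 <= a2 -> 0 <= a3 ->
  exists (I : finType) (G : I -> 'rV[R]_d -> R),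
    [/\ #|I| = ((2 * m).+1 ^ (k * d.+2).+1)%N,
        forall i, NN k a1 a2 a3 (G i) &
        forall g, NN k a1 a2 a3 g -> exists i, forall x, unit_cube x ->
          `|g x - G i x| <= (k%:R * (a2 + a2 * (d.+1%:R * a1)) + a3) / m%:R].
Proof.
move=> m0 a10 a20 a30.
pose Gr := 'I_(2 * m).+1.
pose I : finType := ({ffun 'I_k -> {ffun 'I_d -> Gr} * Gr * Gr} * Gr)%type.
pose W (p : I) (i : 'I_k) : 'rV[R]_d := \row_j grid_val a1 ((p.1 i).1.1 j).
pose B (p : I) i : R := grid_val a1 (p.1 i).1.2.
pose BE (p : I) i : R := grid_val a2 (p.1 i).2.
pose B0 (p : I) : R := grid_val a3 p.2.
exists I, (fun p => nn (BE p) (W p) (B p) (B0 p)); split.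
- rewrite card_prod card_ffun !card_prod card_ffun !card_ord.
  set q := (2 * m).+1.
  have -> : (q ^ d * q * q = q ^ d.+2)%N by rewrite !expnSr.
  by rewrite -expnM -expnSr (mulnC k).
- move=> p; exists (BE p), (W p), (B p), (B0 p); split => //.
  + by move=> i j; rewrite mxE grid_val_le.
  + by move=> i; rewrite grid_val_le.
  + by move=> i; rewrite grid_val_le.
  + by rewrite grid_val_le.
move=> g [be [w [b [b0 [gE hw hb hbe hb0]]]]].
have /choice[fw hfw] : forall ij : 'I_k * 'I_d, exists q,
    `|w ij.1 0 ij.2 - @grid_val m a1 q| <= a1 / m%:R.
  by move=> [i j]; exact: grid_val_approx.
have /choice[fb hfb] : forall i, exists q, `|b i - @grid_val m a1 q| <= a1 / m%:R.
  by move=> i; exact: grid_val_approx.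
have /choice[fbe hfbe] : forall i, exists q, `|be i - @grid_val m a2 q| <= a2 / m%:R.
  by move=> i; exact: grid_val_approx.
have [fb0 hfb0] := grid_val_approx m0 hb0.
pose p : I := ([ffun i => ([ffun j => fw (i, j)], fb i, fbe i)], fb0).
exists p => x xc.
rewrite gE /nn opprD addrACA mulrDl -sumrB.
rewrite (le_trans (ler_normD _ _))// lerD//.
rewrite (le_trans (ler_norm_sum _ _ _))//.
rewrite (@le_trans _ _ (\sum_(i < k) (a2 / m%:R + a2 * (d.+1%:R * (a1 / m%:R)))))//.
  apply: ler_sum => i _; apply: norm_beta_unit_diff => //.
  - by rewrite grid_val_le.
  - by rewrite /BE ffunE; exact: hfbe.
  - by move=> j; rewrite mxE /p/= ffunE/= ffunE; exact: (hfw (i, j)).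
  - by rewrite /B ffunE; exact: hfb.
rewrite sumr_const card_ord -[X in X <= _]mulr_natl -mulrA ler_wpM2l// mulrDl lerD//.
by rewrite !mulrA.
Qed.

End network.

(** * The log-density as a bounded function, and change of measure *)

Local Open Scope charge_scope.

Section log_density.
Context {R : realType} {d : nat}.
Variables (P Q : probability (borel_rV R d) R).

Lemma measurable_fine_RN : P `<< Q -> measurable_fun setT
  (fun x => fine (('d (charge_of_finite_measure P) '/d Q) x)).
Proof.
move=> PQ; apply: (measurableT_comp (fine_measurable measurableT)).
exact: (measurable_int Q (Radon_Nikodym_integrable (nu := charge_of_finite_measure P) PQ)).
Qed.

Lemma log_ratioE x : P `<< Q -> log_ratio P Q x =
  if fine (('d (charge_of_finite_measure P) '/d Q) x) <= 0 then -oo%E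
  else (ln (fine (('d (charge_of_finite_measure P) '/d Q) x)))%:E.
Proof.
move=> PQ; rewrite /log_ratio.
have := @Radon_Nikodym_fin_num _ _ _ (charge_of_finite_measure P) Q x PQ.
by case: ('d _ '/d _ x) => // r _ /=.
Qed.

Lemma measurable_log_ratio : P `<< Q -> measurable_fun setT (log_ratio P Q).
Proof.
move=> PQ; have mr := measurable_fine_RN PQ.
rewrite (_ : log_ratio P Q = fun x =>
  if fine (('d (charge_of_finite_measure P) '/d Q) x) <= 0 then -oo%E
  else (ln (fine (('d (charge_of_finite_measure P) '/d Q) x)))%:E); last first.
  by apply/funext => x; exact: log_ratioE.
apply: measurable_fun_ifT.
- by apply: measurable_fun_ler => //; exact: measurable_cst.
- exact: measurable_cst.
- apply/measurable_EFinP; apply: measurableT_comp mr; exact: measurable_ln.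
Qed.

Lemma ae_cube : Q (@unit_cube R d) = 1%E -> {ae Q, forall x, @unit_cube R d x}.
Proof.
move=> Q1; exists (~` @unit_cube R d); split => //.
  by apply: measurableC; exact: measurable_cube.
by rewrite probability_setC ?Q1 ?subee//; exact: measurable_cube.
Qed.

(** Since [fKL] is only tied to dP/dQ almost everywhere, [f] is built from the Radon-Nikodym
    derivative itself: its logarithm clipped to [-M, M], which changes it on a Q-null set only and
    makes it bounded and measurable everywhere. *)
Lemma log_density_change (fKL : 'rV[R]_d -> R) (M : R) :
  KL_pair P Q -> is_log_ratio P Q fKL ->
  (forall x, unit_cube x -> `|fKL x| <= M) ->
  exists f : borel_rV R d -> R,
    [/\ bmf f, forall x, `|f x| <= M, {ae Q, forall x, f x = fKL x},
     (forall g : borel_rV R d -> R, bmf g ->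
       \int[P]_x g x = \int[Q]_x (expR (f x) * g x)) &
     KL P Q = (\int[P]_x f x)%:E].
Proof.
move=> [P1 Q1 PQ _] hf fM.
have M0 : 0 <= M.
  have c0 : @unit_cube R d 0 by move=> j; rewrite mxE lexx ler01.
  exact: le_trans (fM _ c0).
pose r x := fine (('d (charge_of_finite_measure P) '/d Q) x).
have mr : measurable_fun setT r := measurable_fine_RN PQ.
have rE x : ('d (charge_of_finite_measure P) '/d Q) x = (r x)%:E.
  by rewrite fineK//; exact: Radon_Nikodym_fin_num.
pose f (x : borel_rV R d) := Num.max (- M) (Num.min M (ln (r x))).
have fleM x : `|f x| <= M.
  rewrite ler_norml /f le_max lexx/= ge_max ge_min lexx/=.
  by rewrite andbT; lra.
have bf : bmf f.
  split; last by exists M.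
  apply: measurable_maxr; first exact: measurable_cst.
  apply: measurable_minr; first exact: measurable_cst.
  by apply: measurableT_comp mr; exact: measurable_ln.
have aefr : {ae Q, forall x, f x = fKL x /\ r x = expR (f x)}.
  move: hf (ae_cube Q1); apply: filterS2 => x.
  rewrite log_ratioE// -/(r x); case: leP => // r0 [lr] xc.
  have fx : f x = fKL x.
    have := fM _ xc; rewrite ler_norml => /andP[h1 h2].
    by rewrite /f lr (min_idPr h2) (max_idPr h1).
  by split => //; rewrite fx -lr lnK.
exists f; split => //.
- by apply: filterS aefr => x [].
- move=> g bg; rewrite -[LHS]mul1r.
  rewrite -(@Rint_weighted_comp _ _ _ _ _ Q P (fun x => expR (f x)) id 1)//.
    exact: bmf_expR.
  move=> A mA; rewrite mul1r Rint_indic//.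
  have -> : P A = charge_of_finite_measure P A by [].
  rewrite (@Radon_Nikodym_integral _ _ _ _ Q)// /Rintegral; congr fine.
  rewrite [RHS]integral_mkcond; apply: ae_eq_integral => //.
  - apply/measurable_EFinP; apply: measurable_funM; first exact: (bmf_expR bf).1.
    exact: measurable_indic.
  - apply/(measurable_restrictT _ mA).
    by apply: (measurable_funS measurableT).
  apply: filterS aefr => x [_ rx] _.
  rewrite patchE indicE; case: ifPn => xA; rewrite ?mulr1 ?mulr0//.
  by rewrite rE rx.
- transitivity (\int[P]_x (f x)%:E)%E; last first.
    by rewrite fineK// integrable_fin_num//; exact: bmf_integrable.
  apply: ae_eq_integral => //.
  + exact: measurable_log_ratio.
  + by apply/measurable_EFinP; exact: bf.1.
  apply: (null_dominates_ae_eq measurableT PQ).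
  by move: hf aefr; apply: filterS2 => x -> [-> _] _.
Qed.

End log_density.

(** * The variational gap and deviations *)

Section penalty.
Context {R : realType} {dT : measure_display} {T : measurableType dT}.
Variables (P Q : probability T R) (f : T -> R).
Hypothesis bf : bmf f.
Hypothesis changePQ : forall g : T -> R, bmf g ->
  \int[P]_x g x = \int[Q]_x (expR (f x) * g x).

Definition gap (g : T -> R) : R :=
  \int[P]_x f x - (\int[P]_x g x - (\int[Q]_x expR (g x) - 1)).

(** The constant 1 is the Q-integral of e^f. Writing it so puts all terms under one integral against
    Q, with integrand e^f times the convexity defect of exp at g - f. *)
Lemma gapE g : bmf g ->
  gap g = \int[Q]_x (expR (f x) * (expR (g x - f x) - 1 - (g x - f x))).
Proof.
move=> bg; have bef := bmf_expR bf; have beg := bmf_expR bg.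
have one : 1 = \int[Q]_x expR (f x).
  rewrite -[LHS](Rint_cst P) changePQ; last exact: bmf_cst.
  by apply: eq_Rintegral => x _; rewrite mulr1.
rewrite /gap [in LHS]one !changePQ// -!RintB//.
- apply: eq_Rintegral => x _.
  have -> : expR (g x) = expR (g x - f x) * expR (f x) by rewrite -expRD subrK.
  ring.
all: by repeat first [assumption | exact: bmfM | apply: bmfB].
Qed.

Let bmf_gap g : bmf g ->
  bmf (fun x => expR (f x) * (expR (g x - f x) - 1 - (g x - f x))).
Proof.
move=> bg; have bgf := bmfB bg bf.
apply: bmfM; first exact: bmf_expR.
by apply: bmfB => //; apply: bmfB; [exact: bmf_expR|exact: bmf_cst].
Qed.

Lemma gap_ge0 g : bmf g -> 0 <= gap g.
Proof.
move=> bg; rewrite gapE//; apply: Rintegral_ge0 => x _.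
rewrite mulr_ge0 ?expR_ge0//; have := expR_ge1Dx (g x - f x); lra.
Qed.

(** Squaring e^(y/2) >= 1 + y/2 and using (1 + t)^2 >= 4t. In the equivalent form e^y <= 2 ((e^y - 1
    - y) + 1) it bounds e^g by twice the integrand of the gap plus e^f. *)
Lemma expR_ge_double (y : R) : 2 * y <= expR y.
Proof.
have [y0|y0] := ltP y 0; first by have := expR_gt0 y; lra.
rewrite (_ : y = 2%:R * (y / 2)) ?expRM_natl; last by field.
have h := expR_ge1Dx (y / 2).
have : (1 + y / 2) ^+ 2 <= expR (y / 2) ^+ 2.
  by rewrite lerXn2r ?nnegrE ?expR_ge0//; lra.
have := sqr_ge0 (1 - y / 2); lra.
Qed.

(* Controls the second moment of e^g, when e^g <= B, by B times the gap: the
   gap subtracted in exp_loss_mgf then pays for the variance. *)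
Lemma int_expR_le_gap g : bmf g -> \int[Q]_x expR (g x) <= 2 * (gap g + 1).
Proof.
move=> bg; have bef := bmf_expR bf; have beg := bmf_expR bg.
have one : 1 = \int[Q]_x expR (f x).
  rewrite -[LHS](Rint_cst P) changePQ; last exact: bmf_cst.
  by apply: eq_Rintegral => x _; rewrite mulr1.
rewrite [X in _ + X]one gapE// -RintD//; last exact: bmf_gap.
rewrite -RintZ; last by apply: bmfD => //; exact: bmf_gap.
apply: le_Rint => //.
  by apply: bmfZ; apply: bmfD => //; exact: bmf_gap.
move=> x.
have -> : expR (g x) = expR (g x - f x) * expR (f x) by rewrite -expRD subrK.
have h := expR_ge_double (g x - f x); have h0 := expR_ge0 (f x).
have : 0 <= expR (f x) * (expR (g x - f x) - 2 * (g x - f x)).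
  by rewrite mulr_ge0// subr_ge0.
lra.
Qed.

(** With y = g - f <= 2K, the defect e^y - 1 - y is at most y^2 when y <= 1/3; otherwise 9 y^2 >= 1
    and e^y <= e^(2K) <= 9 e^(2K) y^2. The factor e^f contributes the third K of the exponent. *)
Lemma gap_le (D : set T) (K : R) g : measurable D -> Q (~` D) = 0%E -> bmf g ->
  0 <= K -> (forall x, D x -> `|f x| <= K /\ `|g x| <= K) ->
  gap g <= 9 * expR (3 * K) * \int[Q]_x (g x - f x) ^+ 2.
Proof.
move=> mD D0 bg K0 fgK.
have b2 : bmf (fun x => (g x - f x) ^+ 2).
  exact: bmf_sqr (bmfB bg bf).
rewrite gapE// -RintZ//; apply: (le_Rint_on mD D0).
- exact: bmf_gap.
- exact: bmfZ.
move=> x /fgK[]; rewrite !ler_norml => /andP[f1 f2] /andP[g1 g2].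
set y := g x - f x.
have yK : y <= 2 * K by rewrite /y; lra.
rewrite (_ : 3 * K = K + 2 * K); last by ring.
rewrite expRD [9 * _]mulrCA -mulrA.
have e2 : 1 <= expR (2 * K) by rewrite -[leLHS]expR0 ler_expR; lra.
apply: ler_pM; rewrite ?expR_ge0//.
- by have := expR_ge1Dx y; lra.
- by rewrite ler_expR.
have [y3|y3] := leP y (3^-1).
  have := expR_le_quad y3; have := sqr_ge0 y; nra.
have h1 : expR y <= expR (2 * K) by rewrite ler_expR.
have h2 : 9^-1 <= y ^+ 2.
  rewrite (_ : 9^-1 = 3^-1 ^+ 2); last by field.
  by rewrite lerXn2r ?nnegrE//; lra.
have : 0 <= expR (2 * K) * (9 * y ^+ 2 - 1) by rewrite mulr_ge0 ?expR_ge0//; lra.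
lra.
Qed.

End penalty.

Section deviation.
Context {R : realType} {d1 d2 : measure_display}.
Context {Omega : measurableType d1} {T : measurableType d2}.
Variables (Pr : probability Omega R) (X Y : nat -> {RV Pr >-> T}).
Variables (P Q : probability T R) (hX : iid_from X P) (hY : iid_from Y Q).

Definition emp_dev (Z : nat -> {RV Pr >-> T}) (mu : probability T R) (n : nat)
    (W : T -> R) (w : Omega) : R :=
  n%:R^-1 * \sum_(i < n) (W (Z i w) - \int[mu]_x W x).

Lemma bmf_emp_dev Z mu n W : bmf W -> bmf (emp_dev Z mu n W).
Proof.
move=> bW; apply: bmfZ; apply: bmf_sum => i.
by apply: bmfB; [exact: bmf_comp|exact: bmf_cst].
Qed.

Lemma emp_devN Z mu n W w : bmf W ->
  emp_dev Z mu n (fun x => - W x) w = - emp_dev Z mu n W w.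
Proof.
move=> bW; rewrite /emp_dev RintN// -mulrN -sumrN; congr (_ * _).
by apply: eq_bigr => i _; rewrite opprB opprK addrC.
Qed.

Lemma emp_dev_mgf (n : nat) (lam H : R) (W : T -> R) : (0 < n)%N -> bmf W ->
  (forall x, `|W x| <= H) -> 0 <= lam -> lam * H <= 3^-1 ->
  \int[Pr]_w expR (n%:R * lam * emp_dev X P n W w) <= expR (n%:R * lam * (lam * H ^+ 2)).
Proof.
move=> n0 bW WH lam0 lamH.
have n0' : n%:R != 0 :> R by rewrite pnatr_eq0 -lt0n.
have cancel (S : R) : n%:R * lam * (n%:R^-1 * S) = lam * S by field.
under eq_Rintegral do rewrite /emp_dev cancel.
apply: (le_trans (iid_mgf_le hX n bW _)).
  by move=> x; apply: le_trans lamH; rewrite ler_wpM2l// (le_trans (ler_norm _)).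
rewrite ler_expR expr2 (mulrA n%:R) -mulrA ler_wpM2l ?mulr_ge0// ler_wpM2l//.
rewrite -[leRHS](Rint_cst P); apply: le_Rint; last 1 first.
- move=> x; rewrite -[leLHS]ger0_norm ?sqr_ge0// normrX lerXn2r ?nnegrE//.
  exact: le_trans (WH x).
- exact: bmf_sqr.
- exact: bmf_cst.
Qed.

(** The variable -e^g is nonpositive, so [iid_mgf_le] applies whatever the size of g. Its second
    moment is at most 2 B (gap + 1), and the exponent n lam (2 lam B (gap + 1) - gap) loses its
    dependence on the gap once 2 lam B <= 1. *)
Lemma exp_loss_mgf (n : nat) (lam B : R) (f g : T -> R) : (0 < n)%N ->
  bmf f -> (forall h : T -> R, bmf h ->
    \int[P]_x h x = \int[Q]_x (expR (f x) * h x)) ->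
  bmf g -> (forall x, expR (g x) <= B) -> 0 <= lam -> 2 * lam * B <= 1 ->
  \int[Pr]_w expR (n%:R * lam *
      (emp_dev Y Q n (fun x => - expR (g x)) w - gap P Q f g))
  <= expR (n%:R * lam * (2 * lam * B)).
Proof.
move=> n0 bf PQ bg gB lam0 lamB.
have n0' : n%:R != 0 :> R by rewrite pnatr_eq0 -lt0n.
have beg := bmf_expR bg; have bneg := bmfN beg.
have cancel (S : R) : n%:R * lam * (n%:R^-1 * S) = lam * S by field.
under eq_Rintegral do rewrite mulrBr /emp_dev cancel addrC expRD.
rewrite RintZ; last first.
  apply: bmf_expR; apply: bmfZ; apply: bmf_sum => i.
  by apply: bmfB; [apply: (bmf_comp (fun x => - expR (g x)))|exact: bmf_cst].
apply: (@le_trans _ _ (expR (- (n%:R * lam * gap P Q f g)) *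
    expR (n%:R * lam ^+ 2 * \int[Q]_x (- expR (g x)) ^+ 2))).
  rewrite ler_wpM2l ?expR_ge0//; apply: (iid_mgf_le hY n bneg) => x.
  rewrite mulrN (le_trans (_ : _ <= 0))// oppr_le0 mulr_ge0// expR_ge0.
rewrite -expRD ler_expR.
have I1 : \int[Q]_x (- expR (g x)) ^+ 2 <= B * (2 * (gap P Q f g + 1)).
  apply: le_trans (_ : B * \int[Q]_x expR (g x) <= _).
    rewrite -RintZ//; apply: le_Rint.
    - by under eq_fun do rewrite sqrrN expr2; exact: bmfM.
    - exact: bmfZ.
    - by move=> x; rewrite sqrrN expr2 ler_wpM2r ?expR_ge0.
  rewrite ler_wpM2l//; last exact: int_expR_le_gap.
  exact: le_trans (expR_ge0 _) (gB point).
have gap0 := gap_ge0 bf PQ bg.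
set I := \int[Q]_x (- expR (g x)) ^+ 2 in I1 *.
set G := gap P Q f g in I1 gap0 *.
rewrite (_ : _ + _ = n%:R * lam * (lam * I - G)); last by ring.
rewrite ler_wpM2l ?mulr_ge0//.
apply: le_trans (_ : lam * (B * (2 * (G + 1))) - G <= _).
  by rewrite lerB// ler_wpM2l.
have : 0 <= G * (1 - 2 * lam * B) by rewrite mulr_ge0// subr_ge0.
lra.
Qed.

End deviation.

(** * Union bounds for finite families *)

Section union_bound.
Context {R : realType} {d : measure_display} {Omega : measurableType d}.
Variable Pr : probability Omega R.

(** The shift c is left free: the bound in expectation takes the c that cancels the exponent, the
    tail bound takes the tolerated deviation. *)
Lemma int_sum_expR_le (I : finType) (Z : I -> Omega -> R) (s e L c : R) :
  (forall i, bmf (Z i)) -> (#|I|%:R <= expR L) ->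
  (forall i, \int[Pr]_w expR (s * Z i w) <= expR (s * e)) ->
  \int[Pr]_w (\sum_(i : I) expR (s * (Z i w - c))) <= expR (L + s * e - s * c).
Proof.
move=> bZ IL He.
rewrite Rint_sum; last first.
  by move=> i; apply: bmf_expR; apply: bmfZ; apply: bmfB => //; exact: bmf_cst.
apply: (@le_trans _ _ (\sum_(i : I) expR (s * e - s * c))).
  apply: ler_sum => i _.
  under eq_Rintegral do rewrite mulrBr addrC expRD.
  rewrite RintZ; last by apply: bmf_expR; exact: bmfZ.
  by rewrite [s * e - _]addrC expRD ler_wpM2l ?expR_ge0.
rewrite sumr_const -[X in X <= _]mulr_natl -(addrA L) [leRHS]expRD.
by rewrite ler_wpM2r ?expR_ge0.
Qed.

(* Uses x <= e^x instead of integrating the tail. *)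
Lemma expected_sup_le (I : finType) (Z : I -> Omega -> R) (s e L : R) :
  0 < s -> 0 <= s * e + L ->
  (forall i, bmf (Z i)) -> (#|I|%:R <= expR L) ->
  (forall i, \int[Pr]_w expR (s * Z i w) <= expR (s * e)) ->
  exists U : Omega -> R, [/\ bmf U, forall w, 0 <= U w, forall i w, Z i w <= U w &
    \int[Pr]_w U w <= e + (L + 1) / s].
Proof.
move=> s0 eL bZ IL He.
have s0' : s != 0 by rewrite gt_eqF.
(* With this c the exponent L + s e - s c vanishes, so the sum of exponentials has integral at most
   1 and contributes 1 / s. *)
pose c := e + L / s.
have c0 : 0 <= c.
  by rewrite /c -(pmulr_rge0 _ s0) mulrDr mulrCA mulfV ?mulr1 ?gt_eqF.
exists (fun w => c + s^-1 * \sum_(i : I) expR (s * (Z i w - c))).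
have bS : bmf (fun w => \sum_(i : I) expR (s * (Z i w - c))).
  apply: bmf_sum => i; apply: bmf_expR; apply: bmfZ; apply: bmfB => //.
  exact: bmf_cst.
split.
- by apply: bmfD; [exact: bmf_cst|exact: bmfZ].
- move=> w; rewrite addr_ge0// mulr_ge0 ?invr_ge0 ?(ltW s0)//.
  by apply: sumr_ge0 => i _; exact: expR_ge0.
- move=> i w; rewrite -lerBlDl.
  rewrite -[leLHS](mulKf s0') ler_wpM2l ?invr_ge0 ?(ltW s0)//.
  rewrite (bigD1 i)//=; apply: ler_wpDr.
    by apply: sumr_ge0 => j _; exact: expR_ge0.
  have := expR_ge1Dx (s * (Z i w - c)); lra.
rewrite RintD; [|exact: bmf_cst|exact: bmfZ].
rewrite Rint_cst RintZ// /c -addrA lerD2l mulrDl lerD2l mul1r -[leRHS]mulr1.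
rewrite ler_wpM2l ?invr_ge0 ?(ltW s0)//.
apply: (le_trans (int_sum_expR_le c bZ IL He)).
by rewrite -[leRHS]expR0 ler_expR /c mulrDr mulrCA mulfV ?mulr1 ?gt_eqF//; lra.
Qed.

End union_bound.

(** * The estimator and its reduction to a finite net *)

Section estimator.
Context {R : realType} {d : nat}.
Variables (P Q : probability (borel_rV R d) R).
Context {disp : measure_display} {Omega : measurableType disp}.
Variables (Pr : probability Omega R) (X Y : nat -> {RV Pr >-> borel_rV R d}).
Hypotheses (hX : iid_from X P) (hY : iid_from Y Q).
Variable f : borel_rV R d -> R.
Hypothesis bf : bmf f.
Hypothesis changePQ : forall g : borel_rV R d -> R, bmf g ->
  \int[P]_x g x = \int[Q]_x (expR (f x) * g x).

Definition emp_obj (n : nat) (g : 'rV[R]_d -> R) (x y : nat -> 'rV[R]_d) : R :=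
  n%:R^-1 * \sum_(i < n) (g (x i) - (expR (g (y i)) - 1)).

(** The gap is grouped with the Y-deviation because [exp_loss_mgf] bounds exactly that
    difference. *)
Lemma emp_objE (n : nat) (g : borel_rV R d -> R) w : (0 < n)%N -> bmf g ->
  emp_obj n g (X ^~ w) (Y ^~ w) = \int[P]_x f x + emp_dev X P n g w +
    (emp_dev Y Q n (fun x => - expR (g x)) w - gap P Q f g).
Proof.
move=> n0 bg; have n0' : n%:R != 0 :> R by rewrite pnatr_eq0 -lt0n.
rewrite /emp_obj /emp_dev /gap RintN; last exact: bmf_expR.
set mX := \int[P]_x g x; set mY := \int[Q]_x expR (g x).
pose SX := \sum_(i < n) g (X i w); pose SY := \sum_(i < n) expR (g (Y i w)).
have cst (c : R) : \sum_(i < n) c = n%:R * c by rewrite sumr_const card_ord mulr_natl.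
have -> : \sum_(i < n) (g (X i w) - (expR (g (Y i w)) - 1)) = SX - (SY - n%:R).
  by rewrite sumrB sumrB cst mulr1.
have -> : \sum_(i < n) (g (X i w) - mX) = SX - n%:R * mX.
  by rewrite sumrB cst.
have -> : \sum_(i < n) (- expR (g (Y i w)) - - mY) = - SY - - (n%:R * mY).
  by rewrite sumrB sumrN cst mulrN.
by field.
Qed.

Lemma ae_samples_cube (Z : nat -> {RV Pr >-> borel_rV R d}) (mu : probability (borel_rV R d) R) :
  iid_from Z mu -> mu (@unit_cube R d) = 1%E ->
  {ae Pr, forall w, forall i, @unit_cube R d (Z i w)}.
Proof.
move=> [_ disZ] mu1; apply/ae_foralln => i.
exists (Z i @^-1` (~` @unit_cube R d)); split => //.
- by apply: measurable_funPTI; apply: measurableC; exact: measurable_cube.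
- have := disZ i _ (measurableC measurable_cube).
  rewrite /distribution/= /pushforward => ->.
  by rewrite probability_setC ?mu1 ?subee//; exact: measurable_cube.
Qed.

Lemma expR_lip (H a b : R) : a <= H -> b <= H -> `|expR a - expR b| <= expR H * `|a - b|.
Proof.
wlog ab : a b / b <= a.
  by move=> h aH bH; case: (leP b a) => [/h|/ltW/h]; [|rewrite distrC (distrC b)]; exact.
move=> aH _; rewrite !ger0_norm ?subr_ge0 ?ler_expR//.
apply: (@le_trans _ _ (expR a * (a - b))); last by rewrite ler_wpM2r ?subr_ge0 ?ler_expR.
have -> : expR b = expR a * expR (b - a) by rewrite -expRD addrC subrK.
have := expR_ge1Dx (b - a); have := expR_gt0 a.
by move: (expR a) (expR _) => u v; nra.
Qed.

Lemma emp_obj_lip (n : nat) (g g' : 'rV[R]_d -> R) (x y : nat -> 'rV[R]_d) (H delta : R) :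
  (0 < n)%N -> (forall i, unit_cube (x i)) -> (forall i, unit_cube (y i)) ->
  (forall z, g z <= H) -> (forall z, g' z <= H) ->
  (forall z, unit_cube z -> `|g z - g' z| <= delta) ->
  emp_obj n g x y <= emp_obj n g' x y + (1 + expR H) * delta.
Proof.
move=> n0 xc yc gH g'H gg'; have n0' : n%:R != 0 :> R by rewrite pnatr_eq0 -lt0n.
rewrite -lerBlDl /emp_obj -mulrBr -sumrB ler_pdivrMl ?ltr0n//.
apply: (@le_trans _ _ (\sum_(i < n) ((1 + expR H) * delta))); last first.
  by rewrite sumr_const card_ord mulr_natl.
apply: ler_sum => i _.
have h1 := le_trans (ler_norm _) (gg' _ (xc i)).
have h2 := expR_lip (g'H (y i)) (gH (y i)).
have h3 := gg' _ (yc i); rewrite distrC in h3.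
have h4 := le_trans h2 (ler_wpM2l (expR_ge0 H) h3).
have := le_trans (ler_norm _) h4; lra.
Qed.

Lemma KL_estimator_ge (G : set ('rV[R]_d -> R)) n g x y : G g ->
  ((emp_obj n g x y)%:E <= KL_estimator G n x y)%E.
Proof. by move=> Gg; apply: ereal_sup_ubound; exists g. Qed.

Lemma KL_estimator_le (G : set ('rV[R]_d -> R)) n x y (c : R) :
  (forall g, G g -> emp_obj n g x y <= c) -> (KL_estimator G n x y <= c%:E)%E.
Proof. by move=> h; apply: ge_ereal_sup => _ [g Gg <-]; rewrite lee_fin; exact: h. Qed.

Lemma emp_obj_le (n : nat) (g : 'rV[R]_d -> R) (x y : nat -> 'rV[R]_d) (H : R) :
  (0 < n)%N -> (forall z, `|g z| <= H) -> `|emp_obj n g x y| <= H + expR H + 1.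
Proof.
move=> n0 gH; rewrite /emp_obj normrM normfV normr_nat ler_pdivrMl ?ltr0n//.
apply: (le_trans (ler_norm_sum _ _ _)).
apply: (@le_trans _ _ (\sum_(i < n) (H + expR H + 1))); last first.
  by rewrite sumr_const card_ord mulr_natl.
apply: ler_sum => i _.
have := gH (x i); rewrite !ler_norml => /andP[h1 h2].
have /(le_trans (ler_norm _)) h3 := gH (y i).
have h4 : expR (g (y i)) <= expR H by rewrite ler_expR.
have := expR_gt0 (g (y i)); have := expR_gt0 H => *; apply/andP; split; lra.
Qed.

(** One condition on lam serves both samples: the first conclusion is what [emp_dev_mgf] asks for,
    the second what [exp_loss_mgf] asks for. *)
Lemma small_rate (lam H : R) : 0 < lam -> 0 <= H -> 3 * lam * expR H <= 1 ->
  lam * H <= 3^-1 /\ 2 * lam * expR H <= 1.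
Proof.
move=> lam0 H0 lamH; have h := expR_ge_double H.
have h1 : lam * (2 * H) <= lam * expR H by rewrite ler_wpM2l// ltW.
have h2 : 0 <= lam * H by rewrite mulr_ge0// ltW.
have h3 : 0 < lam * expR H by rewrite mulr_gt0 ?expR_gt0.
by split; lra.
Qed.

Section deviation_NN.
Variables (k n m : nat) (a1 a2 a3 lam L : R).
Hypotheses (n0 : (0 < n)%N) (m0 : (0 < m)%N).
Hypotheses (a10 : 0 <= a1) (a20 : 0 <= a2) (a30 : 0 <= a3).
Let H := k%:R * a2 + a3.
Let delta := (k%:R * (a2 + a2 * (d.+1%:R * a1)) + a3) / m%:R.
Hypotheses (lam0 : 0 < lam) (lamH : 3 * lam * expR H <= 1).
Hypothesis cardL : ((2 * m).+1 ^ (k * d.+2).+1)%:R <= expR L.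

Let H0 : 0 <= H. Proof. by rewrite addr_ge0// mulr_ge0. Qed.

Let lamH3 : lam * H <= 3^-1. Proof. exact: (small_rate lam0 H0 lamH).1. Qed.

Let lamB : 2 * lam * expR H <= 1. Proof. exact: (small_rate lam0 H0 lamH).2. Qed.

(* The net reduces the supremum over the network class to finitely many
   exponential moments, simultaneously for the X- and the Y-sample. *)
Lemma NN_net_mgf : exists (I : finType) (G : I -> 'rV[R]_d -> R),
  [/\ #|I|%:R <= expR L,
      forall i, NN k a1 a2 a3 (G i),
      forall i, \int[Pr]_w expR (n%:R * lam * emp_dev X P n (G i) w) <=
        expR (n%:R * lam * (lam * H ^+ 2)),
      forall i, \int[Pr]_w expR (n%:R * lam *
        (emp_dev Y Q n (fun x => - expR (G i x)) w - gap P Q f (G i))) <=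
        expR (n%:R * lam * (2 * lam * expR H)) &
      forall x y c1 c2, (forall i, unit_cube (x i)) -> (forall i, unit_cube (y i)) ->
        (forall i, emp_obj n (G i) x y <= \int[P]_x f x + c1 + c2) ->
        (KL_estimator (NN k a1 a2 a3) n x y <=
          (\int[P]_x f x + c1 + c2 + (1 + expR H) * delta)%:E)%E].
Proof.
have [I [G [cI GN net]]] := @NN_net R d k m a1 a2 a3 m0 a10 a20 a30.
exists I, G; split => //.
- by rewrite cI.
- move=> i; apply: (emp_dev_mgf hX n0 (bmf_NN (GN i)) _ (ltW lam0) lamH3).
  by move=> x; exact: norm_NN_le (GN i).
- move=> i; apply: (exp_loss_mgf hY n0 bf changePQ (bmf_NN (GN i)) _ (ltW lam0) lamB).
  by move=> x; rewrite ler_expR (le_trans (ler_norm _))//; exact: norm_NN_le (GN i).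
- move=> x y c1 c2 xc yc h; apply: KL_estimator_le => g Gg.
  have [i gi] := net _ Gg.
  have gH z : g z <= H by rewrite (le_trans (ler_norm _))//; exact: norm_NN_le Gg.
  have GH z : G i z <= H by rewrite (le_trans (ler_norm _))//; exact: norm_NN_le (GN i).
  apply: (le_trans (emp_obj_lip n0 xc yc gH GH gi)).
  by rewrite lerD2r.
Qed.

End deviation_NN.

End estimator.

(** * Domination by bounded variables and Borel-Cantelli *)

Section dominated_integral.
Context {R : realType} {d : measure_display} {Omega : measurableType d}.
Variable Pr : probability Omega R.
Import HBNNSimple.

(* [F] is not assumed measurable: the integral of a nonnegative function is a
   supremum over the simple functions below it. *)
Lemma integral_le_ae_bmf (F : Omega -> \bar R) (U : Omega -> R) :
  (forall w, 0 <= F w)%E -> bmf U -> (forall w, 0 <= U w) ->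
  {ae Pr, forall w, (F w <= (U w)%:E)%E} ->
  (\int[Pr]_w F w <= (\int[Pr]_w U w)%:E)%E.
Proof.
move=> F0 bU U0 FU; rewrite ge0_integralTE//.
apply: ge_ereal_sup => _ [h hF <-].
rewrite -integralT_nnsfun /Rintegral fineK; last first.
  by rewrite integrable_fin_num//; exact: bmf_integrable.
apply: ae_ge0_le_integral => //.
- by move=> w _; rewrite lee_fin; exact: fun_ge0.
- by apply/measurable_EFinP; exact: measurable_funPT.
- by move=> w _; rewrite lee_fin.
- by apply/measurable_EFinP; exact: bU.1.
- by apply: filterS FU => w FUw _; exact: le_trans (hF w) FUw.
Qed.

Lemma prob_ge1_le (V : Omega -> R) : bmf V -> (forall w, 0 <= V w) ->
  measurable [set w | 1 <= V w] /\ (Pr [set w | (1 <= V w)%R] <= (\int[Pr]_w V w)%:E)%E.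
Proof.
move=> bV V0; have mA : measurable [set w | 1 <= V w].
  by rewrite -[X in measurable X]setTI; apply: measurable_fun_le => //; exact: bV.1.
split=> //; rewrite -[leLHS]fineK ?fin_num_measure// lee_fin -Rint_indic//.
apply: le_Rint => //; first exact: bmf_indic.
by move=> w; rewrite indicE; case: (boolP (_ \in _)) => // /set_mem.
Qed.

(** The bound 1/((n+1)(n+2)) is chosen because its partial sums telescope to 1 - 1/(n+1). *)
Lemma nneseries_le1 (p : nat -> \bar R) (N : nat) :
  (forall n, 0 <= p n)%E -> (forall n, (n < N)%N -> p n = 0%E) ->
  (forall n, (N <= n)%N -> p n <= ((n.+1 * n.+2)%:R^-1)%:E)%E ->
  (\sum_(0 <= n <oo) p n < +oo)%E.
Proof.
move=> p0 pN pn.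
have H n : (\sum_(0 <= i < n) p i <= (1 - n.+1%:R^-1)%:E)%E.
  elim: n => [|n IH]; first by rewrite big_nil invr1 subrr.
  rewrite big_nat_recr//=.
  apply: (@le_trans _ _ ((1 - n.+1%:R^-1)%:E + ((n.+1 * n.+2)%:R^-1)%:E)%E).
    apply: leeD => //; have [nN|nN] := ltnP n N; last exact: pn.
    by rewrite pN// lee_fin.
  rewrite -EFinD lee_fin natrM.
  rewrite -(natr1 n.+1); have : 0 < n.+1%:R :> R by rewrite ltr0n.
  move: (n.+1%:R : R) => a a0.
  rewrite le_eqVlt; apply/orP; left; apply/eqP; field.
  by rewrite !gt_eqF// addr_gt0.
apply: (@le_lt_trans _ _ 1%:E); last by rewrite ltry.
apply: lime_le; first exact: is_cvg_nneseries.
apply: nearW => n; apply: (le_trans (H n)); rewrite lee_fin.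
by rewrite gerBl.
Qed.

(** Markov's inequality followed by Borel-Cantelli. The events with n < N, for which no bound is
    available, are replaced by the empty set; this does not affect the limit superior. *)
Lemma ae_eventually_lt1 (V : nat -> Omega -> R) (N : nat) :
  (forall n, bmf (V n)) -> (forall n w, 0 <= V n w) ->
  (forall n, (N <= n)%N -> \int[Pr]_w V n w <= (n.+1 * n.+2)%:R^-1) ->
  {ae Pr, forall w, exists M, forall n, (M <= n)%N -> V n w < 1}.
Proof.
move=> bV V0 HV.
pose F n := if (n < N)%N then set0 else [set w | 1 <= V n w].
have mF n : measurable (F n).
  by rewrite /F; case: ifP => // _; exact: (prob_ge1_le (bV n) (V0 n)).1.
have sumF : (\sum_(0 <= n <oo) Pr (F n) < +oo)%E.
  apply: (@nneseries_le1 _ N) => [n|n nN|n Nn]; first exact: measure_ge0.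
    by rewrite /F nN measure0.
  rewrite /F ltnNge Nn/=.
  by apply: (le_trans (prob_ge1_le (bV n) (V0 n)).2); rewrite lee_fin HV.
have L := lim_sup_set_cvg0 mF sumF.
exists (lim_sup_set F); split => //.
  by apply: bigcap_measurable => // n _; apply: bigcup_measurable => k _; exact: mF.
move=> w; rewrite /lim_sup_set => nM n _; apply: contrapT => nF.
apply: nM; exists (maxn n N) => k; rewrite geq_max => /andP[nk Nk].
rewrite ltNge; apply/negP => Vk; apply: nF; exists k => //.
by rewrite /F ltnNge Nk.
Qed.

End dominated_integral.

(** * The error in expectation *)

Section error_bounds.
Context {R : realType} {d : nat}.
Variables (P Q : probability (borel_rV R d) R).
Context {disp : measure_display} {Omega : measurableType disp}.
Variables (Pr : probability Omega R) (X Y : nat -> {RV Pr >-> borel_rV R d}).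
Hypotheses (hX : iid_from X P) (hY : iid_from Y Q).
Hypotheses (P1 : P (@unit_cube R d) = 1%E) (Q1 : Q (@unit_cube R d) = 1%E).
Variable f : borel_rV R d -> R.
Hypothesis bf : bmf f.
Hypothesis changePQ : forall g : borel_rV R d -> R, bmf g ->
  \int[P]_x g x = \int[Q]_x (expR (f x) * g x).

Let D := \int[P]_x f x.

(** [U1] and [U2] dominate the deviations over the net and control the excess above D; [U3] and [U4]
    dominate those of the single network g and control the shortfall. The latter two reuse
    [expected_sup_le] on a one-element family with L = 0, whence 2L + 4 = 2 (L + 1) + 2. The bound
    H' of g is kept apart from H because it enters through e^(2H'). *)
Lemma expected_error_le (k n m : nat) (a1 a2 a3 lam L : R) (g : 'rV[R]_d -> R) (H' gam : R) :
  (0 < n)%N -> (0 < m)%N -> 0 <= a1 -> 0 <= a2 -> 0 <= a3 -> 0 < lam -> 0 <= L ->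
  let H := k%:R * a2 + a3 in
  let delta := (k%:R * (a2 + a2 * (d.+1%:R * a1)) + a3) / m%:R in
  3 * lam * expR H <= 1 ->
  ((2 * m).+1 ^ (k * d.+2).+1)%:R <= expR L ->
  NN k a1 a2 a3 g -> (forall x, `|g x| <= H') -> H' <= H -> gap P Q f g <= gam ->
  (\int[Pr]_w `|KL_estimator (NN k a1 a2 a3) n (X ^~ w) (Y ^~ w) - D%:E|
   <= (gam + lam * (H ^+ 2 + 2 * expR H + H' ^+ 2 + expR H' ^+ 2) +
       (2 * L + 4) / (n%:R * lam) + (1 + expR H) * delta)%:E)%E.
Proof.
move=> n0 m0 a10 a20 a30 lam0 L0 H delta lamH cardL Gg gH' H'H gapg.
have [I [G [cI GN mX mY net]]] :=
  @NN_net_mgf R d P Q _ _ Pr X Y hX hY f bf changePQ k n m a1 a2 a3 lam L n0 m0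
    a10 a20 a30 lam0 lamH cardL.
have s0 : 0 < n%:R * lam by rewrite mulr_gt0// ltr0n.
have bg := bmf_NN Gg.
have bG i := bmf_NN (GN i).
have H'0 : 0 <= H' by exact: le_trans (gH' 0).
have H0 : 0 <= H by exact: le_trans H'H.
have lamH' : 3 * lam * expR H' <= 1.
  by apply: le_trans lamH; rewrite ler_wpM2l ?ler_expR// mulr_ge0// ltW.
have [lH'3 lB'] := small_rate lam0 H'0 lamH'.
have [U1 [bU1 U10 leU1 iU1]] : exists U : Omega -> R, [/\ bmf U, forall w, 0 <= U w,
    forall i w, emp_dev X P n (G i) w <= U w &
    \int[Pr]_w U w <= lam * H ^+ 2 + (L + 1) / (n%:R * lam)].
  apply: expected_sup_le => //.
    by rewrite addr_ge0// !mulr_ge0 ?sqr_ge0// ltW.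
  by move=> i; exact: bmf_emp_dev.
have [U2 [bU2 U20 leU2 iU2]] : exists U : Omega -> R, [/\ bmf U, forall w, 0 <= U w,
    forall i w, emp_dev Y Q n (fun x => - expR (G i x)) w - gap P Q f (G i) <= U w &
    \int[Pr]_w U w <= 2 * lam * expR H + (L + 1) / (n%:R * lam)].
  apply: (expected_sup_le (Z := fun i w =>
    emp_dev Y Q n (fun x => - expR (G i x)) w - gap P Q f (G i))) => //.
    by rewrite addr_ge0// !mulr_ge0 ?expR_ge0// ltW.
  move=> i; apply: bmfB; last exact: bmf_cst.
  by apply: bmf_emp_dev; apply: bmfN; exact: bmf_expR.
have [U3 [bU3 U30 leU3 iU3]] : exists U : Omega -> R, [/\ bmf U, forall w, 0 <= U w,
    forall (i : 'I_1) w, emp_dev X P n (fun x => - g x) w <= U w &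
    \int[Pr]_w U w <= lam * H' ^+ 2 + (0 + 1) / (n%:R * lam)].
  apply: expected_sup_le => //.
  - by rewrite addr_ge0// !mulr_ge0 ?sqr_ge0// ltW.
  - by move=> i; apply: bmf_emp_dev; exact: bmfN.
  - by rewrite card_ord expR0.
  - move=> _; apply: (emp_dev_mgf hX n0 (bmfN bg)) => //; last exact: ltW.
    by move=> x; rewrite normrN.
have [U4 [bU4 U40 leU4 iU4]] : exists U : Omega -> R, [/\ bmf U, forall w, 0 <= U w,
    forall (i : 'I_1) w, emp_dev Y Q n (fun x => expR (g x)) w <= U w &
    \int[Pr]_w U w <= lam * expR H' ^+ 2 + (0 + 1) / (n%:R * lam)].
  apply: expected_sup_le => //.
  - by rewrite addr_ge0// !mulr_ge0 ?sqr_ge0// ltW.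
  - by move=> i; apply: bmf_emp_dev; exact: bmf_expR.
  - by rewrite card_ord expR0.
  - move=> _; apply: (emp_dev_mgf hY n0 (bmf_expR bg)) => //; last 2 first.
    + exact: ltW.
    + have : 0 < lam * expR H' by rewrite mulr_gt0 ?expR_gt0.
      lra.
    + by move=> x; rewrite ger0_norm ?expR_ge0// ler_expR (le_trans (ler_norm _)).
have gam0 : 0 <= gam by apply: le_trans gapg; exact: gap_ge0.
have delta0 : 0 <= (1 + expR H) * delta.
  apply: mulr_ge0; first by rewrite addr_ge0 ?expR_ge0.
  by rewrite divr_ge0// addr_ge0// mulr_ge0// addr_ge0// !mulr_ge0.
pose U w := U1 w + U2 w + U3 w + U4 w + (gam + (1 + expR H) * delta).
have bU : bmf U by repeat (apply: bmfD => //); exact: bmf_cst.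
apply: (@le_trans _ _ (\int[Pr]_w U w)%:E); last first.
  rewrite lee_fin /U !RintD//; last 7 first.
  all: try exact: bmf_cst.
  all: try by repeat (apply: bmfD => //).
  rewrite !Rint_cst (_ : (2 * L + 4) / (n%:R * lam) =
    (L + 1) / (n%:R * lam) + (L + 1) / (n%:R * lam) + ((0 + 1) / (n%:R * lam) +
     (0 + 1) / (n%:R * lam))); last by rewrite -!mulrDl; congr (_ / _); ring.
  lra.
apply: integral_le_ae_bmf => //.
- by move=> w; rewrite !addr_ge0//.
move: (ae_samples_cube hX P1) (ae_samples_cube hY Q1); apply: filterS2 => w Xc Yc.
have lo : ((D - (U w))%:E <= KL_estimator (NN k a1 a2 a3) n (X ^~ w) (Y ^~ w))%E.
  apply: le_trans (KL_estimator_ge _ _ _ Gg).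
  rewrite lee_fin (emp_objE P Q X Y f w n0 bg).
  have := leU3 ord0 w; have := leU4 ord0 w.
  rewrite emp_devN// (emp_devN _ _ _ _ (bmf_expR bg)).
  have := U10 w; have := U20 w; rewrite /U /D; lra.
have up : (KL_estimator (NN k a1 a2 a3) n (X ^~ w) (Y ^~ w) <= (D + U w)%:E)%E.
  apply: (le_trans (net _ _ (U1 w) (U2 w) Xc Yc _)).
    move=> i; rewrite (emp_objE P Q X Y f w n0 (bG i)).
    have := leU1 i w; have := leU2 i w; lra.
  rewrite lee_fin /U -/D; have := U30 w; have := U40 w; rewrite -/H -/delta /D; lra.
move: lo up; case: (KL_estimator _ _ _ _) => [r| |] //=.
rewrite !lee_fin => lo up; rewrite ler_norml; apply/andP; split; lra.
Qed.

End error_bounds.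

(** * The error almost surely *)

Lemma four_quarters {R : realType} (q v1 v2 v3 v4 : R) :
  v1 <= q / 4 -> v2 <= q / 4 -> v3 <= q / 4 -> v4 <= q / 4 ->
  v1 + v2 + v3 + v4 <= q.
Proof. lra. Qed.

Lemma lower_arith {R : realType} (D gam e a b c : R) :
  - a < e -> b < e -> c <= gam -> D - gam - 2 * e <= D + a + (- b - c).
Proof. lra. Qed.

Lemma upper_arith {R : realType} (D e t : R) : t <= e -> D + e + e + t <= D + 3 * e.
Proof. lra. Qed.

Lemma four_lt1 {R : realType} (v1 v2 v3 v4 : R) :
  0 <= v1 -> 0 <= v2 -> 0 <= v3 -> 0 <= v4 -> v1 + v2 + v3 + v4 < 1 ->
  [/\ v1 < 1, v2 < 1, v3 < 1 & v4 < 1].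
Proof. by move=> *; split; lra. Qed.

Section almost_sure.
Context {R : realType} {d : nat}.
Variables (P Q : probability (borel_rV R d) R).
Context {disp : measure_display} {Omega : measurableType disp}.
Variables (Pr : probability Omega R) (X Y : nat -> {RV Pr >-> borel_rV R d}).
Hypotheses (hX : iid_from X P) (hY : iid_from Y Q).
Hypotheses (P1 : P (@unit_cube R d) = 1%E) (Q1 : Q (@unit_cube R d) = 1%E).
Variable f : borel_rV R d -> R.
Hypothesis bf : bmf f.
Hypothesis changePQ : forall g : borel_rV R d -> R, bmf g ->
  \int[P]_x g x = \int[Q]_x (expR (f x) * g x).

Let D := \int[P]_x f x.

Lemma exp_tail_lt1 (I : finType) (Z : I -> Omega -> R) (s e : R) i w : 0 < s ->
  \sum_(j : I) expR (s * (Z j w - e)) < 1 -> Z i w < e.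
Proof.
move=> s0 H; rewrite -subr_lt0 -(pmulr_rlt0 _ s0) -expR_lt1.
apply: le_lt_trans H; rewrite (bigD1 i)//= lerDl.
by apply: sumr_ge0 => j _; exact: expR_ge0.
Qed.

(** [V] is the sum of four sums of exponentials, one for each deviation in [expected_error_le]. If V
    < 1 every single exponential is below 1, so every deviation is below e. The third e of the upper
    bound pays for the net, taken with resolution m = n. *)
Lemma tail_event (k n : nat) (lam L H' gam e : R) (g : 'rV[R]_d -> R) :
  let H := k%:R + 1 in
  let c := (n.+1 * n.+2)%:R^-1 / 4 in
  0 < e -> (0 < n)%N -> NN k 1 1 1 g -> (forall x, `|g x| <= H') ->
  2 * H' <= H -> gap P Q f g <= gam -> 0 < lam -> 0 <= L ->
  3 * lam * expR H <= 1 ->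
  ((2 * n).+1 ^ (k * d.+2).+1)%:R <= expR L ->
  expR (L + n%:R * lam * (lam * H ^+ 2) - n%:R * lam * e) <= c ->
  expR (L + n%:R * lam * (2 * lam * expR H) - n%:R * lam * e) <= c ->
  (1 + expR H) * ((k%:R * d.+2%:R + 1) / n%:R) <= e ->
  exists V : Omega -> R, [/\ bmf V, forall w, 0 <= V w,
    \int[Pr]_w V w <= (n.+1 * n.+2)%:R^-1 &
    forall w, (forall i, unit_cube (X i w)) -> (forall i, unit_cube (Y i w)) ->
      V w < 1 ->
      ((D - gam - 2 * e)%:E <= KL_estimator (NN k 1 1 1) n (X ^~ w) (Y ^~ w)
         <= (D + 3 * e)%:E)%E].
Proof.
move=> H c e0 n0 Gg gH' H'H gapg lam0 L0 lamH cardL c1 c2 de.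
have lamH_ : 3 * lam * expR (k%:R * 1 + 1) <= 1 by rewrite mulr1.
have [I [G [cI GN mX mY net]]] :=
  @NN_net_mgf R d P Q _ _ Pr X Y hX hY f bf changePQ k n n 1 1 1 lam L n0 n0
    ler01 ler01 ler01 lam0 lamH_ cardL.
rewrite mulr1 -/H in mX mY net.
have s0 : 0 < n%:R * lam by rewrite mulr_gt0// ltr0n.
have bg := bmf_NN Gg.
have bG i := bmf_NN (GN i).
have H'0 : 0 <= H' by exact: le_trans (gH' 0).
have H'leH : H' <= H by lra.
have lamH' : 3 * lam * expR H' <= 1.
  by apply: le_trans lamH; rewrite ler_wpM2l ?ler_expR// mulr_ge0// ltW.
have [lH'3 lB'] := small_rate lam0 H'0 lamH'.
pose s := n%:R * lam.
pose V1 w := \sum_(i : I) expR (s * (emp_dev X P n (G i) w - e)).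
pose Z2 i w := emp_dev Y Q n (fun x => - expR (G i x)) w - gap P Q f (G i).
pose V2 w := \sum_(i : I) expR (s * (Z2 i w - e)).
pose Z3 (i : 'I_1) w := emp_dev X P n (fun x => - g x) w.
pose V3 w := \sum_(i : 'I_1) expR (s * (Z3 i w - e)).
pose Z4 (i : 'I_1) w := emp_dev Y Q n (fun x => expR (g x)) w.
pose V4 w := \sum_(i : 'I_1) expR (s * (Z4 i w - e)).
have bZ1 i : bmf (emp_dev X P n (G i)) by exact: bmf_emp_dev.
have bZ2 i : bmf (Z2 i).
  apply: bmfB; last exact: bmf_cst.
  by apply: bmf_emp_dev; apply: bmfN; exact: bmf_expR.
have bZ3 i : bmf (Z3 i) by apply: bmf_emp_dev; exact: bmfN.
have bZ4 i : bmf (Z4 i) by apply: bmf_emp_dev; exact: bmf_expR.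
have bS (J : finType) (Z : J -> Omega -> R) : (forall i, bmf (Z i)) ->
    bmf (fun w => \sum_(i : J) expR (s * (Z i w - e))).
  move=> bZ; apply: bmf_sum => i; apply: bmf_expR; apply: bmfZ; apply: bmfB => //.
  exact: bmf_cst.
have S0 (J : finType) (Z : J -> Omega -> R) w : 0 <= \sum_(i : J) expR (s * (Z i w - e)).
  by apply: sumr_ge0 => i _; exact: expR_ge0.
have card1 : #|'I_1|%:R <= expR 0 :> R by rewrite card_ord expR0.
have i1 : \int[Pr]_w V1 w <= c by exact: le_trans (int_sum_expR_le e bZ1 cI mX) c1.
have i2 : \int[Pr]_w V2 w <= c by exact: le_trans (int_sum_expR_le e bZ2 cI mY) c2.
have i3 : \int[Pr]_w V3 w <= c.
  apply: le_trans c1.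
  apply: le_trans (_ : expR (0 + s * (lam * H' ^+ 2) - s * e) <= _).
    apply: (int_sum_expR_le e bZ3 card1) => i.
    apply: (emp_dev_mgf hX n0 (bmfN bg)) => //; last exact: ltW.
    by move=> x; rewrite normrN.
  rewrite ler_expR lerD2r lerD// ler_wpM2l ?(ltW s0)// ler_wpM2l ?(ltW lam0)//.
  by rewrite lerXn2r ?nnegrE//; exact: le_trans H'leH.
have i4 : \int[Pr]_w V4 w <= c.
  apply: le_trans c2.
  apply: le_trans (_ : expR (0 + s * (lam * expR H' ^+ 2) - s * e) <= _).
    apply: (int_sum_expR_le e bZ4 card1) => i.
    apply: (emp_dev_mgf hY n0 (bmf_expR bg)) => //; last 2 first.
    - exact: ltW.
    - have : 0 < lam * expR H' by rewrite mulr_gt0 ?expR_gt0.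
      lra.
    - by move=> x; rewrite ger0_norm ?expR_ge0// ler_expR (le_trans (ler_norm _)).
  rewrite ler_expR lerD2r lerD// ler_wpM2l ?(ltW s0)//.
  (* The assumption 2 H' <= H gives (e^H')^2 <= e^H, so the condition imposed for the net also
     covers the deviation of e^g. *)
  rewrite -expRM_natl (_ : 2 * lam * _ = lam * (2 * expR H)); last by ring.
  rewrite ler_wpM2l ?(ltW lam0)//.
  have : expR (2 * H') <= expR H by rewrite ler_expR.
  have := expR_gt0 H; lra.
have V10 w : 0 <= V1 w := S0 _ (fun i => emp_dev X P n (G i)) w.
have V20 w : 0 <= V2 w := S0 _ Z2 w.
have V30 w : 0 <= V3 w := S0 _ Z3 w.
have V40 w : 0 <= V4 w := S0 _ Z4 w.
exists (fun w => V1 w + V2 w + V3 w + V4 w).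
have b1 : bmf V1 by exact: bS.
have b2 : bmf V2 by exact: bS.
have b3 : bmf V3 by exact: bS.
have b4 : bmf V4 by exact: bS.
split.
- by repeat apply: bmfD => //.
- by move=> w; rewrite !addr_ge0.
- rewrite !RintD//; [|by apply: bmfD|by apply: bmfD => //; exact: bmfD].
  exact: (four_quarters i1 i2 i3 i4).
move=> w Xc Yc Vw.
have {}V10 := V10 w; have {}V20 := V20 w; have {}V30 := V30 w; have {}V40 := V40 w.
have [V1w V2w V3w V4w] : [/\ V1 w < 1, V2 w < 1, V3 w < 1 & V4 w < 1].
  exact: (four_lt1 V10 V20 V30 V40 Vw).
apply/andP; split.
  apply: le_trans (KL_estimator_ge _ _ _ Gg).
  rewrite lee_fin (emp_objE P Q X Y f w n0 bg).
  have z3 := exp_tail_lt1 (Z := Z3) ord0 s0 V3w.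
  have z4 := exp_tail_lt1 (Z := Z4) ord0 s0 V4w.
  rewrite /Z3 emp_devN// in z3; rewrite (emp_devN _ _ _ _ (bmf_expR bg)).
  rewrite /Z4 in z4; rewrite -/D; apply: lower_arith; [exact: z3|exact: z4|exact: gapg].
apply: (le_trans (net _ _ e e Xc Yc _)).
  move=> i; rewrite (emp_objE P Q X Y f w n0 (bG i)).
  have z1 := exp_tail_lt1 (Z := fun i => emp_dev X P n (G i)) i s0 V1w.
  have z2 := exp_tail_lt1 (Z := Z2) i s0 V2w.
  by rewrite lerD// ?lerD2l ltW.
rewrite lee_fin.
have -> : k%:R * (1 + 1 * (d.+1%:R * 1)) + 1 = k%:R * d.+2%:R + 1 :> R.
  by rewrite mulr1 mul1r -(natr1 d.+1) (addrC 1).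
by rewrite -/D; apply: upper_arith.
Qed.

Lemma as_bracket (k : nat -> nat) (lam L : nat -> R) (N0 : nat) (H' gam e : R)
    (g : 'rV[R]_d -> R) :
  0 < e -> (forall x, `|g x| <= H') -> gap P Q f g <= gam ->
  (forall n, (N0 <= n)%N ->
    let H := (k n)%:R + 1 in
    let c := (n.+1 * n.+2)%:R^-1 / 4 in
    [/\ (0 < n)%N, NN (k n) 1 1 1 g, 2 * H' <= H, 0 < lam n & 0 <= L n] /\
    [/\ 3 * lam n * expR H <= 1,
      ((2 * n).+1 ^ (k n * d.+2).+1)%:R <= expR (L n),
      expR (L n + n%:R * lam n * (lam n * H ^+ 2) - n%:R * lam n * e) <= c,
      expR (L n + n%:R * lam n * (2 * lam n * expR H) - n%:R * lam n * e) <= c &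
      (1 + expR H) * (((k n)%:R * d.+2%:R + 1) / n%:R) <= e]) ->
  {ae Pr, forall w, exists M, forall n, (M <= n)%N ->
    ((D - gam - 2 * e)%:E <= KL_estimator (NN (k n) 1 1 1) n (X ^~ w) (Y ^~ w)
         <= (D + 3 * e)%:E)%E}.
Proof.
move=> e0 gH' gapg hyp.
have /choice[V HV] : forall n, exists V : Omega -> R, [/\ bmf V, forall w, 0 <= V w,
    (N0 <= n)%N -> \int[Pr]_w V w <= (n.+1 * n.+2)%:R^-1 &
    forall w, (N0 <= n)%N ->
      (forall i, unit_cube (X i w)) -> (forall i, unit_cube (Y i w)) ->
      V w < 1 ->
      ((D - gam - 2 * e)%:E <= KL_estimator (NN (k n) 1 1 1) n (X ^~ w) (Y ^~ w)
         <= (D + 3 * e)%:E)%E].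
  move=> n; have [nN|nN] := ltnP n N0.
    by exists (fun=> 0); split => //; exact: bmf_cst.
  have [[n0 Gg H'H lam0 L0] [h1 h2 h3 h4 h5]] := hyp n nN.
  have [V [bV V0 iV tV]] := tail_event e0 n0 Gg gH' H'H gapg lam0 L0 h1 h2 h3 h4 h5.
  by exists V; split => // w _; exact: tV.
have aeV := @ae_eventually_lt1 _ _ _ Pr V N0 (fun n => let: And4 b _ _ _ := HV n in b)
  (fun n => let: And4 _ b _ _ := HV n in b) (fun n => let: And4 _ _ b _ := HV n in b).
have aeC : {ae Pr, forall w, (forall i, unit_cube (X i w)) /\ (forall i, unit_cube (Y i w))}.
  by move: (ae_samples_cube hX P1) (ae_samples_cube hY Q1); apply: filterS2.
move: aeV aeC; apply: filterS2 => w [M HM] [Xc Yc].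
exists (maxn M N0) => n; rewrite geq_max => /andP[Mn Nn].
by have [_ _ _] := HV n; apply => //; exact: HM.
Qed.

End almost_sure.

(** * Greedy approximation of Barron functions *)

Section staircase.
Context {R : realType}.
Implicit Types (u : R) (H : R -> R).

Lemma expR1_ge2 : 2 <= expR 1 :> R.
Proof. by have := expR_ge1Dx (1 : R); rewrite (_ : 1 + 1 = 2)//; ring. Qed.

Lemma expR1_le4 : expR 1 <= 4 :> R.
Proof.
have h : 2^-1 <= expR (- 2^-1) :> R by apply: le_trans (expR_ge1Dx _); lra.
rewrite -[X in expR X]opprK expRN invf_ple ?posrE ?expR_gt0//.
rewrite (_ : - 1 = 2%:R * - 2^-1); last by field.
rewrite expRM_natl (_ : 4^-1 = 2^-1 ^+ 2); last by field.
by rewrite lerXn2r ?nnegrE ?expR_ge0.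
Qed.

(** To the left of all the integers the sum is geometric: shifting u by -1 at least halves e^u. *)
Lemma exp_sum_neg (N : nat) u : u <= 0 ->
  \sum_(j < N) expR (- `|u - j.+1%:R|) <= expR u.
Proof.
elim: N u => [|N IH] u u0; first by rewrite big_ord0 expR_ge0.
rewrite big_ord_recl/=.
rewrite (eq_bigr (fun j : 'I_N => expR (- `|(u - 1) - j.+1%:R|))); last first.
  by move=> j _; congr (expR (- `|_|)); rewrite /bump/= add1n -(natr1 j.+1); ring.
have h := IH (u - 1) _; rewrite ler0_norm; last lra.
have e2 : 2 * expR (u - 1) <= expR u.
  have -> : expR u = expR 1 * expR (u - 1) by rewrite -expRD addrC subrK.
  by rewrite ler_wpM2r ?expR_ge0// expR1_ge2.
rewrite opprK; have := h; lra.
Qed.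

Lemma exp_sum_le (N : nat) u : \sum_(j < N) expR (- `|u - j.+1%:R|) <= 5.
Proof.
have [u0|u0] := leP u 0.
  apply: le_trans (exp_sum_neg N u0) _; rewrite (@le_trans _ _ 1)//; last lra.
  by rewrite expR_le1.
(* A constant bound would not survive the induction on shifts of u. The deficit 4 e^(-u) pays for
   the new term e^(1-u), since 3e >= 4; in the last case 0 < u <= 1 the claim reduces to (x - 1)(4 -
   x) >= 0 for x = e^u. *)
suff : \sum_(j < N) expR (- `|u - j.+1%:R|) <= 5 - 4 * expR (- u).
  by have := expR_gt0 (- u); lra.
elim: N u u0 => [|N IH] u u0.
  rewrite big_ord0; have : expR (- u) <= 1 by rewrite expR_le1; lra.
  lra.
rewrite big_ord_recl/=.
rewrite (eq_bigr (fun j : 'I_N => expR (- `|(u - 1) - j.+1%:R|))); last first.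
  by move=> j _; congr (expR (- `|_|)); rewrite /bump/= add1n -(natr1 j.+1); ring.
have e1 := expR1_ge2; have e4 := expR1_le4.
have [u1|u1] := leP u 1.
  have h : \sum_(j < N) expR (- `|(u - 1) - j.+1%:R|) <= expR (u - 1).
    by apply: exp_sum_neg; lra.
  rewrite ler0_norm; last lra.
  rewrite opprK.
  have e2 : 2 * expR (u - 1) <= expR u.
    have -> : expR u = expR 1 * expR (u - 1) by rewrite -expRD addrC subrK.
    by rewrite ler_wpM2r ?expR_ge0.
  have x1 : 1 <= expR u by have := expR_ge1Dx u; lra.
  have x4 : expR u <= 4 by apply: le_trans e4; rewrite ler_expR.
  have xx : expR (- u) * expR u = 1 by rewrite -expRD addNr expR0.
  have y0 := expR_gt0 (- u).
  suff : expR u <= 5 - 4 * expR (- u) by lra.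
  have : 0 <= expR (- u) * ((expR u - 1) * (4 - expR u)).
    by apply: mulr_ge0; [lra|apply: mulr_ge0; lra].
  move: xx; move: (expR (- u)) (expR u) => y x xx.
  rewrite (_ : y * _ = 5 * (y * x) - (y * x) * x - 4 * y); last by ring.
  rewrite xx; lra.
rewrite gtr0_norm; last lra.
have h : \sum_(j < N) expR (- `|(u - 1) - j.+1%:R|) <= 5 - 4 * expR (- (u - 1)).
  by apply: IH; lra.
have E : expR (- (u - 1)) = expR 1 * expR (- u) by rewrite -expRD; congr expR; ring.
rewrite E in h *; have y0 := expR_gt0 (- u).
have : 0 <= (3 * expR 1 - 4) * expR (- u) by apply: mulr_ge0; lra.
lra.
Qed.

Lemma sigmoid_step (t : R) : `|(0 <= t)%R%:R - sigmoid t| <= expR (- `|t|).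
Proof.
have s0 := sigmoid_gt0 t; have s1 := sigmoid_le1 t.
case: (leP 0 t) => t0.
  rewrite ger0_norm ?subr_ge0// ger0_norm//.
  have E : 1 - sigmoid t = sigmoid t * expR (- t).
    by rewrite /sigmoid; field; rewrite gt_eqF// ltr_wpDr ?expR_ge0.
  by rewrite E ler_piMl ?expR_ge0.
rewrite sub0r normrN (ger0_norm (ltW s0)) ltr0_norm// opprK.
have E : expR t * expR (- t) = 1 by rewrite -expRD subrr expR0.
rewrite /sigmoid -[leLHS]mul1r ler_pdivrMr ?ltr_wpDr ?expR_ge0// mulrDr E mulr1.
by rewrite lerDr expR_ge0.
Qed.

Lemma telescope_step (N : nat) H u : 0 <= u <= N%:R ->
  exists p : nat, [/\ p%:R <= u, u < p%:R + 1 &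
    \sum_(j < N) (H j.+1%:R - H j%:R) * (0 <= u - j.+1%:R)%R%:R = H p%:R - H 0].
Proof.
move=> /andP[u0 uN]; have /andP[p1 p2] := truncn_itv u0.
exists (Num.truncn u); split => //; first by rewrite natr1.
set p := Num.truncn u in p1 p2 *.
have pN : (p <= N)%N by rewrite -(ler_nat R) (le_trans p1).
rewrite (eq_bigr (fun j : 'I_N => if (j < p)%N then H j.+1%:R - H j%:R else 0)).
  rewrite -big_mkcond/= -(big_ord_widen_cond N (fun=> true) (fun j => H j.+1%:R - H j%:R))//.
  rewrite -(big_mkord xpredT (fun j => H j.+1%:R - H j%:R)).
  by rewrite (telescope_sumr (fun j => H j%:R)).
move=> j _; rewrite subr_ge0.
have -> : (j.+1%:R <= u)%R = (j < p)%N.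
  by apply/idP/idP => [ju|jp]; [rewrite -ltnS -(ltr_nat R) (le_lt_trans ju)|rewrite (le_trans _ p1)// ler_nat].
by case: ifP => _; rewrite ?mulr1 ?mulr0.
Qed.

(* Telescoping H along the integers gives its staircase interpolation, whose
   steps are then replaced by sigmoids; the errors decay exponentially in the
   distance to u, so they sum to a constant. *)
Lemma lipschitz_sigmoid_sum (N : nat) (L : R) H u :
  0 <= L -> (forall a b, `|H a - H b| <= L * `|a - b|) -> 0 <= u <= N%:R ->
  `|H u - H 0 - \sum_(j < N) (H j.+1%:R - H j%:R) * sigmoid (u - j.+1%:R)| <= 6 * L.
Proof.
move=> L0 HL uN; have [p [pu up E]] := telescope_step H uN.
have -> : H u - H 0 - \sum_(j < N) (H j.+1%:R - H j%:R) * sigmoid (u - j.+1%:R) =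
  (H u - H p%:R) + \sum_(j < N) (H j.+1%:R - H j%:R) *
     ((0 <= u - j.+1%:R)%R%:R - sigmoid (u - j.+1%:R)).
  under [X in _ = _ + X]eq_bigr do rewrite mulrBr.
  by rewrite sumrB E; ring.
apply: (le_trans (ler_normD _ _)).
have h1 : `|H u - H p%:R| <= L.
  apply: (le_trans (HL _ _)); rewrite -[leRHS]mulr1 ler_wpM2l// ger0_norm; lra.
have h2 : `|\sum_(j < N) (H j.+1%:R - H j%:R) *
     ((0 <= u - j.+1%:R)%R%:R - sigmoid (u - j.+1%:R))| <= L * 5.
  apply: (le_trans (ler_norm_sum _ _ _)).
  apply: le_trans (_ : \sum_(j < N) L * expR (- `|u - j.+1%:R|) <= _); last first.
    by rewrite -mulr_sumr ler_wpM2l// exp_sum_le.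
  apply: ler_sum => j _; rewrite normrM; apply: ler_pM => //.
    apply: (le_trans (HL _ _)); rewrite -natr1 addrAC subrr add0r normr1 mulr1 //.
  exact: sigmoid_step.
lra.
Qed.

End staircase.

(** * Correlations with ridge functions against correlations with neurons *)

Section dual_bound.
Context {R : realType} {d : nat}.
Variable Q : probability (borel_rV R d) R.
Hypothesis Q1 : Q (@unit_cube R d) = 1%E.

Definition norm1 (w : 'rV[R]_d) : R := \sum_(j < d) `|w 0 j|.

Lemma norm1_ge0 w : 0 <= norm1 w.
Proof. by apply: sumr_ge0. Qed.

Lemma coord_le_norm1 (w : 'rV[R]_d) j : `|w 0 j| <= norm1 w.
Proof. by rewrite /norm1 (bigD1 j)//= lerDl; apply: sumr_ge0. Qed.

Lemma dotrv_le_norm1 (w x : 'rV[R]_d) : unit_cube x -> `|dotrv w x| <= norm1 w.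
Proof.
move=> xc; apply: (le_trans (ler_norm_sum _ _ _)); apply: ler_sum => j _.
rewrite normrM -[leRHS]mulr1 ler_wpM2l//.
by have /andP[x0 x1] := xc j; rewrite ger0_norm.
Qed.

Lemma cube_null : Q (~` @unit_cube R d) = 0%E.
Proof. by rewrite probability_setC ?Q1 ?subee//; exact: measurable_cube. Qed.

Lemma bmf_lip_dotrv (h : R -> R) (w : 'rV[R]_d) : continuous h ->
  (exists M, forall t, `|h t| <= M) -> bmf (fun x : borel_rV R d => h (dotrv w x)).
Proof.
move=> ch [M hM]; split; last by exists M => x.
apply: measurableT_comp; last exact: measurable_dotrv.
exact: continuous_measurable_fun.
Qed.

(** On the cube om.x ranges over [-|om|, |om|] for the l1 norm; the affine change u = m om.x / |om|
    + m maps it into [0, 2m] and makes h Lipschitz with constant |om| / m. The 2m neurons of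
    [lipschitz_sigmoid_sum] then have inner weights and biases within m and outer weights summing to
    2 |om|. The constant term costs another 2 |om|, and the uniform error is 6 |om| / m. *)
Lemma ridge_dual_bound (S : borel_rV R d -> R) (m : nat) (sig : R) (h : R -> R)
    (om : 'rV[R]_d) : (0 < m)%N -> bmf S ->
  continuous h -> (exists M, forall t, `|h t| <= M) ->
  (forall a b, `|h a - h b| <= `|a - b|) -> h 0 = 0 ->
  (forall (w : 'rV[R]_d) b, (forall j, `|w 0 j| <= m%:R) -> `|b| <= m%:R ->
     `|\int[Q]_x (S x * unit_fun w b x)| <= sig) ->
  `|\int[Q]_x (S x * h (dotrv om x))| <=
    norm1 om * (4 * sig + 6 / m%:R * \int[Q]_x `|S x|).
Proof.
move=> m0 bS ch bh hlip h0 Hsig.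
have m0' : 0 < m%:R :> R by rewrite ltr0n.
have bhom := bmf_lip_dotrv om ch bh.
have bnS := bmf_norm bS.
have IS0 : 0 <= \int[Q]_x `|S x| by apply: Rintegral_ge0.
have : 0 <= norm1 om := norm1_ge0 om.
rewrite le_eqVlt => /orP[/eqP n10|n1].
  rewrite -n10 mul0r.
  have -> : (fun x : borel_rV R d => S x * h (dotrv om x)) = (fun=> 0).
    apply/funext => x; rewrite (_ : dotrv om x = 0) ?h0 ?mulr0//.
    apply: big1 => j _; have := coord_le_norm1 om j.
    by rewrite -n10 normr_le0 => /eqP ->; rewrite mul0r.
  by rewrite Rint_cst normr0.
have n1W : 0 <= norm1 om := ltW n1.
have mW : 0 <= m%:R :> R := ltW m0'.
pose H t := h (norm1 om * (t / m%:R - 1)).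
have HL a b : `|H a - H b| <= norm1 om / m%:R * `|a - b|.
  apply: (le_trans (hlip _ _)).
  rewrite (_ : _ - _ = norm1 om / m%:R * (a - b)); last by field; rewrite gt_eqF.
  by rewrite normrM ger0_norm// divr_ge0 ?ltW.
have L0 : 0 <= norm1 om / m%:R by rewrite divr_ge0 ?ltW.
pose wj : 'rV[R]_d := (m%:R / norm1 om) *: om.
pose u x := dotrv wj x + m%:R.
have dotwj x : dotrv wj x = m%:R / norm1 om * dotrv om x.
  by rewrite /dotrv mulr_sumr; apply: eq_bigr => j _; rewrite mxE mulrA.
have Hu x : H (u x) = h (dotrv om x).
  by rewrite /H /u dotwj; congr h; field; rewrite !gt_eqF.
have wjm j : `|wj 0 j| <= m%:R.
  rewrite mxE normrM ger0_norm ?divr_ge0// mulrAC ler_pdivrMr//.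
  by rewrite ler_wpM2l// coord_le_norm1.
have ucube x : unit_cube x -> 0 <= u x <= (2 * m)%:R.
  move=> /(dotrv_le_norm1 om); rewrite /u dotwj ler_norml natrM => /andP[l1 l2].
  have e : 0 <= m%:R / norm1 om by rewrite divr_ge0 ?ltW.
  have h1 := ler_wpM2l e l1; have h2 := ler_wpM2l e l2.
  rewrite mulrN divfK ?gt_eqF// in h1; rewrite divfK ?gt_eqF// in h2.
  by apply/andP; split; lra.
pose A (j : nat) := H j.+1%:R - H j%:R.
(* The constant 1 is written as twice the neuron with zero weights, so that the hypothesis on
   neurons covers it too. *)
pose ap x := H 0 * (2 * unit_fun 0 0 x) +
  \sum_(j < 2 * m) A j * unit_fun wj (m%:R - j.+1%:R) x.
have one x : 2 * unit_fun 0 0 x = 1 :> R.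
  rewrite /unit_fun /sigmoid (_ : dotrv 0 x = 0) ?addr0 ?oppr0 ?expR0; last first.
    by apply: big1 => j _; rewrite mxE mul0r.
  by field.
have apE x : unit_cube x -> `|h (dotrv om x) - ap x| <= 6 * (norm1 om / m%:R).
  move=> xc; have := lipschitz_sigmoid_sum L0 HL (ucube x xc).
  rewrite Hu /ap one mulr1 opprD addrA; congr (`|_ - _| <= _).
  by apply: eq_bigr => j _; rewrite /unit_fun /u addrA.
have bap : bmf (ap : borel_rV R d -> R).
  apply: bmfD; first by apply: bmfZ; apply: bmfZ; exact: bmf_unit_fun.
  by apply: bmf_sum => j; apply: bmfZ; exact: bmf_unit_fun.
have bSu w b : bmf (fun x : borel_rV R d => S x * unit_fun w b x).
  by apply: bmfM => //; exact: bmf_unit_fun.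
have AL j : `|A j| <= norm1 om / m%:R.
  apply: (le_trans (HL _ _)); rewrite -[j.+1%:R]natr1 addrAC subrr add0r normr1.
  by rewrite mulr1.
have H0L : `|H 0| <= norm1 om.
  rewrite /H mul0r sub0r mulrN1 -[X in `|X|]subr0 -h0.
  by apply: (le_trans (hlip _ _)); rewrite subr0 normrN ger0_norm//.
have sig0 : 0 <= sig.
  apply: le_trans (Hsig 0 0 _ _) => //; last by rewrite normr0 //.
  by move=> j; rewrite mxE normr0 //.
have I1 : `|\int[Q]_x (S x * ap x)| <= 4 * norm1 om * sig.
  have -> : (fun x : borel_rV R d => S x * ap x) = (fun x : borel_rV R d =>
     (H 0 * 2) * (S x * unit_fun 0 0 x) +
     \sum_(j < 2 * m) A j * (S x * unit_fun wj (m%:R - j.+1%:R) x)).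
    apply/funext => x; rewrite /ap mulrDr mulr_sumr; congr (_ + _); first by ring.
    by apply: eq_bigr => j _; rewrite mulrCA.
  rewrite RintD; last 2 first.
  - exact: bmfZ.
  - by apply: bmf_sum => j; exact: bmfZ.
  rewrite RintZ// Rint_sum; last by move=> j; exact: bmfZ.
  apply: (le_trans (ler_normD _ _)).
  have t1 : `|H 0 * 2 * \int[Q]_x (S x * unit_fun 0 0 x)| <= norm1 om * 2 * sig.
    rewrite normrM normrM (ger0_norm (_ : 0 <= 2))//.
    rewrite ler_pM// ?mulr_ge0//; first by rewrite ler_wpM2r.
    by apply: Hsig => [j|]; rewrite ?mxE normr0 //.
  have t2 : `|\sum_(j < 2 * m) \int[Q]_x (A j * (S x * unit_fun wj (m%:R - j.+1%:R) x))|
      <= 2 * norm1 om * sig.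
    apply: (le_trans (ler_norm_sum _ _ _)).
    apply: (@le_trans _ _ (\sum_(j < 2 * m) norm1 om / m%:R * sig)).
      apply: ler_sum => j _; rewrite RintZ// normrM ler_pM//.
      apply: Hsig => //; rewrite ler_norml.
      have : (j.+1%:R : R) <= (2 * m)%:R by rewrite ler_nat.
      have : (0 : R) <= j.+1%:R by rewrite ler0n.
      by rewrite natrM => *; apply/andP; split; lra.
    rewrite sumr_const card_ord -[X in X <= _]mulr_natl natrM.
    by rewrite le_eqVlt; apply/orP; left; apply/eqP; field; rewrite gt_eqF.
  lra.
have -> : \int[Q]_x (S x * h (dotrv om x)) =
   \int[Q]_x (S x * ap x) + \int[Q]_x (S x * (h (dotrv om x) - ap x)).
  rewrite -RintD; last 2 first.
  - exact: bmfM.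
  - by apply: bmfM => //; exact: bmfB.
  by apply: eq_Rintegral => x _; ring.
apply: (le_trans (ler_normD _ _)).
have I2 : `|\int[Q]_x (S x * (h (dotrv om x) - ap x))| <=
    6 * (norm1 om / m%:R) * \int[Q]_x `|S x|.
  have bD : bmf (fun x : borel_rV R d => S x * (h (dotrv om x) - ap x)).
    by apply: bmfM => //; exact: bmfB.
  apply: le_trans (_ : \int[Q]_x `|S x * (h (dotrv om x) - ap x)| <= _).
    by apply: le_norm_Rint => //; exact: bmf_norm.
  rewrite -RintZ//; apply: (le_Rint_on measurable_cube cube_null).
  - exact: bmf_norm.
  - exact: bmfZ.
  - by move=> x xc; rewrite normrM mulrC ler_wpM2r// apE.
move: I1 I2; rewrite (_ : 6 * (norm1 om / m%:R) * _ =
   norm1 om * (6 / m%:R * \int[Q]_x `|S x|)); last by ring.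
set t := 6 / m%:R * _; lra.
Qed.

End dual_bound.

(** * Fubini and mixtures of ridge functions *)

Section bmf_fubini.
Context {R : realType} {d1 d2 : measure_display}.
Context {T1 : measurableType d1} {T2 : measurableType d2}.
Variables (m1 : {finite_measure set T1 -> \bar R}) (m2 : {finite_measure set T2 -> \bar R}).
Variable k : T1 * T2 -> R.
Hypothesis bk : bmf k.

Let bk1 x : bmf (fun y => k (x, y)).
Proof. by apply: (bmf_comp k (fun y => (x, y))) => //; exact: measurable_pair1. Qed.

Let bk2 y : bmf (fun x => k (x, y)).
Proof. by apply: (bmf_comp k (fun x => (x, y))) => //; exact: measurable_pair2. Qed.

Let ik : (m1 \x m2)%E.-integrable setT (EFin \o k).
Proof.
have [mk [M kM]] := bk.
apply/integrable12ltyP; first exact/measurable_EFinP.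
apply: (@le_lt_trans _ _ (\int[m1]_x (M%:E * m2 setT))%E).
  apply: ge0_le_integral => //.
  - by move=> x _; apply: integral_ge0 => y _; exact: abse_ge0.
  - have mabs : measurable_fun setT (fun z => `|(k z)%:E|%E).
      by apply: measurableT_comp => //; exact/measurable_EFinP.
    rewrite -[X in measurable_fun _ X]/(fubini_F m2 (fun z => `|(k z)%:E|%E)).
    by apply: measurable_fun_fubini_tonelli_F => // z; exact: abse_ge0.
  move=> x _; rewrite -integral_cst//; apply: ge0_le_integral => //.
  - by apply: measurableT_comp => //; apply/measurable_EFinP; exact: (bk1 x).1.
  - by move=> y _; rewrite lee_fin.
rewrite integral_cst// ltey_eq; apply/orP; left.
by rewrite !fin_numM// fin_num_measure.
Qed.

Lemma Rint_EFin {d} {T : measurableType d} (mu : {finite_measure set T -> \bar R})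
  (h : T -> R) : bmf h -> (\int[mu]_x h x)%:E = (\int[mu]_x (h x)%:E)%E.
Proof.
by move=> bh; rewrite fineK// integrable_fin_num//; exact: bmf_integrable.
Qed.

Lemma bmf_partial_Rint : bmf (fun x => \int[m2]_y k (x, y)).
Proof.
have [mk [M kM]] := bk; split.
  apply/measurable_EFinP.
  have -> : EFin \o (fun x => \int[m2]_y k (x, y)) =
      fubini_F m2 (EFin \o k : T1 * T2 -> \bar R).
    by apply/funext => x /=; rewrite Rint_EFin.
  exact: measurable_fubini_F ik.
exists (\int[m2]_y M) => x; apply: le_norm_Rint => //.
exact: bmf_cst.
Qed.

Lemma Rint_fubini : \int[m1]_x \int[m2]_y k (x, y) = \int[m2]_y \int[m1]_x k (x, y).
Proof.
rewrite [LHS]/Rintegral [RHS]/Rintegral; congr fine.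
have := Fubini ik.
have -> : (fun x => \int[m2]_y (EFin \o k) (x, y))%E =
    (fun x => (\int[m2]_y k (x, y))%:E).
  by apply/funext => x; rewrite Rint_EFin.
have -> : (fun y => \int[m1]_x (EFin \o k) (x, y))%E =
    (fun y => (\int[m1]_x k (x, y))%:E).
  by apply/funext => y; rewrite Rint_EFin.
by [].
Qed.

End bmf_fubini.

Section barron_representation.
Context {R : realType} {d : nat}.

Lemma measurable_dotrv2 : measurable_fun setT
  (fun z : borel_rV R d * borel_rV R d => dotrv (z.2 : 'rV[R]_d) (z.1 : 'rV[R]_d)).
Proof.
apply: measurable_sum => j; apply: measurable_funM.
  exact: (measurableT_comp (measurable_coord j) measurable_snd).
exact: (measurableT_comp (measurable_coord j) measurable_fst).
Qed.

Lemma measurable_norm1 : measurable_fun setT (fun w : borel_rV R d => norm1 (w : 'rV[R]_d)).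
Proof.
apply: measurable_sum => j.
apply: (measurableT_comp (@normr_measurable R setT)); exact: measurable_coord.
Qed.

Variable Q : probability (borel_rV R d) R.
Hypothesis Q1 : Q (@unit_cube R d) = 1%E.

Lemma norm_ridge_int_le (mu : {finite_measure set (borel_rV R d) -> \bar R}) (K A : R)
    (J : borel_rV R d -> R) :
  (\int[mu]_w (norm1 (w : 'rV[R]_d))%:E <= K%:E)%E -> 0 <= A -> bmf J ->
  (forall w, `|J w| <= norm1 (w : 'rV[R]_d) * A) -> `|\int[mu]_w J w| <= A * K.
Proof.
move=> muK A0 bJ JA; apply: (@le_trans _ _ (\int[mu]_w `|J w|)).
  by apply: le_norm_Rint => //; exact: bmf_norm.
rewrite -lee_fin Rint_EFin; last exact: bmf_norm.
apply: (@le_trans _ _ (\int[mu]_w (A%:E * (norm1 (w : 'rV[R]_d))%:E))%E).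
  apply: ge0_le_integral => //.
  - by apply/measurable_EFinP; exact: (bmf_norm bJ).1.
  - by under eq_fun do rewrite -EFinM; apply/measurable_EFinP;
      apply: measurable_funM; [exact: measurable_cst|exact: measurable_norm1].
  - by move=> w _; rewrite -EFinM lee_fin mulrC.
rewrite ge0_integralZl//; last 2 first.
- by apply/measurable_EFinP; exact: measurable_norm1.
- by move=> w _; rewrite lee_fin norm1_ge0.
by rewrite EFinM lee_wpmul2l.
Qed.

Section ridge_mixture.
Variables (mu : {finite_measure set (borel_rV R d) -> \bar R}) (h : R -> R).
Hypotheses (ch : continuous h) (bh : exists M, forall t, `|h t| <= M).

Let bmf_pair : bmf (fun z : borel_rV R d * borel_rV R d =>
  h (dotrv (z.2 : 'rV[R]_d) (z.1 : 'rV[R]_d))).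
Proof.
case: bh => M hM; split; last by exists M => z.
apply: measurableT_comp; last exact: measurable_dotrv2.
exact: continuous_measurable_fun.
Qed.

Definition ridge_mix (x : borel_rV R d) : R :=
  \int[mu]_w h (dotrv (w : 'rV[R]_d) (x : 'rV[R]_d)).

Lemma bmf_ridge_mix : bmf ridge_mix.
Proof. exact: (bmf_partial_Rint Q mu bmf_pair). Qed.

(** Fubini moves the integral over directions outside. The bound for one ridge function is linear in
    the l1 norm of its direction, so integrating it brings in only the first moment of [mu]. *)
Lemma ridge_mix_dual_bound (S : borel_rV R d -> R) (m : nat) (K sig : R) :
  (0 < m)%N -> bmf S -> (forall a b, `|h a - h b| <= `|a - b|) -> h 0 = 0 ->
  (\int[mu]_w (norm1 (w : 'rV[R]_d))%:E <= K%:E)%E ->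
  (forall (w : 'rV[R]_d) b, (forall j, `|w 0 j| <= m%:R) -> `|b| <= m%:R ->
     `|\int[Q]_x (S x * unit_fun w b x)| <= sig) ->
  `|\int[Q]_x (S x * ridge_mix x)| <= (4 * sig + 6 / m%:R * \int[Q]_x `|S x|) * K.
Proof.
move=> m0 bS hlip h0 muK Hsig.
have bF : bmf (fun z : borel_rV R d * borel_rV R d =>
    S z.1 * h (dotrv (z.2 : 'rV[R]_d) (z.1 : 'rV[R]_d))).
  by apply: bmfM => //; apply: (bmf_comp S fst) => //; exact: measurable_fst.
have bhx x : bmf (fun w : borel_rV R d => h (dotrv (w : 'rV[R]_d) (x : 'rV[R]_d))).
  apply: (bmf_comp (fun z : borel_rV R d * borel_rV R d =>
     h (dotrv (z.2 : 'rV[R]_d) (z.1 : 'rV[R]_d))) (fun w => (x, w))) => //.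
  exact: measurable_pair1.
have -> : \int[Q]_x (S x * ridge_mix x) =
    \int[mu]_w \int[Q]_x (S x * h (dotrv (w : 'rV[R]_d) (x : 'rV[R]_d))).
  rewrite -(Rint_fubini Q mu bF); apply: eq_Rintegral => x _.
  by rewrite /ridge_mix -RintZ.
apply: (norm_ridge_int_le muK).
- have sig0 : 0 <= sig.
    apply: le_trans (Hsig 0 0 _ _) => //; last by rewrite normr0.
    by move=> j; rewrite mxE normr0.
  rewrite addr_ge0 ?mulr_ge0 ?divr_ge0//.
  by apply: Rintegral_ge0.
- have bF' : bmf (fun z : borel_rV R d * borel_rV R d =>
      S z.2 * h (dotrv (z.1 : 'rV[R]_d) (z.2 : 'rV[R]_d))).
    apply: (bmf_comp _ (fun z : borel_rV R d * borel_rV R d => (z.2, z.1)) _ bF).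
    apply/measurable_fun_pairP; split; [exact: measurable_snd|exact: measurable_fst].
  exact: (bmf_partial_Rint mu Q bF').
- by move=> w; exact: ridge_dual_bound.
Qed.
End ridge_mixture.

End barron_representation.

Section lipschitz.
Context {R : realType}.

Lemma is_derive_lip (f df : R -> R) (C : R) :
  (forall x : R, is_derive x (1 : R) f (df x)) -> (forall x, `|df x| <= C) ->
  forall a b, `|f a - f b| <= C * `|a - b|.
Proof.
move=> fd dfC a b.
wlog ba : a b / b <= a.
  by move=> H; case: (leP b a) => [/H//|/ltW /H]; rewrite distrC (distrC b).
have cf : {within `[b, a], continuous f}.
  apply: continuous_subspaceT => x; apply: differentiable_continuous.
  by apply/derivable1_diffP; have [] := fd x.
have [c _ ->] := MVT_segment ba (fun x _ => fd x) cf.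
by rewrite normrM ler_wpM2r.
Qed.

(** The cosine is shifted to vanish at 0, as [ridge_dual_bound] requires; the removed constants are
    collected into the value at the origin, which becomes the output bias. *)
Definition cosm1 (t : R) : R := cos t - 1.

Lemma cosm1_lip a b : `|cosm1 a - cosm1 b| <= `|a - b|.
Proof.
rewrite /cosm1 opprB addrA subrK -[leRHS]mul1r.
apply: (@is_derive_lip cos (fun x => - sin x)) => x.
by rewrite normrN ler_norml sin_geN1 sin_le1.
Qed.

Lemma sin_lip a b : `|sin a - sin b| <= `|a - b| :> R.
Proof.
rewrite -[leRHS]mul1r; apply: (@is_derive_lip sin cos) => x.
by rewrite ler_norml cos_geN1 cos_le1.
Qed.

Lemma lip1_continuous (h : R -> R) :
  (forall a b, `|h a - h b| <= `|a - b|) -> continuous h.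
Proof.
move=> hl x; apply/cvgrPdist_le => /= e e0; near=> y.
apply: (le_trans (hl _ _)); near: y.
have : y @[y --> x] --> x by exact: cvg_id.
by move/cvgrPdist_le; exact.
Unshelve. all: by end_near. Qed.

Lemma cosm1_bounded : exists M, forall t, `|cosm1 t| <= M.
Proof.
by exists 2 => t; rewrite ler_norml /cosm1; have := @cos_geN1 R t; have := @cos_le1 R t => *; apply/andP; split; lra.
Qed.

Lemma sin_bounded : exists M, forall t : R, `|sin t| <= M.
Proof. by exists 1 => t; rewrite ler_norml sin_geN1 sin_le1. Qed.

End lipschitz.

(** The integral of a nonnegative function is a supremum over simple functions below it, hence
    monotone without measurability. The integrand in question is the supremum of |w.x| over the
    cube. *)
Lemma le_integral_nonmeasurable {d} {T : measurableType d} {R : realType}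
    (mu : {measure set T -> \bar R}) (f g : T -> \bar R) :
  (forall x, 0 <= f x)%E -> (forall x, f x <= g x)%E ->
  (\int[mu]_x f x <= \int[mu]_x g x)%E.
Proof.
move=> f0 fg; have g0 x := le_trans (f0 x) (fg x).
rewrite !ge0_integralTE//; apply: le_ereal_sup => _ [h hf <-].
by exists h => //= x; exact: le_trans (hf x) (fg x).
Qed.

Section barron_mixture.
Context {R : realType} {d : nat}.
Hypothesis hd : (0 < d)%N.

(** The unit vectors lie in the cube, so each |w_j| is at most the supremum. A factor d thus buys a
    measurable replacement for the Barron integrand. *)
Lemma norm1_le_sup (w : 'rV[R]_d) :
  ((norm1 w / d%:R)%:E <= ereal_sup [set `|dotrv w x|%:E | x in @unit_cube R d])%E.
Proof.
have dn0 : 0 < d%:R :> R by rewrite ltr0n.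
have supj j : (`|w 0 j|%:E <= ereal_sup [set `|dotrv w x|%:E | x in @unit_cube R d])%E.
  apply: ereal_sup_ubound; exists (delta_mx 0 j).
    by move=> i; rewrite mxE eqxx/=; case: eqP => _; rewrite ?lexx ?ler01.
  rewrite /dotrv (bigD1 j)//= mxE !eqxx mulr1 big1 ?addr0//.
  by move=> i /negbTE ij; rewrite mxE eqxx ij mulr0.
move: supj; set s := ereal_sup _; case: s => [s| |] supj.
- rewrite lee_fin ler_pdivrMr// mulrC.
  apply: (@le_trans _ _ (\sum_(j < d) s)); last by rewrite sumr_const card_ord mulr_natl.
  by apply: ler_sum => j _; rewrite -lee_fin.
- by rewrite leey.
- by have := supj (Ordinal hd); rewrite leeNy_eq.
Qed.

Section magnitude.
Variables (nu : complex_measure R (borel_rV R d)) (F : {measure set (borel_rV R d) -> \bar R}).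
Hypothesis magF : is_magnitude nu F.

Lemma magnitude_ge A : measurable A -> ((Normc.normc (cmeas nu A))%:E <= F A)%E.
Proof.
move=> mA; rewrite magF//.
pose E i := if i == 0%N then A else set0.
apply: (@le_trans _ _ (\sum_(0 <= i <oo) (Normc.normc (cmeas nu (E i)))%:E)%E); last first.
  apply: ereal_sup_ubound; exists E => //; split.
  - by move=> i; rewrite /E; case: ifP => _ //; exact: measurable0.
  - by apply/trivIsetP => -[|i] [|j] _ _ //= _; rewrite /E/= ?set0I ?setI0.
  - by apply/seteqP; split => [x [[|i] _ //]|x Ax]; exists 0%N.
apply: le_trans (nneseries_lim_ge 1 _).
  by rewrite big_nat1.
by move=> i _ _; rewrite lee_fin /Normc.normc; case: (cmeas _ _) => a b; exact: sqrtr_ge0.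
Qed.

Lemma fin_charge (n : {charge set (borel_rV R d) -> \bar R}) A :
  measurable A -> n A = (fine (n A))%:E.
Proof. by move=> mA; rewrite fineK// fin_num_measure. Qed.

Lemma re_le_magnitude A : measurable A -> (`|re_charge nu A| <= F A)%E.
Proof.
move=> mA; apply: le_trans (magnitude_ge mA); rewrite fin_charge//= lee_fin.
by rewrite /cmeas /= -sqrtr_sqr ler_wsqrtr// lerDl sqr_ge0.
Qed.

Lemma im_le_magnitude A : measurable A -> (`|im_charge nu A| <= F A)%E.
Proof.
move=> mA; apply: le_trans (magnitude_ge mA); rewrite fin_charge//= lee_fin.
by rewrite /cmeas /= -sqrtr_sqr ler_wsqrtr// lerDr sqr_ge0.
Qed.

(** The positive part of A is n(A and P), which is at most F(A and P) and so at most F(A); likewise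
    for the negative part. *)
Lemma jordan_le_magnitude (n : {charge set (borel_rV R d) -> \bar R}) P N
    (nPN : hahn_decomposition n P N) :
  (forall A, measurable A -> (`|n A| <= F A)%E) ->
  forall A, measurable A -> (jordan_pos nPN A <= F A /\ jordan_neg nPN A <= F A)%E.
Proof.
move=> nF A mA; have [[mP _] [mN _] _ _] := nPN; split.
  rewrite jordan_posE cjordan_posE /crestr0 mem_set// /crestr.
  apply: (@le_trans _ _ (F (A `&` P))); last first.
    by apply: le_measure; [exact/mem_set/measurableI|exact: mem_set|exact: subIsetl].
  apply: le_trans (nF _ _); last exact: measurableI.
  exact: lee_abs.
rewrite jordan_negE cjordan_negE /crestr0 mem_set// /crestr.
apply: (@le_trans _ _ (F (A `&` N))); last first.
  by apply: le_measure; [exact/mem_set/measurableI|exact: mem_set|exact: subIsetl].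
apply: le_trans (nF _ _); last exact: measurableI.
by rewrite -abseN; exact: lee_abs.
Qed.

Lemma int_norm1_le (c : R) (mu : {finite_measure set (borel_rV R d) -> \bar R}) :
  (\int[F]_w ereal_sup [set `|dotrv (w : 'rV[R]_d) x|%:E | x in @unit_cube R d] <= c%:E)%E ->
  (forall A, measurable A -> (mu A <= F A)%E) ->
  (\int[mu]_w (norm1 (w : 'rV[R]_d))%:E <= (d%:R * c)%:E)%E.
Proof.
move=> Fc muF; have dn0 : 0 < d%:R :> R by rewrite ltr0n.
have mn : measurable_fun setT (fun w : borel_rV R d => (norm1 (w : 'rV[R]_d) / d%:R)%:E).
  by apply/measurable_EFinP; apply: measurable_funM; [exact: measurable_norm1|exact: measurable_cst].
have n0 (w : 'rV[R]_d) : (0 <= (norm1 w / d%:R)%:E)%E.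
  by rewrite lee_fin divr_ge0 ?norm1_ge0// ltW.
rewrite (_ : (\int[mu]_w _)%E = (d%:R%:E * \int[mu]_w (norm1 (w : 'rV[R]_d) / d%:R)%:E)%E).
  rewrite EFinM lee_wpmul2l ?lee_fin ?(ltW dn0)//.
  apply: le_trans Fc; apply: (@le_trans _ _ (\int[F]_w (norm1 (w : 'rV[R]_d) / d%:R)%:E)%E).
    exact: ge0_le_measure_integral.
  by apply: le_integral_nonmeasurable => // w; exact: norm1_le_sup.
rewrite -ge0_integralZl//.
by apply: eq_integral => w _; rewrite -EFinM mulrC divfK// gt_eqF.
Qed.

End magnitude.

(** The real part of the Fourier representation is the integral of cos against the real charge minus
    that of sin against the imaginary one. Subtracting its value at 0 turns cos into [cosm1], and
    the two Jordan decompositions give four measures, all dominated by the magnitude. *)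
Lemma barron_mixture (c : R) (g : 'rV[R]_d -> R) : barron c g ->
  exists mu1 mu2 mu3 mu4 : {finite_measure set (borel_rV R d) -> \bar R},
   [/\ forall x, g x = g 0 + (ridge_mix mu1 cosm1 x - ridge_mix mu2 cosm1 x) -
          (ridge_mix mu3 sin x - ridge_mix mu4 sin x),
       `|g 0| <= c,
       (\int[mu1]_w (norm1 (w : 'rV[R]_d))%:E <= (d%:R * c)%:E)%E /\
       (\int[mu2]_w (norm1 (w : 'rV[R]_d))%:E <= (d%:R * c)%:E)%E &
       (\int[mu3]_w (norm1 (w : 'rV[R]_d))%:E <= (d%:R * c)%:E)%E /\
       (\int[mu4]_w (norm1 (w : 'rV[R]_d))%:E <= (d%:R * c)%:E)%E].
Proof.
move=> [nu [F [frep magF]]]; rewrite ge_max => /andP[Fc g0c].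
pose Pr' := cid (Hahn_decomposition (re_charge nu)).
pose rPN := svalP (cid (svalP Pr')).
pose Pi := cid (Hahn_decomposition (im_charge nu)).
pose iPN := svalP (cid (svalP Pi)).
exists (jordan_pos rPN), (jordan_neg rPN), (jordan_pos iPN), (jordan_neg iPN).
have jr := jordan_le_magnitude rPN (re_le_magnitude magF).
have ji := jordan_le_magnitude iPN (im_le_magnitude magF).
split.
- move=> x.
  have rep y : g y = (\int[jordan_pos rPN]_w cos (dotrv (w : 'rV[R]_d) y) -
      \int[jordan_neg rPN]_w cos (dotrv (w : 'rV[R]_d) y)) -
      (\int[jordan_pos iPN]_w sin (dotrv (w : 'rV[R]_d) y) -
      \int[jordan_neg iPN]_w sin (dotrv (w : 'rV[R]_d) y)).
    by have := frep y => /(congr1 (@complex.Re R)).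
  have bcos (y : 'rV[R]_d) : bmf (fun w : borel_rV R d => cos (dotrv (w : 'rV[R]_d) y)).
    split; last by exists 1 => w; rewrite ler_norml cos_geN1 cos_le1.
    apply: measurableT_comp.
      by apply: continuous_measurable_fun; exact: continuous_cos.
    apply: measurable_sum => j; apply: measurable_funM; last exact: measurable_cst.
    exact: measurable_coord.
  have z (w : 'rV[R]_d) : dotrv w 0 = 0.
    by apply: big1 => j _; rewrite mxE mulr0.
  have cosE (mu : {finite_measure set (borel_rV R d) -> \bar R}) :
      ridge_mix mu cosm1 x = \int[mu]_w cos (dotrv (w : 'rV[R]_d) x) -
        \int[mu]_w cos (dotrv (w : 'rV[R]_d) 0).
    rewrite /ridge_mix /cosm1 -RintB//; apply: eq_Rintegral => w _.
    by rewrite z cos0.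
  have sin0E (mu : {finite_measure set (borel_rV R d) -> \bar R}) :
      \int[mu]_w sin (dotrv (w : 'rV[R]_d) 0) = 0.
    transitivity (\int[mu]_w (0 : R)).
      by apply: eq_Rintegral => w _; rewrite z sin0.
    by rewrite Rintegral_cst// mul0r.
  rewrite (rep x) (rep 0) !sin0E !cosE /ridge_mix.
  ring.
- by move: g0c; rewrite lee_fin.
- by split; apply: (int_norm1_le Fc) => A mA; have [] := jr A mA.
- by split; apply: (int_norm1_le Fc) => A mA; have [] := ji A mA.
Qed.

End barron_mixture.

(** * Greedy selection of neurons *)

Section greedy.
Context {R : realType} {d : nat}.
Variable Q : probability (borel_rV R d) R.
Variables (ft : borel_rV R d -> R) (V eps C1 : R) (m : nat).
Hypothesis bft : bmf ft.
Hypotheses (V0 : 0 < V) (eps0 : 0 <= eps) (ftC1 : forall x, `|ft x| + 2 * V <= C1).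
Hypothesis dual : forall (S : borel_rV R d -> R) (sig : R), bmf S ->
  (forall (w : 'rV[R]_d) b, (forall j, `|w 0 j| <= m%:R) -> `|b| <= m%:R ->
     `|\int[Q]_x (S x * unit_fun w b x)| <= sig) ->
  `|\int[Q]_x (S x * ft x)| <= V * sig + eps * \int[Q]_x `|S x|.

Let box (w : 'rV[R]_d) (b : R) := (forall j, `|w 0 j| <= m%:R) /\ `|b| <= m%:R.

(* The dual hypothesis, applied with sig the supremum of the correlations of S
   with neurons, leaves a factor 2 of room: beta = +-2V at a neuron reaching half
   of that supremum. *)
Lemma greedy_step (S : borel_rV R d -> R) : bmf S ->
  exists (beta : R) (w : 'rV[R]_d) (b : R), [/\ `|beta| <= 2 * V, box w b &
    \int[Q]_x (S x * (ft x - beta * unit_fun w b x)) <= eps * \int[Q]_x `|S x|].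
Proof.
move=> bS.
have bSu w b : bmf (fun x : borel_rV R d => S x * unit_fun w b x).
  by apply: bmfM => //; exact: bmf_unit_fun.
pose I (w : 'rV[R]_d) b := \int[Q]_x (S x * unit_fun w b x).
have b0 : box 0 0 by split => [j|]; rewrite ?mxE normr0.
pose A := [set r | exists w b, box w b /\ r = `|I w b|].
have supA : has_sup A.
  split; first by exists `|I 0 0|, 0, 0.
  exists (\int[Q]_x `|S x|) => _ [w [b [_ ->]]].
  apply: le_norm_Rint => //; first exact: bmf_norm.
  by move=> x; rewrite normrM ler_piMr//; exact: norm_sigmoid_le1.
have leA w b : box w b -> `|I w b| <= sup A.
  by move=> wb; apply: ub_le_sup; [exact: supA.2|exists w, b].
have D : `|\int[Q]_x (S x * ft x)| <= V * sup A + eps * \int[Q]_x `|S x|.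
  by apply: dual => // w b wm bm; exact: leA.
have E beta w b : \int[Q]_x (S x * (ft x - beta * unit_fun w b x)) =
    \int[Q]_x (S x * ft x) - beta * I w b.
  rewrite /I -RintZ// -RintB//; last 2 first.
  - exact: bmfM.
  - exact: bmfZ.
  by apply: eq_Rintegral => x _; ring.
have : 0 <= sup A by apply: le_trans (leA _ _ b0).
rewrite le_eqVlt => /orP[/eqP A0|Apos].
  rewrite -A0 mulr0 add0r in D.
  exists 0, 0, 0; split; [by rewrite normr0 mulr_ge0// ltW|exact: b0|].
  by rewrite E mul0r subr0; exact: le_trans (ler_norm _) D.
have [_ [w [b [wb ->]]] Iwb] : exists2 r, A r & sup A / 2 < r.
  apply/(sup_gt supA.1); lra.
exists (2 * V * Num.sg (I w b)), w, b; split => //.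
  rewrite normrM ger0_norm ?mulr_ge0 ?(ltW V0)//.
  rewrite ler_piMr ?mulr_ge0 ?(ltW V0)// normr_sg.
  by case: (_ != 0); rewrite ?lexx ?ler01.
rewrite E -mulrA -normrEsg.
have h : V * sup A <= 2 * V * `|I w b|.
  by rewrite -mulrA mulrCA ler_wpM2l ?(ltW V0)//; lra.
have := le_trans (ler_norm _) D; lra.
Qed.

(** The residuals of single neurons are accumulated without weights. Dividing the sum by k at the
    end gives all neurons outer weights of order 1/k, as the class prescribes. Each step adds to the
    squared norm twice the correlation supplied by [greedy_step], at most 2 eps k C1, plus the
    square C1^2 of the new term. *)
Lemma greedy_approx (k : nat) :
  exists (beta : nat -> R) (w : nat -> 'rV[R]_d) (b : nat -> R),
    [/\ forall i, `|beta i| <= 2 * V, forall i, box (w i) (b i) &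
     \int[Q]_x (\sum_(i < k) (ft x - beta i * unit_fun (w i) (b i) x)) ^+ 2 <=
       k%:R * (2 * eps * k%:R * C1 + C1 ^+ 2)].
Proof.
have C10 : 0 <= C1.
  by apply: le_trans (ftC1 0); rewrite addr_ge0// mulr_ge0// ltW.
suff H j : (j <= k)%N -> exists (beta : nat -> R) (w : nat -> 'rV[R]_d) (b : nat -> R),
    [/\ forall i, `|beta i| <= 2 * V, forall i, box (w i) (b i) &
     \int[Q]_x (\sum_(i < j) (ft x - beta i * unit_fun (w i) (b i) x)) ^+ 2 <=
       j%:R * (2 * eps * k%:R * C1 + C1 ^+ 2)] by exact: H.
elim: j => [|j IH] jk.
  exists (fun=> 0), (fun=> 0), (fun=> 0); split => [i|i|].
  - by rewrite normr0 mulr_ge0// ltW.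
  - by split => [j|]; rewrite ?mxE normr0.
  - have -> : (fun x => (\sum_(i < 0) (ft x - 0 * unit_fun (0 : 'rV[R]_d) 0 x)) ^+ 2) = (fun=> 0).
      by apply/funext => x; rewrite big_ord0 expr0n.
    by rewrite Rint_cst mul0r.
have [beta [w [b [hbeta hwb HS]]]] := IH (ltnW jk).
pose S x := \sum_(i < j) (ft x - beta i * unit_fun (w i) (b i) x).
have bdiff be ww bb : bmf (fun x : borel_rV R d => ft x - be * unit_fun ww bb x).
  by apply: bmfB => //; apply: bmfZ; exact: bmf_unit_fun.
have bS : bmf S by apply: bmf_sum.
have [be [ww [bb [hbe hbox Hstep]]]] := greedy_step bS.
exists (fun i => if i == j then be else beta i), (fun i => if i == j then ww else w i),
  (fun i => if i == j then bb else b i); split.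
- by move=> i; case: eqP.
- by move=> i; case: eqP.
have diffC1 be' ww' bb' x : `|be'| <= 2 * V -> `|ft x - be' * unit_fun ww' bb' x| <= C1.
  move=> hbe'; apply: le_trans (ler_normB _ _) _; apply: le_trans (ftC1 x).
  rewrite lerD2l normrM -[leRHS]mulr1; apply: ler_pM => //.
  exact: norm_sigmoid_le1.
have SC x : `|S x| <= k%:R * C1.
  apply: (le_trans (ler_norm_sum _ _ _)).
  apply: (@le_trans _ _ (\sum_(i < j) C1)).
    by apply: ler_sum => i _; exact: diffC1.
  rewrite sumr_const card_ord -[X in X <= _]mulr_natl ler_wpM2r// ler_nat.
  exact: ltnW.
pose D x := ft x - be * unit_fun ww bb x.
have bD : bmf (D : borel_rV R d -> R) by exact: bdiff.
have -> : (fun x => (\sum_(i < j.+1) (ft x - (if i == j :> nat then be else beta i) *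
      unit_fun (if i == j :> nat then ww else w i) (if i == j :> nat then bb else b i) x)) ^+ 2) =
    (fun x => S x ^+ 2 + 2 * (S x * D x) + D x ^+ 2).
  apply/funext => x; rewrite big_ord_recr/= eqxx.
  rewrite (eq_bigr (fun i : 'I_j => ft x - beta i * unit_fun (w i) (b i) x)).
    by rewrite -/(S x) -/(D x); ring.
  by move=> i _; rewrite ltn_eqF// ltn_ord.
rewrite RintD; last 2 first.
- by apply: bmfD; [exact: bmf_sqr|apply: bmfZ; exact: bmfM].
- exact: bmf_sqr.
rewrite RintD; [|exact: bmf_sqr|by apply: bmfZ; exact: bmfM].
rewrite RintZ; last exact: bmfM.
have h1 : \int[Q]_x D x ^+ 2 <= C1 ^+ 2.
  rewrite -[leRHS](Rint_cst Q); apply: le_Rint; [exact: bmf_sqr|exact: bmf_cst|].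
  move=> x; rewrite -[leLHS]ger0_norm ?sqr_ge0// normrX lerXn2r ?nnegrE//.
  exact: diffC1.
have h2 : \int[Q]_x (S x * D x) <= eps * (k%:R * C1).
  apply: (le_trans Hstep); rewrite ler_wpM2l//.
  rewrite -[leRHS](Rint_cst Q); apply: le_Rint; [exact: bmf_norm|exact: bmf_cst|exact: SC].
move: HS; rewrite -[j.+1%:R]natr1 -/(S _).
have -> : \int[Q]_x (\sum_(i < j) (ft x - beta i * unit_fun (w i) (b i) x)) ^+ 2 =
  \int[Q]_x (S x ^+ 2) by [].
lra.
Qed.

End greedy.

Section barron_approximation.
Context {R : realType} {d : nat}.
Hypothesis hd : (0 < d)%N.
Variable Q : probability (borel_rV R d) R.
Hypothesis Q1 : Q (@unit_cube R d) = 1%E.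

Lemma barron_approximation (c : R) (g : 'rV[R]_d -> R) : barron c g ->
  exists V C : R, [/\ 0 <= V, 0 <= C, bmf (g : borel_rV R d -> R) &
   forall k m : nat, (0 < k)%N -> (0 < m)%N ->
   exists (beta : 'I_k -> R) (w : 'I_k -> 'rV[R]_d) (b : 'I_k -> R),
    [/\ forall i, `|beta i| <= V / k%:R, forall i j, `|w i 0 j| <= m%:R,
        forall i, `|b i| <= m%:R &
     \int[Q]_x (nn beta w b (g 0) x - g x) ^+ 2 <= C * (k%:R^-1 + m%:R^-1)]].
Proof.
move=> /(barron_mixture hd)[mu1 [mu2 [mu3 [mu4 [gE g0c [I1 I2] [I3 I4]]]]]].
have c0 : 0 <= c by exact: le_trans g0c.
have cc := lip1_continuous (@cosm1_lip R).
have cs := lip1_continuous (@sin_lip R).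
have bc := @cosm1_bounded R; have bs := @sin_bounded R.
have b1 := bmf_ridge_mix Q mu1 cc bc.
have b2 := bmf_ridge_mix Q mu2 cc bc.
have b3 := bmf_ridge_mix Q mu3 cs bs.
have b4 := bmf_ridge_mix Q mu4 cs bs.
pose ft x := (ridge_mix mu1 cosm1 x - ridge_mix mu2 cosm1 x) -
  (ridge_mix mu3 sin x - ridge_mix mu4 sin x).
have bft : bmf ft by apply: bmfB; exact: bmfB.
have gft x : g x = g 0 + ft x by rewrite (gE x) /ft; ring.
have bg : bmf (g : borel_rV R d -> R).
  have -> : g = fun x => g 0 + ft x by apply/funext.
  by apply: bmfD => //; exact: bmf_cst.
have [_ [M ftM]] := bft.
have M0 : 0 <= M by exact: le_trans (ftM 0).
pose K := d%:R * c.
have K0 : 0 <= K by rewrite mulr_ge0.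
(* Each of the four mixtures costs 4 K sig and 6 K / m by [ridge_mix_dual_bound], hence 16 K here
   and 24 K / m in [eps]; the added 1 makes V positive. *)
pose V := 16 * K + 1.
have V0 : 0 < V by rewrite /V; lra.
pose C1 := M + 2 * V.
have C10 : 0 <= C1 by rewrite /C1; lra.
have cos0' : cosm1 (0 : R) = 0 by rewrite /cosm1 cos0 subrr.
exists (2 * V), (48 * K * C1 + C1 ^+ 2); split => //.
- by rewrite mulr_ge0// ltW.
- by rewrite addr_ge0 ?sqr_ge0// !mulr_ge0.
move=> k m k0 m0.
have m0' : 0 < m%:R :> R by rewrite ltr0n.
have k0' : 0 < k%:R :> R by rewrite ltr0n.
pose eps := 24 * K / m%:R.
have eps0 : 0 <= eps by rewrite divr_ge0 ?mulr_ge0// ltW.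
have ftC1 x : `|ft x| + 2 * V <= C1 by rewrite lerD2r.
have dual (S : borel_rV R d -> R) (sig : R) : bmf S ->
  (forall (w : 'rV[R]_d) b, (forall j, `|w 0 j| <= m%:R) -> `|b| <= m%:R ->
     `|\int[Q]_x (S x * unit_fun w b x)| <= sig) ->
  `|\int[Q]_x (S x * ft x)| <= V * sig + eps * \int[Q]_x `|S x|.
  move=> bS Hsig.
  have D1 := ridge_mix_dual_bound Q1 cc bc m0 bS (@cosm1_lip R) cos0' I1 Hsig.
  have D2 := ridge_mix_dual_bound Q1 cc bc m0 bS (@cosm1_lip R) cos0' I2 Hsig.
  have D3 := ridge_mix_dual_bound Q1 cs bs m0 bS (@sin_lip R) (@sin0 R) I3 Hsig.
  have D4 := ridge_mix_dual_bound Q1 cs bs m0 bS (@sin_lip R) (@sin0 R) I4 Hsig.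
  have sig0 : 0 <= sig.
    apply: le_trans (Hsig 0 0 _ _) => //; last by rewrite normr0 ltW.
    by move=> j; rewrite mxE normr0 ltW.
  rewrite (_ : \int[Q]_x (S x * ft x) = (\int[Q]_x (S x * ridge_mix mu1 cosm1 x) -
     \int[Q]_x (S x * ridge_mix mu2 cosm1 x)) - (\int[Q]_x (S x * ridge_mix mu3 sin x) -
     \int[Q]_x (S x * ridge_mix mu4 sin x))); last first.
    rewrite -!RintB//; try exact: bmfM.
    - by apply: eq_Rintegral => x _; rewrite /ft; ring.
    - by apply: bmfB; exact: bmfM.
    - by apply: bmfB; exact: bmfM.
  apply: le_trans (ler_normB _ _) _.
  apply: le_trans (lerD (ler_normB _ _) (ler_normB _ _)) _.
  apply: le_trans (lerD (lerD D1 D2) (lerD D3 D4)) _.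
  rewrite -/K /V /eps.
  set t := \int[Q]_x `|S x|.
  rewrite [leLHS](_ : _ = 16 * K * sig + 24 * K / m%:R * t); last by field; rewrite gt_eqF.
  by rewrite lerD2r [leRHS]mulrDl mul1r lerDl.
have [beta [w [b [hbeta hbox HS]]]] := greedy_approx bft V0 eps0 ftC1 dual k.
exists (fun i => beta i / k%:R), (fun i => w i), (fun i => b i); split.
- by move=> i; rewrite normrM (@ger0_norm _ k%:R^-1) ?invr_ge0// ler_wpM2r ?invr_ge0.
- by move=> i j; have [] := hbox i.
- by move=> i; have [] := hbox i.
pose S x := \sum_(i < k) (ft x - beta i * unit_fun (w i) (b i) x).
have bS : bmf (S : borel_rV R d -> R).
  apply: bmf_sum => i; apply: bmfB => //; apply: bmfZ; exact: bmf_unit_fun.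
have -> : (fun x => (nn (fun i : 'I_k => beta i / k%:R) (fun i => w i) (fun i => b i) (g 0) x - g x) ^+ 2) =
    (fun x => k%:R^-1 ^+ 2 * S x ^+ 2).
  apply/funext => x; rewrite /nn (gft x) /S sumrB sumr_const card_ord.
  rewrite (eq_bigr (fun i : 'I_k => k%:R^-1 * (beta i * unit_fun (w i) (b i) x))).
    rewrite -mulr_sumr -[ft x *+ k]mulr_natl.
    by set s := \sum_(i < k) _; field; rewrite gt_eqF.
  by move=> i _; rewrite mulrAC mulrC.
rewrite RintZ; last exact: bmf_sqr.
apply: (@le_trans _ _ (k%:R^-1 ^+ 2 * (k%:R * (2 * eps * k%:R * C1 + C1 ^+ 2)))).
  by rewrite ler_wpM2l ?sqr_ge0.
rewrite (_ : _ * (_ * _) = 48 * K * C1 * m%:R^-1 + C1 ^+ 2 * k%:R^-1); last first.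
  by rewrite /eps; field; rewrite !gt_eqF.
have h1 : 0 <= 48 * K * C1 * k%:R^-1 by rewrite !mulr_ge0 ?invr_ge0.
have h2 : 0 <= C1 ^+ 2 * m%:R^-1 by rewrite mulr_ge0 ?sqr_ge0 ?invr_ge0.
rewrite [leRHS](_ : _ = 48 * K * C1 * m%:R^-1 + C1 ^+ 2 * k%:R^-1 +
  (48 * K * C1 * k%:R^-1 + C1 ^+ 2 * m%:R^-1)); last by ring.
by rewrite lerDl addr_ge0.
Qed.

End barron_approximation.

(** * The rate of convergence in expectation *)

Section rates.
Context {R : realType}.
Implicit Types x u a : R.

Lemma natr_expR_ln (k : nat) : (0 < k)%N -> k%:R = expR (ln k%:R) :> R.
Proof. by move=> k0; rewrite lnK// posrE ltr0n. Qed.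

Lemma powR_natr (k : nat) a : (0 < k)%N -> k%:R `^ a = expR (a * ln k%:R).
Proof. by move=> k0; rewrite /powR pnatr_eq0 gtn_eqF. Qed.

Lemma sqrt_expR x : Num.sqrt (expR x) = expR (x / 2).
Proof.
rewrite (_ : expR x = expR (x / 2) ^+ 2) ?sqrtr_sqr ?ger0_norm ?expR_ge0//.
by rewrite -expRM_natl; congr expR; field.
Qed.

Lemma le_expR x : x <= expR x.
Proof. by have := expR_ge1Dx x; lra. Qed.

Lemma sqr_le_expR x : 0 <= x -> x ^+ 2 <= 4 * expR x.
Proof.
move=> x0; have h := le_expR (x / 2).
have : (x / 2) ^+ 2 <= expR (x / 2) ^+ 2 by rewrite lerXn2r ?nnegrE ?expR_ge0//; lra.
rewrite -expRM_natl (_ : 2%:R * (x / 2) = x); last by field.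
lra.
Qed.

(** With x = ln k and u = ln n this reads k n^(-1/2) (1 + ln n) <= k^(3/2) n^(-1/2) + 8^4 k^(-1/2).
    If 1 + ln n <= sqrt k the first term suffices. Otherwise k^(3/2) <= (1 + ln n)^3, and the left
    side is at most k^(-1/2) (1 + ln n)^4 n^(-1/2), where the fourth power is beaten by sqrt n. *)
Lemma log_rate x u : 0 <= u ->
  expR (x - u / 2) * (1 + u) <= expR (3 / 2 * x - u / 2) + 8 ^+ 4 * expR (- (x / 2)).
Proof.
move=> u0; have [h|h] := leP (1 + u) (expR (x / 2)).
  rewrite ler_wpDr ?mulr_ge0 ?expR_ge0//.
  rewrite (_ : 3 / 2 * x - u / 2 = (x - u / 2) + x / 2); last by field.
  by rewrite [leRHS]expRD ler_wpM2l ?expR_ge0.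
rewrite ler_wpDl ?expR_ge0//.
have -> : expR (x - u / 2) = expR (- (x / 2)) * expR (x / 2) ^+ 3 * expR (- (u / 2)).
  by rewrite -expRM_natl -!expRD; congr expR; field.
have h3 : expR (x / 2) ^+ 3 <= (1 + u) ^+ 3.
  by rewrite lerXn2r ?nnegrE ?expR_ge0//; lra.
have h8 : 1 + u <= 8 * expR (u / 8).
  by have := expR_ge1Dx (u / 8); lra.
have h4 : (1 + u) ^+ 4 <= 8 ^+ 4 * expR (u / 2).
  apply: (@le_trans _ _ ((8 * expR (u / 8)) ^+ 4)).
    rewrite lerXn2r ?nnegrE ?mulr_ge0 ?expR_ge0//; lra.
  rewrite exprMn -expRM_natl (_ : 4%:R * (u / 8) = u / 2); last by field.
  by [].
have eu : expR (u / 2) * expR (- (u / 2)) = 1 by rewrite -expRD subrr expR0.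
apply: (@le_trans _ _ (expR (- (x / 2)) * ((1 + u) ^+ 3 * expR (- (u / 2)) * (1 + u)))).
  move: h3; move: (expR (x / 2) ^+ 3) ((1 + u) ^+ 3) => E3 U3 h3.
  rewrite -!mulrA; apply: ler_wpM2l; first exact: expR_ge0.
  by apply: ler_wpM2r => //; apply: mulr_ge0; [exact: expR_ge0|lra].
rewrite [leRHS]mulrC; apply: ler_wpM2l; first exact: expR_ge0.
rewrite (_ : _ * _ * _ = (1 + u) ^+ 4 * expR (- (u / 2))); last by ring.
by rewrite -[leRHS]mulr1 -[X in _ <= _ * X]eu mulrA ler_wpM2r ?expR_ge0.
Qed.

End rates.

Section barron_rate.
Context {R : realType} {d : nat}.
Hypothesis hd : (0 < d)%N.
Variables (P Q : probability (borel_rV R d) R).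
Context {disp : measure_display} {Omega : measurableType disp}.
Variables (Pr : probability Omega R) (X Y : nat -> {RV Pr >-> borel_rV R d}).
Hypotheses (hX : iid_from X P) (hY : iid_from Y Q).
Hypotheses (P1 : P (@unit_cube R d) = 1%E) (Q1 : Q (@unit_cube R d) = 1%E).
Variable f : borel_rV R d -> R.
Hypothesis bf : bmf f.
Hypothesis changePQ : forall g : borel_rV R d -> R, bmf g ->
  \int[P]_x g x = \int[Q]_x (expR (f x) * g x).

Let D := \int[P]_x f x.

(** Serves the bounded values of k for which the class may be too small for the approximating
    network. All its members are bounded by 3/2 ln k, and the zero network keeps the supremum from
    being -oo. *)
Lemma NNstar_trivial_error (k n : nat) (H : R) x y : (0 < n)%N -> (0 < k)%N ->
  0 <= ln (k%:R : R) -> 3 / 2 * ln k%:R <= H ->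
  (`|KL_estimator (@NNstar R d k (2^-1 * ln k%:R)) n x y - D%:E| <=
     (H + expR H + 1 + `|D|)%:E)%E.
Proof.
move=> n0 k0 lk0 lkH.
have k0' : 0 < k%:R :> R by rewrite ltr0n.
have gH g : @NNstar R d k (2^-1 * ln k%:R) g -> forall z, `|g z| <= H.
  move=> Gg z; apply: le_trans (norm_NN_le z Gg) _.
  rewrite (_ : _ + _ = 3 / 2 * ln k%:R)//; by field; rewrite gt_eqF.
have G0 : @NNstar R d k (2^-1 * ln k%:R) (fun=> 0).
  exists (fun=> 0), (fun=> 0), (fun=> 0), 0; split.
  - by move=> z; rewrite addr0 big1// => i _; rewrite mul0r.
  - by move=> i j; rewrite mxE normr0 mulr_ge0 ?sqrtr_ge0.
  - by move=> i; rewrite normr0 mulr_ge0 ?sqrtr_ge0.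
  - by move=> i; rewrite normr0 !mulr_ge0// invr_ge0 ltW.
  - by rewrite normr0 mulr_ge0.
have lo := KL_estimator_ge n x y G0.
have up : (KL_estimator (@NNstar R d k (2^-1 * ln k%:R)) n x y <= (H + expR H + 1)%:E)%E.
  apply: KL_estimator_le => g /gH gz.
  by apply: le_trans (ler_norm _) _; exact: emp_obj_le.
have := emp_obj_le x y n0 (gH _ G0); rewrite ler_norml => /andP[lo1 _].
move: lo up; case: (KL_estimator _ _ _ _) => [r| |] //=.
rewrite !lee_fin => lo2 up2; apply: le_trans (ler_normB _ _) _; rewrite lerD2r.
by rewrite ler_norml; apply/andP; split => //; exact: le_trans lo2.
Qed.

(** The greedy network is taken with m the integer part of sqrt k, so that 1/k + 1/m <= 3 / sqrt k.
    The threshold on ln k places it in the class: m <= sqrt k ln k, V/k <= ln k / k, and |g0(0)| <=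
    ln k / 2. Its sup bound does not involve k. *)
Lemma barron_gap (c M : R) (g0 : 'rV[R]_d -> R) : barron c g0 ->
  {ae Q, forall x, f x = g0 x} -> (forall x, `|f x| <= M) ->
  exists V C c0 : R, [/\ 0 <= V, 0 <= C, 0 <= c0 &
    forall k : nat, (0 < k)%N -> 1 + V + 2 * c0 <= ln k%:R ->
    exists g, [/\ @NNstar R d k (2^-1 * ln k%:R) g,
      forall x, `|g x| <= c0 + V & gap P Q f g <= C * expR (- (ln k%:R / 2))]].
Proof.
move=> bg0 fg0 fM.
have M0 : 0 <= M by exact: le_trans (fM 0).
have [V [C [V0 C0 bmg0 approx]]] := barron_approximation hd Q1 bg0.
pose c0 : R := `|g0 0|.
have c00 : 0 <= c0 := normr_ge0 _.
pose K := M + c0 + V.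
have K0 : 0 <= K by rewrite !addr_ge0.
exists V, (9 * expR (3 * K) * (3 * C)), c0; split => //.
  by rewrite !mulr_ge0 ?expR_ge0.
move=> k k0 lk.
have k0' : 0 < k%:R :> R by rewrite ltr0n.
have lk1 : 1 <= ln (k%:R : R).
  by apply: le_trans lk; have := normr_ge0 (g0 0); rewrite -/c0; lra.
have k1 : (1 : R) <= Num.sqrt k%:R.
  by rewrite -[leLHS]sqrtr1 ler_wsqrtr// ler1n.
pose m := Num.truncn (Num.sqrt k%:R : R).
have m0 : (0 < m)%N by rewrite truncn_gt0.
have /andP[m1 m2] := truncn_itv (le_trans ler01 k1).
have [beta [w [b [hbeta hw hb HS]]]] := approx k m k0 m0.
have msq : m%:R <= Num.sqrt k%:R * ln (k%:R : R).
  by apply: (le_trans m1); rewrite ler_peMr ?sqrtr_ge0.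
exists (nn beta w b (g0 0)); split.
- exists beta, w, b, (g0 0); split => //.
  + by move=> i j; exact: le_trans (hw i j) msq.
  + by move=> i; exact: le_trans (hb i) msq.
  + move=> i; apply: le_trans (hbeta i) _.
    rewrite (_ : 2 * k%:R^-1 * _ = ln k%:R / k%:R); last by field; rewrite gt_eqF.
    by rewrite ler_wpM2r ?invr_ge0 ?(ltW k0')//; rewrite /c0 in lk; have := normr_ge0 (g0 0); lra.
  + by rewrite -/c0; lra.
- move=> x; rewrite /nn addrC; apply: le_trans (ler_normD _ _) _; rewrite lerD2l.
  apply: (le_trans (ler_norm_sum _ _ _)).
  apply: (@le_trans _ _ (\sum_(i < k) V / k%:R)).
    apply: ler_sum => i _; rewrite normrM -[leRHS]mulr1.
    by apply: ler_pM => //; exact: norm_sigmoid_le1.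
  by rewrite sumr_const card_ord -[X in X <= _]mulr_natl mulrC divfK// gt_eqF.
have bnn : bmf (nn beta w b (g0 0) : borel_rV R d -> R).
  apply: bmfD; last exact: bmf_cst.
  by apply: bmf_sum => i; apply: bmfZ; exact: bmf_unit_fun.
have nnK x : `|nn beta w b (g0 0) x| <= K.
  rewrite /nn addrC; apply: le_trans (ler_normD _ _) _.
  rewrite /K -addrA addrA lerD//; first by rewrite lerDr.
  apply: (le_trans (ler_norm_sum _ _ _)).
  apply: (@le_trans _ _ (\sum_(i < k) V / k%:R)).
    apply: ler_sum => i _; rewrite normrM -[leRHS]mulr1.
    by apply: ler_pM => //; exact: norm_sigmoid_le1.
  by rewrite sumr_const card_ord -[X in X <= _]mulr_natl mulrC divfK// gt_eqF.
have gle : gap P Q f (nn beta w b (g0 0)) <=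
    9 * expR (3 * K) * \int[Q]_x (nn beta w b (g0 0) x - f x) ^+ 2.
  apply: (gap_le bf changePQ (D := setT)) => //.
    by rewrite setCT measure0.
  by move=> x _; split => //; apply: le_trans (fM x) _; rewrite /K -addrA lerDl addr_ge0.
apply: (le_trans gle); rewrite -[leRHS]mulrA ler_wpM2l ?mulr_ge0 ?expR_ge0//.
have [N [mN QN sub]] := fg0.
have bsq (h : borel_rV R d -> R) : bmf h ->
    bmf (fun x : borel_rV R d => (nn beta w b (g0 0) x - h x) ^+ 2).
  by move=> bh; exact: (bmf_sqr (bmfB bnn bh)).
apply: (@le_trans _ _ (\int[Q]_x (nn beta w b (g0 0) x - g0 x) ^+ 2)).
  apply: (@le_Rint_on _ _ _ Q (~` N)) => //.
  - exact: measurableC.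
  - by rewrite setCK.
  - exact: bsq.
  - exact: bsq.
  move=> x nNx; have -> // : f x = g0 x.
  by apply: contrapT => fx; apply: nNx; exact: sub.
apply: (le_trans HS).
have -> : expR (- (ln k%:R / 2)) = (Num.sqrt k%:R)^-1 :> R.
  by rewrite expRN -sqrt_expR -natr_expR_ln.
rewrite -mulrA [leRHS]mulrCA ler_wpM2l//.
have s0 : 0 < Num.sqrt k%:R :> R by exact: lt_le_trans ltr01 k1.
have h1 : k%:R^-1 <= (Num.sqrt k%:R)^-1 :> R.
  rewrite lef_pV2 ?posrE//.
  by rewrite -[leRHS]sqr_sqrtr ?ler0n// expr2 ler_peMr// ltW.
have m0' : 0 < m%:R :> R by rewrite ltr0n.
have h2 : m%:R^-1 <= 2 * (Num.sqrt k%:R)^-1 :> R.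
  rewrite -[leLHS]mul1r ler_pdivrMr// mulrAC ler_pdivlMr// mul1r.
  have : (1 : R) <= m%:R by rewrite ler1n.
  by move: m2; rewrite -natr1 -/m; lra.
lra.
Qed.

End barron_rate.

Section expected_rate.
Context {R : realType}.
Implicit Types x u a : R.

Lemma net_card_le (d k n : nat) (a0 : R) : (0 < k)%N -> (0 < n)%N ->
  0 <= a0 -> 3 * ln (k%:R : R) <= a0 + ln n%:R ->
  ((2 * (k ^ 3 * n)).+1 ^ (k * d.+2).+1)%:R <=
    expR ((k * d.+2).+1%:R * ((2 + a0) * (1 + ln (n%:R : R)))).
Proof.
move=> k0 n0 a00 kn; rewrite natrX expRM_natl.
have ln0 : 0 <= ln (n%:R : R) by rewrite ln_ge0// ler1n.
rewrite lerXn2r ?nnegrE ?ler0n ?expR_ge0//.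
have h3 : 3 <= expR 2 :> R by have := expR_ge1Dx (2 : R); lra.
apply: (@le_trans _ _ ((3 * (k ^ 3 * n))%:R)).
  by rewrite ler_nat -(addn1 (2 * _)) (mulSn 2) addnC leq_add2r muln_gt0 expn_gt0 k0.
rewrite natrM natrM natrX {1}(@natr_expR_ln R _ k0) {1}(@natr_expR_ln R _ n0).
rewrite -expRM_natl -expRD.
apply: (@le_trans _ _ (expR 2 * expR (3%:R * ln k%:R + ln n%:R))).
  by rewrite ler_wpM2r ?expR_ge0.
rewrite -expRD ler_expR.
have := mulr_ge0 a00 ln0; lra.
Qed.

(** The dependence on the parameters is of order sqrt k (ln k)^2, well below k^3. Resolution k^3 n
    thus makes the rounding error O(1/n), while the logarithm of the size of the net stays of order
    k (1 + ln n). *)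
Lemma NNstar_lip_le (d k n : nat) : (0 < k)%N -> (0 < n)%N -> 1 <= ln (k%:R : R) ->
  (k%:R * (2 * k%:R^-1 * (2^-1 * ln k%:R) + 2 * k%:R^-1 * (2^-1 * ln k%:R) *
     (d.+1%:R * (Num.sqrt k%:R * ln k%:R))) + 2^-1 * ln k%:R) / (k ^ 3 * n)%:R <=
  d.+3%:R / n%:R :> R.
Proof.
move=> k0 n0 lk.
have k0' : 0 < k%:R :> R by rewrite ltr0n.
have n0' : 0 < n%:R :> R by rewrite ltr0n.
have k1 : 1 <= k%:R :> R by rewrite ler1n.
have lkk : ln (k%:R : R) <= k%:R by rewrite {2}(@natr_expR_ln R _ k0) le_expR.
have sk : Num.sqrt k%:R <= k%:R :> R.
  rewrite -[leRHS]ger0_norm ?ler0n// -sqrtr_sqr ler_wsqrtr// expr2 ler_peMr// ltW.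
have s0 : 0 <= Num.sqrt k%:R :> R := sqrtr_ge0 _.
rewrite natrM natrX invfM [leLHS]mulrA ler_wpM2r ?invr_ge0 ?(ltW n0')//.
rewrite ler_pdivrMr ?exprn_gt0//.
rewrite (_ : k%:R * _ + _ = 3 / 2 * ln k%:R + d.+1%:R * (Num.sqrt k%:R * ln k%:R ^+ 2));
  last by field; rewrite gt_eqF.
have d0 : 0 <= d.+1%:R :> R by rewrite ler0n.
have h1 : Num.sqrt k%:R * ln k%:R ^+ 2 <= k%:R ^+ 3 :> R.
  rewrite [leRHS]exprS; apply: ler_pM; rewrite ?sqr_ge0//.
  by rewrite lerXn2r ?nnegrE ?ler0n//; lra.
have h2 : k%:R <= k%:R ^+ 3 :> R.
  by rewrite -{1}[k%:R]expr1; apply: ler_weXn2l.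
have h3 := ler_wpM2l d0 h1.
rewrite -[d.+3%:R]natr1 -[d.+2%:R]natr1 !mulrDl mul1r.
lra.
Qed.

(** Here e^H = k^(3/2) and lam is n^(-1/2) up to a constant. The terms with lam are bounded by
    k^(3/2) n^(-1/2), using H^2 <= 9 e^H; the entropy term is of order k n^(-1/2) (1 + ln n) and
    goes through [log_rate]; the rounding term is of order k^(3/2) / n. *)
Lemma rate_arith (d k n : nat) (C H' a0 gam : R) :
  (0 < k)%N -> (0 < n)%N -> 0 <= a0 -> 0 <= C -> 1 <= ln (k%:R : R) ->
  let x := ln (k%:R : R) in let u := ln (n%:R : R) in
  let lam := expR (- ((u + a0) / 2)) / 3 in
  let L := (k * d.+2).+1%:R * ((2 + a0) * (1 + u)) in
  let H := 3 / 2 * x in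
  gam <= C * expR (- (x / 2)) ->
  gam + lam * (H ^+ 2 + 2 * expR H + H' ^+ 2 + expR H' ^+ 2) +
    (2 * L + 4) / (n%:R * lam) + (1 + expR H) * (d.+3%:R / n%:R)
  <= (C + (12 + H' ^+ 2 + expR H' ^+ 2) +
      3 * expR (a0 / 2) * (2 * d.+3%:R * (2 + a0) + 4) * (8 ^+ 4 + 1) + 2 * d.+3%:R) *
     (expR (- (x / 2)) + expR (3 / 2 * x - u / 2)).
Proof.
move=> k0 n0 a00 C0 lk x u lam L H gamC.
have x0 : 0 <= x by rewrite /x; lra.
have u0 : 0 <= u by rewrite /u ln_ge0// ler1n.
have nE : n%:R = expR u :> R by rewrite /u -natr_expR_ln.
have kE : k%:R = expR x :> R by rewrite /x -natr_expR_ln.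
set p1 := expR (- (x / 2)); set p2 := expR (3 / 2 * x - u / 2).
have p10 : 0 < p1 := expR_gt0 _.
have p20 : 0 < p2 := expR_gt0 _.
have lam0 : 0 < lam by rewrite divr_gt0 ?expR_gt0.
have lamle : lam <= expR (- (u / 2)) / 3.
  by rewrite ler_wpM2r// ler_expR; lra.
have lamHH : lam * expR H <= p2 / 3.
  apply: (@le_trans _ _ (expR (- (u / 2)) / 3 * expR H)).
    by rewrite ler_wpM2r ?expR_ge0.
  by rewrite mulrAC -expRD ler_wpM2r// ler_expR /H; lra.
have lam1 : lam <= p2 / 3.
  apply: le_trans lamle _; rewrite ler_wpM2r// ler_expR; lra.
have H2 : H ^+ 2 <= 9 * expR H.
  rewrite /H exprMn; have := sqr_le_expR x0.
  have : expR x <= expR (3 / 2 * x) by rewrite ler_expR; lra.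
  rewrite (_ : (3 / 2) ^+ 2 = 9 / 4 :> R); last by field.
  lra.
have t1 : lam * (H ^+ 2 + 2 * expR H + H' ^+ 2 + expR H' ^+ 2) <=
    (12 + H' ^+ 2 + expR H' ^+ 2) * p2.
  have e1 := ler_wpM2l (ltW lam0) H2.
  have e2 := ler_wpM2r (sqr_ge0 H') lam1.
  have e3 := ler_wpM2r (sqr_ge0 (expR H')) lam1.
  have e4 := mulr_ge0 (sqr_ge0 H') (ltW p20).
  have e5 := mulr_ge0 (sqr_ge0 (expR H')) (ltW p20).
  lra.
have nlam : n%:R * lam = expR (u / 2 - a0 / 2) / 3.
  by rewrite nE /lam mulrA -expRD; congr (expR _ / 3); field.
have inl : (n%:R * lam)^-1 = 3 * expR (a0 / 2) * expR (- (u / 2)).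
  by rewrite nlam invfM invrK mulrC -expRN -mulrA -expRD; congr (_ * expR _); ring.
have d0 : 0 <= d.+3%:R :> R by rewrite ler0n.
have k1 : 1 <= k%:R :> R by rewrite ler1n.
have L2 : 2 * L + 4 <= (2 * d.+3%:R * (2 + a0) + 4) * (k%:R * (1 + u)).
  have f1 : (k * d.+2).+1%:R <= d.+3%:R * k%:R :> R.
    by rewrite -natrM ler_nat mulSn addnC mulnC -addn1 leq_add2l.
  have f2 : 0 <= (2 + a0) * (1 + u) by apply: mulr_ge0; lra.
  have f3 := ler_wpM2r f2 f1.
  have f4 : 1 <= k%:R * (1 + u).
    by rewrite -[leLHS]mulr1; apply: ler_pM => //; lra.
  by rewrite /L; lra.
have lr := log_rate x u0.
have t2 : (2 * L + 4) / (n%:R * lam) <=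
    3 * expR (a0 / 2) * (2 * d.+3%:R * (2 + a0) + 4) * (8 ^+ 4 + 1) * (p1 + p2).
  rewrite inl.
  apply: (@le_trans _ _ ((2 * d.+3%:R * (2 + a0) + 4) * (k%:R * (1 + u)) *
     (3 * expR (a0 / 2) * expR (- (u / 2))))).
    by rewrite ler_wpM2r// !mulr_ge0 ?expR_ge0.
  rewrite (_ : _ * _ * _ = 3 * expR (a0 / 2) * (2 * d.+3%:R * (2 + a0) + 4) *
     ((k%:R * expR (- (u / 2))) * (1 + u))); last by ring.
  rewrite -[leRHS]mulrA ler_wpM2l//.
    rewrite !mulr_ge0 ?expR_ge0// addr_ge0// !mulr_ge0// addr_ge0//.
  rewrite kE -expRD; apply: (le_trans lr); rewrite -/p1 -/p2.
  have : 0 <= (8 ^+ 4 : R) by rewrite exprn_ge0.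
  move: (8 ^+ 4 : R) => q q0.
  have := mulr_ge0 q0 (ltW p20); lra.
have t3 : (1 + expR H) * (d.+3%:R / n%:R) <= 2 * d.+3%:R * p2.
  have e1 : 1 <= expR H by rewrite -[leLHS]expR0 ler_expR /H; lra.
  have e2 : expR H / n%:R <= p2.
    by rewrite nE -expRN -expRD ler_expR /H; lra.
  have e3 : 0 <= n%:R^-1 :> R by rewrite invr_ge0 ler0n.
  have e4 : (1 + expR H) / n%:R <= 2 * p2.
    have := ler_wpM2r e3 e1; rewrite mul1r => e5; rewrite mulrDl mul1r; lra.
  rewrite [leLHS]mulrCA [leRHS](_ : _ = d.+3%:R * (2 * p2)); last by ring.
  by rewrite ler_wpM2l.
set c3 := 3 * expR (a0 / 2) * _ * _ in t2 *.
have c30 : 0 <= c3.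
  rewrite /c3; apply: mulr_ge0; last by rewrite addr_ge0 ?exprn_ge0.
  by rewrite !mulr_ge0 ?expR_ge0// addr_ge0// !mulr_ge0// addr_ge0.
set c4 := H' ^+ 2 in t1 *; set c5 := expR H' ^+ 2 in t1 *.
have c40 : 0 <= c4 by exact: sqr_ge0.
have c50 : 0 <= c5 by exact: sqr_ge0.
have g1 := mulr_ge0 C0 (ltW p20).
have g2 := mulr_ge0 c40 (ltW p10).
have g3 := mulr_ge0 c50 (ltW p10).
have g4 := mulr_ge0 d0 (ltW p10).
rewrite -/p1 in gamC.
move: t1 t2 t3; move: (lam * _) ((2 * L + 4) / _) ((1 + _) * _) => s1 s2 s3.
lra.
Qed.

End expected_rate.

Section barron_expected_rate.
Context {R : realType} {d : nat}.
Hypothesis hd : (0 < d)%N.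
Variables (P Q : probability (borel_rV R d) R).
Context {disp : measure_display} {Omega : measurableType disp}.
Variables (Pr : probability Omega R) (X Y : nat -> {RV Pr >-> borel_rV R d}).
Hypotheses (hX : iid_from X P) (hY : iid_from Y Q).
Hypotheses (P1 : P (@unit_cube R d) = 1%E) (Q1 : Q (@unit_cube R d) = 1%E).
Variable f : borel_rV R d -> R.
Hypothesis bf : bmf f.
Hypothesis changePQ : forall g : borel_rV R d -> R, bmf g ->
  \int[P]_x g x = \int[Q]_x (expR (f x) * g x).

Let D := \int[P]_x f x.

(** In the form k^3 <= max(A, 1) n, the growth condition is exactly 3 lam e^H <= 1 for the lam of
    [rate_arith]. The maximum with 1 keeps the logarithm nonnegative. *)
Lemma log_sample_size (k n : nat) (A alpha : R) : (0 < k)%N -> (0 < n)%N -> 0 < alpha ->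
  k%:R ^+ 3 <= A * n%:R `^ (1 - alpha) ->
  3 * ln (k%:R : R) <= ln (Num.max A 1) + ln n%:R.
Proof.
move=> k0 n0 al0 kn; have k0' : 0 < k%:R :> R by rewrite ltr0n.
have n0' : 0 < n%:R :> R by rewrite ltr0n.
have A1 : 1 <= Num.max A 1 by rewrite le_max lexx orbT.
have A0 : 0 < Num.max A 1 by exact: lt_le_trans A1.
rewrite -lnM ?posrE// mulr_natl -lnXn// ler_ln ?posrE ?exprn_gt0 ?mulr_gt0//.
apply: (le_trans kn).
apply: (@le_trans _ _ (Num.max A 1 * n%:R `^ (1 - alpha))).
  by rewrite ler_wpM2r ?powR_ge0// le_max lexx.
rewrite ler_wpM2l ?(ltW A0)// -[leRHS]powRr1 ?ler0n// ler_powR ?ler1n//.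
lra.
Qed.

Lemma barron_expected_rate (c M : R) (g0 : 'rV[R]_d -> R) (A alpha : R) :
  barron c g0 -> {ae Q, forall x, f x = g0 x} -> (forall x, `|f x| <= M) ->
  0 < alpha ->
  exists C : R, forall k n : nat, (0 < k)%N -> (0 < n)%N ->
     k%:R ^+ 3 <= A * n%:R `^ (1 - alpha) ->
     (\int[Pr]_w `| KL_estimator (@NNstar R d k (2^-1 * ln k%:R)) n
                      (X ^~ w) (Y ^~ w) - D%:E |
      <= (C * (k%:R `^ (- 2^-1) + k%:R `^ (3 / 2) * n%:R `^ (- 2^-1)))%:E)%E.
Proof.
move=> bg0 fg0 fM al0.
have [V [C1 [c0 [V0 C10 c00 approx]]]] := barron_gap hd Q1 bf changePQ bg0 fg0 fM.
pose B0 := 1 + V + 2 * c0.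
pose a0 := ln (Num.max A 1).
have a00 : 0 <= a0 by rewrite ln_ge0// le_max lexx orbT.
pose H' := c0 + V.
pose Ct := 3 / 2 * B0 + expR (3 / 2 * B0) + 1 + `|D|.
pose Cr := C1 + (12 + H' ^+ 2 + expR H' ^+ 2) +
      3 * expR (a0 / 2) * (2 * d.+3%:R * (2 + a0) + 4) * (8 ^+ 4 + 1) + 2 * d.+3%:R.
have B00 : 0 <= B0 by rewrite /B0; lra.
have Ct0 : 0 <= Ct by rewrite !addr_ge0 ?mulr_ge0 ?expR_ge0.
have Cr0 : 0 <= Cr.
  apply: addr_ge0; last by rewrite mulr_ge0.
  apply: addr_ge0; first by rewrite !addr_ge0 ?sqr_ge0.
  apply: mulr_ge0; last by rewrite addr_ge0 ?exprn_ge0.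
  by rewrite !mulr_ge0 ?expR_ge0// addr_ge0// !mulr_ge0// addr_ge0.
exists (Ct * expR (B0 / 2) + Cr) => k n k0 n0 kn.
have lkn := log_sample_size k0 n0 al0 kn.
have lk0 : 0 <= ln (k%:R : R) by rewrite ln_ge0// ler1n.
rewrite !powR_natr// -expRD.
have -> : - 2^-1 * ln k%:R = - (ln k%:R / 2) :> R by field.
have -> : 3 / 2 * ln k%:R + - 2^-1 * ln n%:R = 3 / 2 * ln k%:R - ln n%:R / 2 :> R by field.
set p1 := expR (- _); set p2 := expR (_ - _).
have p10 : 0 < p1 := expR_gt0 _.
have p20 : 0 < p2 := expR_gt0 _.
(* Below the threshold k is bounded, so k^(-1/2) >= e^(-B0/2) and a multiple of it already dominates
   the trivial error. *)
have [kB|Bk] := ltP (ln (k%:R : R)) B0.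
  apply: (@le_trans _ _ Ct%:E); last first.
    rewrite lee_fin mulrDl.
    apply: (@le_trans _ _ (Ct * expR (B0 / 2) * (p1 + p2))); last first.
      by rewrite lerDl mulr_ge0// addr_ge0// ltW.
    rewrite -mulrA -[leLHS]mulr1 ler_wpM2l//.
    apply: (@le_trans _ _ (expR (B0 / 2) * p1)).
      by rewrite -expRD -[leLHS]expR0 ler_expR; lra.
    by rewrite ler_wpM2l ?expR_ge0// lerDl ltW.
  have -> : Ct%:E = (\int[Pr]_w Ct)%:E by rewrite Rint_cst.
  apply: integral_le_ae_bmf => //; first exact: bmf_cst.
  apply: nearW => w; apply: (NNstar_trivial_error P f (H := 3 / 2 * B0)) => //.
  by rewrite ler_wpM2l// ltW.
have lk1 : 1 <= ln (k%:R : R) by apply: le_trans Bk; rewrite /B0; lra.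
have [g [Gg gH' gapg]] := approx k k0 Bk.
have k0' : 0 < k%:R :> R by rewrite ltr0n.
have HE : k%:R * (2 * k%:R^-1 * (2^-1 * ln k%:R)) + 2^-1 * ln k%:R = 3 / 2 * ln k%:R :> R.
  by field; rewrite gt_eqF.
pose lam := expR (- ((ln n%:R + a0) / 2)) / 3 : R.
pose L := (k * d.+2).+1%:R * ((2 + a0) * (1 + ln (n%:R : R))).
have ln0 : 0 <= ln (n%:R : R) by rewrite ln_ge0// ler1n.
have m0 : (0 < k ^ 3 * n)%N by rewrite muln_gt0 expn_gt0 k0.
have lam0 : 0 < lam by rewrite divr_gt0 ?expR_gt0.
have := @expected_error_le R d P Q _ _ Pr X Y hX hY P1 Q1 f bf changePQ k n (k ^ 3 * n)
  (Num.sqrt k%:R * ln k%:R) (2 * k%:R^-1 * (2^-1 * ln k%:R)) (2^-1 * ln k%:R)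
  lam L g H' _ n0 m0.
rewrite HE => /(_ (C1 * expR (- (ln k%:R / 2)))) E.
have {}E := E _ _ _ lam0 _ _ _ Gg gH' _ gapg.
apply: le_trans (E _ _ _ _ _ _ _) _.
- by rewrite mulr_ge0 ?sqrtr_ge0.
- by rewrite !mulr_ge0 ?invr_ge0 ?ler0n.
- by rewrite mulr_ge0.
- by rewrite /L mulr_ge0// mulr_ge0// addr_ge0.
- rewrite /lam mulrCA mulfV// mulr1 -expRD -[leRHS]expR0 ler_expR /a0; lra.
- exact: net_card_le.
- by rewrite /H'; move: Bk; rewrite /B0; lra.
rewrite lee_fin; apply: (@le_trans _ _ (Cr * (p1 + p2))).
  apply: le_trans (rate_arith d H' k0 n0 a00 C10 lk1 (lexx _)).
  rewrite lerD2l ler_wpM2l ?addr_ge0 ?expR_ge0//.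
  exact: NNstar_lip_le.
by rewrite ler_wpM2r ?addr_ge0 ?(ltW p10) ?(ltW p20)// lerDr mulr_ge0 ?expR_ge0.
Qed.

End barron_expected_rate.

(** * Density of networks with bounded inner weights *)

Section sigmoid_derivatives.
Context {R : realType}.

Lemma is_derive_sigmoid (t : R) :
  is_derive t (1 : R) (@sigmoid R) (sigmoid t * (1 - sigmoid t)).
Proof.
have ne : 1 + expR (- t) != 0 :> R by rewrite gt_eqF// ltr_wpDr ?expR_ge0.
have dN : is_derive t (1 : R) (fun y : R => - y) (- 1).
  exact: is_deriveN.
have dE : is_derive t (1 : R) (expR \o (fun y : R => - y)) (expR (- t) * - 1).
  exact: is_derive1_comp.
have dD : is_derive t (1 : R) (fun y : R => 1 + expR (- y)) (0 + expR (- t) * - 1).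
  exact: (is_deriveD (is_derive_cst (1 : R) t 1) dE).
have := @is_deriveV R (fun y : R => 1 + expR (- y)) t _ 1 ne dD.
move/is_derive_eq; apply; rewrite /sigmoid /GRing.scale/=.
by field.
Qed.

(** As the sigmoid satisfies s' = s - s^2, differentiating p(s(t)) in t yields a polynomial in s
    again; this is the induced operator on p. *)
Definition sigmoid_poly_deriv (p : {poly R}) : {poly R} := p^`() * ('X - 'X ^+ 2).

Lemma is_derive_sigmoid_poly (p : {poly R}) (t : R) :
  is_derive t (1 : R) (fun t => p.[sigmoid t]) (sigmoid_poly_deriv p).[sigmoid t].
Proof.
elim/poly_ind: p => [|p c IH].
  rewrite (_ : (fun t => _) = cst 0); last by apply/funext => x; rewrite horner0.
  by rewrite /sigmoid_poly_deriv deriv0 mul0r horner0; exact: is_derive_cst.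
rewrite (_ : (fun t => _) = (fun t => p.[sigmoid t]) * (@sigmoid R) + cst c); last first.
  by apply/funext => x; rewrite !hornerE.
have dM := is_deriveM IH (is_derive_sigmoid t).
have := is_deriveD dM (is_derive_cst c t (1 : R)).
move/is_derive_eq; apply.
rewrite addr0 /sigmoid_poly_deriv derivD derivM derivX derivC addr0 mulr1 !hornerE.
have sc (a b : R) : a *: (b : R^o) = a * b by [].
rewrite ?fctE ![_ *: _]sc; ring.
Qed.

Lemma sigmoid_poly_bounded (p : {poly R}) : exists2 M, 0 <= M &
  forall t, `|p.[sigmoid t]| <= M.
Proof.
exists (\sum_(i < size p) `|p`_i|); first by apply: sumr_ge0.
move=> t; rewrite horner_coef (le_trans (ler_norm_sum _ _ _))//.
apply: ler_sum => i _; rewrite normrM -[leRHS]mulr1 ler_wpM2l// normrX.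
by rewrite exprn_ile1// norm_sigmoid_le1.
Qed.

Lemma derive_taylor (f f' : R -> R) (C : R) :
  (forall x : R, is_derive x (1 : R) f (f' x)) ->
  (forall a b, `|f' a - f' b| <= C * `|a - b|) ->
  forall t u, `|f (t + u) - f t - u * f' t| <= C * u ^+ 2.
Proof.
move=> df lip t u.
have cf a b : {within `[a, b], continuous f}.
  apply: continuous_subspaceT => x; apply: differentiable_continuous.
  by apply/derivable1_diffP; have [] := df x.
have C0 : 0 <= C by have := lip 1 0; rewrite subr0 normr1 mulr1; exact: le_trans.
have [c [hc ->]] : exists c, `|c - t| <= `|u| /\ f (t + u) - f t = f' c * u.
  have [u0|u0] := leP 0 u.
    have tu : t <= t + u by rewrite lerDl.
    have [c] := MVT_segment tu (fun x _ => df x) (cf _ _).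
    rewrite in_itv/= => /andP[c1 c2] E; exists c; rewrite E; split.
      by rewrite !ger0_norm//; lra.
    by congr (_ * _); ring.
  have tu : t + u <= t by lra.
  have [c] := MVT_segment tu (fun x _ => df x) (cf _ _).
  rewrite in_itv/= => /andP[c1 c2] E; exists c; split.
    rewrite distrC ger0_norm ?subr_ge0// ltr0_norm//; lra.
  by rewrite -[LHS]opprB E; ring.
rewrite (_ : _ - _ = (f' c - f' t) * u); last by ring.
rewrite normrM -real_normK ?num_real// expr2 mulrA ler_wpM2r//.
by apply: (le_trans (lip _ _)); rewrite ler_wpM2l.
Qed.

Lemma sigmoid_poly_taylor (p : {poly R}) : exists2 C, 0 <= C &
  forall t u, `|p.[sigmoid (t + u)] - p.[sigmoid t] -
     u * (sigmoid_poly_deriv p).[sigmoid t]| <= C * u ^+ 2.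
Proof.
have [C C0 HC] := sigmoid_poly_bounded (sigmoid_poly_deriv (sigmoid_poly_deriv p)).
exists C => // t u; apply: (@derive_taylor (fun t => p.[sigmoid t])
  (fun t => (sigmoid_poly_deriv p).[sigmoid t])).
- by move=> x; exact: is_derive_sigmoid_poly.
- apply: (@is_derive_lip _ _ (fun t => (sigmoid_poly_deriv (sigmoid_poly_deriv p)).[sigmoid t])) => //.
  by move=> x; exact: is_derive_sigmoid_poly.
Qed.

(** Differentiation lowers the degree by one and the factor X - X^2 raises it by two, so the n-th
    iterate has degree n + 1. *)
Lemma size_sigmoid_poly_deriv (n : nat) :
  size (iter n sigmoid_poly_deriv 'X) = n.+2.
Proof.
elim: n => [|n IH]; first by rewrite /= size_polyX.
rewrite iterS /sigmoid_poly_deriv; set p := iter n _ _ in IH *.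
have s3 : size ('X - 'X ^+ 2 : {poly R}) = 3.
  by rewrite -opprB size_polyN size_polyDl ?size_polyXn ?size_polyN ?size_polyX.
have sp : size p^`() = n.+1 by rewrite polyorder.size_deriv IH.
rewrite size_mul ?sp ?s3 ?addn3//.
- by rewrite -size_poly_eq0 sp.
- by rewrite -size_poly_eq0 s3.
Qed.

Lemma sigmoid_inj : injective (@sigmoid R).
Proof.
move=> a b /invr_inj/addrI/expR_inj/oppr_inj; exact.
Qed.

(* The iterated derivatives of the sigmoid are nonzero polynomials in the
   sigmoid, so none of them vanishes identically near 0. *)
Lemma sigmoid_deriv_neq0 (n : nat) : exists2 b : R, `|b| < 1 &
  (iter n sigmoid_poly_deriv 'X).[sigmoid b] != 0.
Proof.
apply: contrapT => H.
pose p := iter n sigmoid_poly_deriv 'X : {poly R}.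
have sp : size p = n.+2 := size_sigmoid_poly_deriv n.
(* These are n + 2 distinct values, taken at points of [0, 1); were they all roots, they would
   exceed the degree n + 1. *)
pose rs := [seq sigmoid (i%:R / n.+3%:R : R) | i <- iota 0 n.+2].
have : (size rs < size p)%N.
  apply: max_poly_roots.
  - by rewrite -size_poly_eq0 sp.
  - rewrite /rs all_map; apply/allP => i; rewrite mem_iota add0n => /andP[_ ilt] /=.
    apply: contrapT => /negP nr; apply: H; exists (i%:R / n.+3%:R) => //.
    rewrite ger0_norm ?divr_ge0// ltr_pdivrMr ?ltr0n// mul1r ltr_nat.
    exact: leqW.
  - rewrite map_inj_uniq ?iota_uniq// => i j /sigmoid_inj.
    by move/(mulIf (invr_neq0 _)) => /(_ _)/eqP; rewrite pnatr_eq0 eqr_nat => /(_ isT)/eqP.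
by rewrite size_map size_iota sp ltnn.
Qed.

End sigmoid_derivatives.

Section sigmoid_span.
Context {R : realType} {d : nat}.
Implicit Types (F G : 'rV[R]_d -> R).

(* A triple lists the outer weight, the inner weights and the bias of a neuron. *)
Definition neurons := seq (R * 'rV[R]_d * R).

Definition neurons_eval (s : neurons) (x : 'rV[R]_d) : R :=
  \sum_(q <- s) q.1.1 * unit_fun q.1.2 q.2 x.

Definition small_neurons (s : neurons) : Prop :=
  forall q, q \in s -> (forall j, `|q.1.2 0 j| <= 1) /\ `|q.2| <= 1.

(** The outer weights are left unrestricted, so that the approximable functions form a vector space;
    [neurons_NN] restores the bound 1 on them afterwards. *)
Definition approximable F : Prop := forall e, 0 < e ->
  exists2 s, small_neurons s &
    forall x, unit_cube x -> `|F x - neurons_eval s x| <= e.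

Lemma eq_approximable F G : (forall x, unit_cube x -> F x = G x) ->
  approximable F -> approximable G.
Proof.
move=> FG aF e /aF[s ss Hs]; exists s => // x xc; rewrite -FG//; exact: Hs.
Qed.

Lemma approximable_lim F : (forall e, 0 < e -> exists2 G, approximable G &
    forall x, unit_cube x -> `|F x - G x| <= e) -> approximable F.
Proof.
move=> H e e0; have e2 : 0 < e / 2 by rewrite divr_gt0.
have [G /(_ _ e2)[s ss Hs] FG] := H _ e2.
exists s => // x xc; have := FG x xc; have := Hs x xc.
have -> : F x - neurons_eval s x = (F x - G x) + (G x - neurons_eval s x) by ring.
by have := ler_normD (F x - G x) (G x - neurons_eval s x); lra.
Qed.

Lemma approximableD F G : approximable F -> approximable G ->
  approximable (fun x => F x + G x).
Proof.
move=> aF aG e e0; have e2 : 0 < e / 2 by rewrite divr_gt0.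
have [s ss Hs] := aF _ e2; have [t st Ht] := aG _ e2.
exists (s ++ t) => [q|x xc].
  by rewrite mem_cat => /orP[/ss|/st].
rewrite /neurons_eval big_cat/= -/(neurons_eval s x) -/(neurons_eval t x).
have := Hs x xc; have := Ht x xc.
have -> : F x + G x - (neurons_eval s x + neurons_eval t x) =
  (F x - neurons_eval s x) + (G x - neurons_eval t x) by ring.
by have := ler_normD (F x - neurons_eval s x) (G x - neurons_eval t x); lra.
Qed.

Lemma approximableZ (c : R) F : approximable F -> approximable (fun x => c * F x).
Proof.
move=> aF e e0; have c1 : 0 < `|c| + 1 by rewrite ltr_wpDl.
have [s ss Hs] := aF _ (divr_gt0 e0 c1).
exists [seq (c * q.1.1, q.1.2, q.2) | q <- s] => [q|x xc].
  by move=> /seq.mapP[p /ss ps ->].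
rewrite /neurons_eval big_map/=.
have -> : \sum_(q <- s) c * q.1.1 * unit_fun q.1.2 q.2 x = c * neurons_eval s x.
  by rewrite /neurons_eval mulr_sumr; apply: eq_bigr => q _; rewrite mulrA.
rewrite -mulrBr normrM; have h := Hs x xc.
apply: (@le_trans _ _ ((`|c| + 1) * (e / (`|c| + 1)))); last by rewrite mulrC divfK// gt_eqF.
by apply: ler_pM => //; rewrite lerDl.
Qed.

Lemma approximable_unit_fun (w : 'rV[R]_d) b :
  (forall j, `|w 0 j| <= 1) -> `|b| <= 1 -> approximable (unit_fun w b).
Proof.
move=> w1 b1 e e0; exists [:: (1, w, b)] => [q|x xc].
  by rewrite inE => /eqP ->.
by rewrite /neurons_eval big_seq1/= mul1r subrr normr0 ltW.
Qed.

Definition monom (l : seq 'I_d) (x : 'rV[R]_d) : R := \prod_(j <- l) x 0 j.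

Lemma monom_cube l x : unit_cube x -> 0 <= monom l x <= 1.
Proof.
move=> xc; elim: l => [|j l /andP[l0 l1]]; first by rewrite /monom big_nil ler01 lexx.
have /andP[x0 x1] := xc j; rewrite /monom big_cons/= -/(monom l x).
by rewrite mulr_ge0//= mulr_ile1.
Qed.

(* The strict bounds leave room for the difference quotient in w 0 j. *)
Lemma approximable_monom_deriv (l : seq 'I_d) (w : 'rV[R]_d) (b : R) :
  (forall j, `|w 0 j| < 1) -> `|b| < 1 ->
  approximable (fun x => monom l x *
    (iter (size l) sigmoid_poly_deriv 'X).[unit_fun w b x]).
Proof.
elim: l w b => [|j l IH] w b w1 b1.
  apply: (@eq_approximable (unit_fun w b)).
    by move=> x _; rewrite /monom big_nil mul1r /= hornerX.
  by apply: approximable_unit_fun => [i|]; exact: ltW.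
set p := iter (size l) sigmoid_poly_deriv 'X in IH *.
have [C C0 HC] := sigmoid_poly_taylor p.
apply: approximable_lim => e e0.
have wj1 : 0 < 1 - `|w 0 j| by rewrite subr_gt0.
(* The first bound keeps the moved weight strictly inside (-1, 1), the second makes the Taylor error
   C h of the difference quotient at most e. *)
pose h := Num.min ((1 - `|w 0 j|) / 2) (e / (C + 1)).
have C1 : 0 < C + 1 by rewrite ltr_wpDl.
have h0 : 0 < h by rewrite lt_min !divr_gt0.
have hw : h < 1 - `|w 0 j|.
  by apply: (@le_lt_trans _ _ ((1 - `|w 0 j|) / 2)); [rewrite ge_min lexx|lra].
have he : C * h <= e.
  apply: (@le_trans _ _ ((C + 1) * (e / (C + 1)))); last by rewrite mulrC divfK ?gt_eqF.
  by apply: ler_pM; rewrite ?(ltW h0)// ?lerDl// ge_min lexx orbT.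
pose w' : 'rV[R]_d := w + h *: delta_mx 0 j.
have w'1 i : `|w' 0 i| < 1.
  rewrite !mxE eqxx/=; case: eqP => [->|_]; last by rewrite mulr0 addr0.
  rewrite mulr1; apply: (le_lt_trans (ler_normD _ _)); rewrite (gtr0_norm h0); lra.
have dotw' x : dotrv w' x + b = (dotrv w x + b) + h * x 0 j.
  rewrite addrAC; congr (_ + _); rewrite /dotrv (bigD1 j)//= [in RHS](bigD1 j)//=.
  rewrite !mxE !eqxx/= mulr1 mulrDl addrAC; congr (_ + _ + _).
  by apply: eq_bigr => i /negbTE ij; rewrite !mxE eqxx/= ij mulr0 addr0.
exists (fun x => h^-1 * (monom l x * p.[unit_fun w' b x] +
    (-1) * (monom l x * p.[unit_fun w b x]))).
  by apply: approximableZ; apply: approximableD; [exact: IH|apply: approximableZ; exact: IH].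
move=> x xc; have /andP[x0 x1] := xc j; have /andP[m0 m1] := monom_cube l xc.
rewrite /= -/p /monom big_cons -/(monom l x).
have := HC (dotrv w x + b) (h * x 0 j); rewrite -dotw' -/(unit_fun w b x) -/(unit_fun w' b x).
set A := p.[unit_fun w' b x]; set B := p.[unit_fun w b x].
set D := (sigmoid_poly_deriv p).[_] => HT.
rewrite (_ : _ - _ = - (monom l x / h * (A - B - h * x 0 j * D))); last by field; rewrite gt_eqF.
rewrite normrN normrM ger0_norm ?divr_ge0 ?(ltW h0)//.
apply: (@le_trans _ _ (monom l x / h * (C * (h * x 0 j) ^+ 2))).
  by rewrite ler_wpM2l// divr_ge0// ltW.
apply: le_trans he; rewrite (_ : _ * _ = (monom l x * x 0 j ^+ 2) * (C * h)); last first.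
  by field; rewrite gt_eqF.
by rewrite ler_piMl ?mulr_ge0 ?(ltW h0)// mulr_ile1 ?sqr_ge0// expr_le1.
Qed.

Lemma approximable_monom l : approximable (monom l).
Proof.
have [b b1 nb] := @sigmoid_deriv_neq0 R (size l).
set c := (iter _ _ _).[_] in nb.
apply: (@eq_approximable (fun x => c^-1 * (monom l x *
    (iter (size l) sigmoid_poly_deriv 'X).[unit_fun 0 b x]))).
  move=> x _; rewrite /unit_fun (_ : dotrv 0 x = 0) ?add0r -/c.
    by rewrite mulrCA mulVf// mulr1.
  by apply: big1 => j _; rewrite mxE mul0r.
apply: approximableZ; apply: approximable_monom_deriv => // j.
by rewrite mxE normr0.
Qed.

(** Approximability is not evidently preserved by products. This stronger property is preserved by
    multiplication with a coordinate, so Bernstein polynomials are reached through their recursion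
    without being expanded into monomials. *)
Definition monom_stable F : Prop := forall l, approximable (fun x => monom l x * F x).

Lemma monom_stable_approximable F : monom_stable F -> approximable F.
Proof.
move=> /(_ [::]); apply: eq_approximable => x _.
by rewrite /monom big_nil mul1r.
Qed.

Lemma monom_stable_cst c : monom_stable (fun=> c).
Proof.
move=> l; apply: (@eq_approximable (fun x => c * monom l x)) => [x _|].
  by rewrite mulrC.
by apply: approximableZ; exact: approximable_monom.
Qed.

Lemma monom_stableD F G : monom_stable F -> monom_stable G ->
  monom_stable (fun x => F x + G x).
Proof.
move=> mF mG l.
apply: (@eq_approximable (fun x => monom l x * F x + monom l x * G x)) => [x _|].
  by rewrite mulrDr.
exact: approximableD.
Qed.

Lemma monom_stableZ c F : monom_stable F -> monom_stable (fun x => c * F x).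
Proof.
move=> mF l; apply: (@eq_approximable (fun x => c * (monom l x * F x))) => [x _|].
  by rewrite mulrCA.
exact: approximableZ.
Qed.

Lemma monom_stable_coord j F : monom_stable F -> monom_stable (fun x => x 0 j * F x).
Proof.
move=> mF l; apply: eq_approximable (mF (j :: l)) => x _.
by rewrite /monom big_cons mulrCA mulrA.
Qed.

Lemma eq_monom_stable F G : (forall x, F x = G x) -> monom_stable F -> monom_stable G.
Proof. by move=> FG mF l; apply: eq_approximable (mF l) => x _; rewrite FG. Qed.

Lemma monom_stable_sum (I : Type) (s : seq I) (F : I -> 'rV[R]_d -> R) :
  (forall i, monom_stable (F i)) -> monom_stable (fun x => \sum_(i <- s) F i x).
Proof.
move=> mF; elim: s => [|i s IH].
  by apply: eq_monom_stable (monom_stable_cst 0) => x; rewrite big_nil.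
by apply: eq_monom_stable (monom_stableD (mF i) IH) => x; rewrite big_cons.
Qed.

End sigmoid_span.

(** * Bernstein polynomials *)

Section bernstein.
Context {R : realType}.

(** The probability of i successes in m independent trials of success probability t, defined by
    conditioning on one trial. The recursion replaces binomial coefficients in all proofs below. *)
Fixpoint bernstein (m i : nat) (t : R) : R :=
  if m is m'.+1 then
    (if i is i'.+1 then t * bernstein m' i' t else 0) + (1 - t) * bernstein m' i t
  else (i == 0%N)%:R.

Lemma bernstein_gt m i t : (m < i)%N -> bernstein m i t = 0.
Proof.
elim: m i => [|m IH] [|i]//= mi.
by rewrite !IH ?mulr0 ?addr0//; exact: ltnW.
Qed.

Lemma bernstein_ge0 m i t : 0 <= t <= 1 -> 0 <= bernstein m i t.
Proof.
move=> /andP[t0 t1]; elim: m i => [|m IH] [|i]//=; rewrite ?addr_ge0 ?mulr_ge0 ?subr_ge0//.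
Qed.

Lemma bernstein_sumS m t (phi : nat -> R) :
  \sum_(i < m.+2) bernstein m.+1 i t * phi i =
  t * (\sum_(i < m.+1) bernstein m i t * phi i.+1) +
  (1 - t) * (\sum_(i < m.+1) bernstein m i t * phi i).
Proof.
have -> : \sum_(i < m.+2) bernstein m.+1 i t * phi i =
   \sum_(i < m.+2) ((if nat_of_ord i is i'.+1 then t * bernstein m i' t else 0) * phi i) +
   \sum_(i < m.+2) ((1 - t) * bernstein m i t * phi i).
  by rewrite -big_split/=; apply: eq_bigr => i _; rewrite -mulrDl.
congr (_ + _).
  rewrite big_ord_recl/= mul0r add0r mulr_sumr.
  by apply: eq_bigr => i _; rewrite /bump/= add1n mulrA.
rewrite big_ord_recr/= bernstein_gt// mulr0 mul0r addr0 mulr_sumr.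
by apply: eq_bigr => i _; rewrite mulrA.
Qed.

Lemma bernstein_sum1 m t : \sum_(i < m.+1) bernstein m i t = 1.
Proof.
elim: m => [|m IH]; first by rewrite big_ord1.
have := bernstein_sumS m t (fun=> 1).
under eq_bigr do rewrite mulr1.
under [X in _ = _ * X + _]eq_bigr do rewrite mulr1.
under [X in _ = _ + _ * X]eq_bigr do rewrite mulr1.
by rewrite IH => ->; ring.
Qed.

(** The second moment about c of the binomial law: variance plus squared bias. The centre is
    arbitrary because a success in the recursion moves it to c - 1. *)
Lemma bernstein_moment2 m t c :
  \sum_(i < m.+1) bernstein m i t * (i%:R - c) ^+ 2 = m%:R * t * (1 - t) + (m%:R * t - c) ^+ 2.
Proof.
elim: m c => [|m IH] c; first by rewrite big_ord1/=; ring.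
rewrite (bernstein_sumS m t (fun i => (i%:R - c) ^+ 2)) IH.
rewrite (eq_bigr (fun i : 'I_m.+1 => bernstein m i t * (i%:R - (c - 1)) ^+ 2)).
  by rewrite IH -natr1; ring.
by move=> i _; rewrite -natr1; congr (_ * _ ^+ 2); ring.
Qed.

Lemma bernstein_variance m t : (0 < m)%N -> 0 <= t <= 1 ->
  \sum_(i < m.+1) bernstein m i t * (t - i%:R / m%:R) ^+ 2 <= m%:R^-1.
Proof.
move=> m0 /andP[t0 t1]; have m0' : 0 < m%:R :> R by rewrite ltr0n.
rewrite (eq_bigr (fun i : 'I_m.+1 => m%:R ^- 2 * (bernstein m i t * (i%:R - m%:R * t) ^+ 2))).
  rewrite -mulr_sumr bernstein_moment2 subrr expr0n addr0.
  rewrite (_ : _ * _ = m%:R^-1 * (t * (1 - t))); last by field; rewrite gt_eqF.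
  by rewrite ler_piMr ?invr_ge0 ?ler0n//; nra.
by move=> i _; field; rewrite gt_eqF.
Qed.

End bernstein.

Section density.
Context {R : realType} {d : nat}.
Implicit Types f : 'rV[R]_d -> R.

Lemma cube_compact : compact (@unit_cube R d).
Proof.
have -> : @unit_cube R d = [set v : 'rV[R]_d | forall i, `[0, 1]%classic (v ord0 i)].
  by apply/seteqP; split => x /= H i; have := H i; rewrite in_itv.
by apply: (@rV_compact R d (fun=> `[0, 1]%classic)) => i; exact: segment_compact.
Qed.

Lemma continuous_cube_bounded f : {within @unit_cube R d, continuous f} ->
  exists M, forall x, unit_cube x -> `|f x| <= M.
Proof.
move=> cf; have /compact_bounded[M [_ HM]] := continuous_compact cf cube_compact.
exists (M + 1) => x xc; apply: (HM (M + 1)); first by rewrite ltrDl.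
by exists x.
Qed.

(** Compactness in its near-covering form turns the local moduli of continuity into one index N
    valid on the whole cube. *)
Lemma continuous_cube_unif f : {within @unit_cube R d, continuous f} ->
  forall e, 0 < e -> exists2 del, 0 < del & forall x y, unit_cube x -> unit_cube y ->
    (forall j, `|x 0 j - y 0 j| <= del) -> `|f x - f y| <= e.
Proof.
move=> /subspace_continuousP cf e e0.
have := cube_compact; rewrite -[compact _]/(compact _) => /compact_near_coveringP.
move=> /(_ nat \oo (fun n x => unit_cube x -> forall y, unit_cube y ->
  (forall j, `|x 0 j - y 0 j| <= n.+1%:R^-1) -> `|f x - f y| <= e)).
case=> [x xc|N _ HN].
  have e2 : 0 < e / 2 by rewrite divr_gt0.
  have /cvgrPdist_le/(_ _ e2) := cf x xc.
  rewrite /prop_near1 /within/= => /nbhs_ballP[r /= r0 Hr].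
  have r2 : 0 < r / 2 by rewrite divr_gt0.
  pose N := Num.bound (2 / r).
  exists (ball x (r / 2), [set n | (N <= n)%N]) => /=.
    by split; [exact: nbhsx_ballx|exists N].
  move=> [x' n] /= [[_ xx'] Nn] x'c y yc x'y.
  have nr : n.+1%:R^-1 < r / 2.
    rewrite -[X in _ < X]invrK ltf_pV2 ?posrE ?invr_gt0 ?ltr0n// invf_div.
    apply: (lt_le_trans (archi_boundP _)); first by rewrite divr_ge0// ltW.
    by rewrite ler_nat (leq_trans Nn).
  have bx' : ball x r x'.
    by split=> // i j; apply: lt_le_trans (xx' i j) _; rewrite ler_pdivrMr//; lra.
  have bxy : ball x r y.
    split=> // i j; have := xx' i j; rewrite /ball/= => h.
    rewrite /ball/= (ord1 i) in h *; have := x'y j.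
    have := ler_normD (x 0 j - x' 0 j) (x' 0 j - y 0 j); rewrite addrA subrK => h1 h2.
    apply: le_lt_trans h1 _; rewrite [ltRHS](splitr r).
    by apply: ltrD => //; exact: le_lt_trans h2 nr.
  have h1 := Hr _ bx' x'c; have h2 := Hr _ bxy yc.
  have := ler_normD (f x' - f x) (f x - f y); rewrite addrA subrK.
  rewrite (distrC (f x') (f x)); lra.
exists N.+1%:R^-1; first by rewrite invr_gt0.
by move=> x y xc yc xy; apply: (HN N _ x xc xc y yc xy); rewrite /=.
Qed.

Section multivariate_bernstein.
Variable m : nat.
Hypothesis m0 : (0 < m)%N.

Definition grid_point (kap : {ffun 'I_d -> 'I_m.+1}) : 'rV[R]_d :=
  \row_j ((kap j)%:R / m%:R).

Definition bernstein_weight (kap : {ffun 'I_d -> 'I_m.+1}) (x : 'rV[R]_d) : R :=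
  \prod_j bernstein m (kap j) (x 0 j).

Lemma grid_point_cube kap : unit_cube (grid_point kap).
Proof.
move=> j; rewrite mxE divr_ge0//= ler_pdivrMr ?ltr0n// mul1r ler_nat.
by rewrite -ltnS ltn_ord.
Qed.

Lemma bernstein_weight_ge0 kap x : unit_cube x -> 0 <= bernstein_weight kap x.
Proof. by move=> xc; apply: prodr_ge0 => j _; exact: bernstein_ge0. Qed.

Lemma bernstein_weight_sum1 x : \sum_kap bernstein_weight kap x = 1.
Proof.
rewrite -(bigA_distr_bigA (fun j (i : 'I_m.+1) => bernstein m i (x 0 j))).
by apply: big1 => j _; exact: bernstein_sum1.
Qed.

Lemma bernstein_weight_variance x j : unit_cube x ->
  \sum_kap bernstein_weight kap x * (x 0 j - grid_point kap 0 j) ^+ 2 <= m%:R^-1.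
Proof.
move=> xc.
rewrite (eq_bigr (fun kap : {ffun 'I_d -> 'I_m.+1} => \prod_i (bernstein m (kap i) (x 0 i) *
  (if i == j then (x 0 i - (kap i)%:R / m%:R) ^+ 2 else 1)))); last first.
  move=> kap _; rewrite big_split/=; congr (_ * _).
  rewrite (bigD1 j)//= eqxx big1 ?mulr1 ?mxE//.
  by move=> i /negbTE ->.
rewrite -(bigA_distr_bigA (fun i (k : 'I_m.+1) => bernstein m k (x 0 i) *
  (if i == j then (x 0 i - k%:R / m%:R) ^+ 2 else 1))).
rewrite (bigD1 j)//= [X in _ * X]big1 ?mulr1.
  under eq_bigr do rewrite eqxx.
  exact: bernstein_variance.
move=> i /negbTE ->; under eq_bigr do rewrite mulr1.
exact: bernstein_sum1.
Qed.

(** Chebyshev's argument: a grid point within [del] in every coordinate contributes at most e; at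
    any other one the sum over j of (x_j - y_j)^2 / del^2 exceeds 1, so 2M times that sum covers the
    difference, and the variances bound its mean. *)
Lemma bernstein_approx f (M e del : R) x : unit_cube x -> 0 < del -> 0 <= e ->
  (forall x, unit_cube x -> `|f x| <= M) ->
  (forall x y, unit_cube x -> unit_cube y ->
    (forall j, `|x 0 j - y 0 j| <= del) -> `|f x - f y| <= e) ->
  `|f x - \sum_kap f (grid_point kap) * bernstein_weight kap x| <=
    e + 2 * M / del ^+ 2 * (d%:R / m%:R).
Proof.
move=> xc del0 e0 fM unif.
have M0 : 0 <= M by exact: le_trans (fM x xc).
rewrite -{1}[f x]mulr1 -(bernstein_weight_sum1 x) mulr_sumr -sumrB.
apply: (le_trans (ler_norm_sum _ _ _)).
pose C := 2 * M / del ^+ 2.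
have C0 : 0 <= C by rewrite divr_ge0 ?mulr_ge0 ?exprn_ge0// ltW.
apply: (@le_trans _ _ (\sum_kap (bernstein_weight kap x * e +
   C * (\sum_j bernstein_weight kap x * (x 0 j - grid_point kap 0 j) ^+ 2)))).
  apply: ler_sum => kap _; have w0 := bernstein_weight_ge0 kap xc.
  rewrite -mulrBl normrM (ger0_norm w0) mulrC.
  rewrite -mulr_sumr mulrCA -mulrDr ler_wpM2l//.
  have [/forallP H|] := boolP [forall j, `|x 0 j - grid_point kap 0 j| <= del].
    apply: ler_wpDr; last exact: unif (grid_point_cube kap) H.
    by rewrite mulr_ge0// sumr_ge0// => j _; exact: sqr_ge0.
  rewrite negb_forall => /existsP[j]; rewrite -ltNge => Hj.
  apply: ler_wpDl => //.
  apply: (@le_trans _ _ (2 * M)).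
    apply: (le_trans (ler_normB _ _)).
    have := fM _ xc; have := fM _ (grid_point_cube kap); lra.
  rewrite /C mulrAC ler_pdivlMr ?exprn_gt0// ler_wpM2l ?mulr_ge0//.
  rewrite (bigD1 j)//=; apply: ler_wpDr.
    by rewrite sumr_ge0// => i _; exact: sqr_ge0.
  by rewrite -[leRHS]real_normK ?num_real// lerXn2r ?nnegrE// ltW.
rewrite big_split/= -mulr_suml bernstein_weight_sum1 mul1r lerD2l.
rewrite -mulr_sumr ler_wpM2l// exchange_big/=.
apply: (@le_trans _ _ (\sum_(j < d) m%:R^-1)).
  by apply: ler_sum => j _; exact: bernstein_weight_variance.
by rewrite sumr_const card_ord -[leLHS]mulr_natl.
Qed.

Lemma monom_stable_bernstein1 (n i : nat) (j : 'I_d) F : monom_stable F ->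
  monom_stable (fun x : 'rV[R]_d => bernstein n i (x 0 j) * F x).
Proof.
move=> mF; elim: n i => [|n IH] i /=; first exact: monom_stableZ.
have m2 : monom_stable (fun x : 'rV[R]_d => (1 - x 0 j) * (bernstein n i (x 0 j) * F x)).
  have h := monom_stableD (IH i) (monom_stableZ (-1) (monom_stable_coord j (IH i))).
  by apply: eq_monom_stable h => x; ring.
case: i m2 => [|i] m2.
  by apply: eq_monom_stable m2 => x; rewrite add0r mulrA.
have h := monom_stableD (monom_stable_coord j (IH i)) m2.
by apply: eq_monom_stable h => x; ring.
Qed.

Lemma monom_stable_bernstein_weight kap :
  monom_stable (bernstein_weight kap).
Proof.
rewrite /bernstein_weight; elim: (index_enum _) => [|j s IH].
  by apply: eq_monom_stable (monom_stable_cst 1) => x; rewrite big_nil.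
by apply: eq_monom_stable (monom_stable_bernstein1 m (kap j) j IH) => x; rewrite big_cons.
Qed.

End multivariate_bernstein.

Lemma continuous_approximable f : {within @unit_cube R d, continuous f} -> approximable f.
Proof.
move=> cf; have [M fM] := continuous_cube_bounded cf.
apply: approximable_lim => e e0.
have e2 : 0 < e / 2 by rewrite divr_gt0.
have [del del0 unif] := continuous_cube_unif cf e2.
have c0 : @unit_cube R d 0 by move=> j; rewrite mxE lexx ler01.
have M0 : 0 <= M by exact: le_trans (fM 0 c0).
pose A := 2 * M / del ^+ 2 * d%:R.
have A0 : 0 <= A by rewrite mulr_ge0// divr_ge0 ?mulr_ge0 ?exprn_ge0// ltW.
pose m := (Num.bound (A / (e / 2))).+1.
exists (fun x => \sum_kap f (grid_point kap) * bernstein_weight (m := m) kap x).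
  apply: monom_stable_approximable; apply: monom_stable_sum => kap.
  by apply: monom_stableZ; exact: monom_stable_bernstein_weight.
move=> x xc; have := bernstein_approx (ltn0Sn _ : (0 < m)%N) xc del0 (ltW e2) fM unif.
move/le_trans; apply; rewrite mulrA -/A.
suff : A / m%:R <= e / 2 by lra.
rewrite ler_pdivrMr ?ltr0n// mulrC -ler_pdivrMr//.
have Ae : 0 <= A / (e / 2) by rewrite divr_ge0 // ltW.
by apply: (le_trans (ltW (archi_boundP Ae))); rewrite ler_nat.
Qed.

(** A neuron with a large outer weight is split into N copies carrying 1/N of it, where N exceeds
    all outer weights. *)
Lemma neurons_NN (s : @neurons R d) : small_neurons s ->
  exists K : nat, forall k, (K <= k)%N -> NN k 1 1 1 (neurons_eval s).
Proof.
move=> ss.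
pose N := (Num.bound (\sum_(q <- s) `|q.1.1|)).+1.
have N0 : 0 < N%:R :> R by rewrite ltr0n.
have betaN q : q \in s -> `|q.1.1| <= N%:R.
  move=> qs; apply: (@le_trans _ _ (\sum_(q <- s) `|q.1.1|)).
    by rewrite (big_rem q qs)/= lerDl sumr_ge0.
  have S0 : 0 <= \sum_(q <- s) `|q.1.1| by rewrite sumr_ge0.
  by apply: (le_trans (ltW (archi_boundP S0))); rewrite ler_nat.
pose t : @neurons R d := flatten [seq nseq N (q.1.1 / N%:R, q.1.2, q.2) | q <- s].
have tE x : neurons_eval t x = neurons_eval s x.
  rewrite /neurons_eval /t big_flatten big_map; apply: eq_bigr => q _.
  apply: (etrans (big_nseq _ _ _ _ _)).
  rewrite [LHS]iter_addr_0/= -[LHS]mulr_natl.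
  by field; rewrite gt_eqF.
have tP q : q \in t -> [/\ `|q.1.1| <= 1, forall j, `|q.1.2 0 j| <= 1 & `|q.2| <= 1].
  move=> /flattenP[r /seq.mapP[p ps ->]]; rewrite mem_nseq => /andP[_ /eqP ->] /=.
  have [w1 b1] := ss _ ps; split => //.
  by rewrite normrM normfV normr_nat ler_pdivrMr// mul1r betaN.
exists (size t) => k tk.
(* The default neuron has outer weight 0: it pads the list to any larger width k without changing
   the function. *)
pose nt i := nth (0, 0, 0) t i.
exists (fun i => (nt i).1.1), (fun i => (nt i).1.2), (fun i => (nt i).2), 0.
have ntP i : [/\ `|(nt i).1.1| <= 1, forall j, `|(nt i).1.2 0 j| <= 1 & `|(nt i).2| <= 1].
  have [it|it] := ltnP i (size t); first by apply: tP; exact: mem_nth.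
  by rewrite /nt nth_default//=; split => [|j|]; rewrite ?mxE normr0.
split; [|by move=> i; have [] := ntP i|by move=> i; have [] := ntP i|
  by move=> i; have [] := ntP i|by rewrite normr0].
move=> x; rewrite addr0 -tE /neurons_eval (big_nth (0, 0, 0)).
rewrite -(big_mkord xpredT (fun i => (nt i).1.1 * sigmoid (dotrv (nt i).1.2 x + (nt i).2))).
rewrite [RHS](big_cat_nat (leq0n (size t)) tk)//= [X in _ = _ + X]big_nat_cond [X in _ = _ + X]big1 ?addr0//.
by move=> i /andP[/andP[it _] _]; rewrite /nt nth_default//= mul0r.
Qed.

End density.

(** * Strong consistency *)

Section consistency_rates.
Context {R : realType}.

Lemma natr_ge_ln_eventually (U : R) : exists N : nat, forall n, (N <= n)%N ->
  (0 < n)%N /\ U <= ln (n%:R : R).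
Proof.
exists (Num.bound (expR U)).+1 => n Nn.
have n0 : (0 < n)%N by exact: leq_trans Nn.
split=> //; rewrite -[leLHS]expRK ler_ln ?posrE ?expR_gt0 ?ltr0n//.
apply: (le_trans (ltW (archi_boundP (expR_ge0 U)))); rewrite ler_nat.
exact: ltnW.
Qed.

(** With lam of order n^(-1/2), the useful term n lam e is of order sqrt n times e. It must beat L,
    which is O((ln n)^2) since k = O(ln n), and n lam^2 e^H, which is O(n^(1/2 - alpha)). The
    hypothesis with u / 4 secures the first, the one with alpha u the second. *)
Lemma consistency_conditions (d k n : nat) (alpha e : R) :
  (0 < n)%N -> 0 < alpha -> 0 < e ->
  let u := ln (n%:R : R) in
  k%:R <= (2^-1 - alpha) * u ->
  (2 * d%:R + 10) * 64 * (6 * expR 1) <= e * expR (u / 4) ->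
  6 * expR 2 <= e * expR (alpha * u) ->
  let H := k%:R + 1 in
  let c := (n.+1 * n.+2)%:R^-1 / 4 in
  let lam := expR (- (u / 2) - 1) / 3 in
  let L := (k * d.+2).+1%:R * (2 + u) in
  [/\ 0 < lam, 0 <= L & 3 * lam * expR H <= 1] /\
  [/\ ((2 * n).+1 ^ (k * d.+2).+1)%:R <= expR L,
      expR (L + n%:R * lam * (lam * H ^+ 2) - n%:R * lam * e) <= c,
      expR (L + n%:R * lam * (2 * lam * expR H) - n%:R * lam * e) <= c &
      (1 + expR H) * ((k%:R * d.+2%:R + 1) / n%:R) <= e].
Proof.
move=> n0 al0 e0 u ku hA hB H c lam L.
have n0' : 0 < n%:R :> R by rewrite ltr0n.
have u0 : 0 <= u by rewrite /u ln_ge0// ler1n.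
have nE : n%:R = expR u :> R by rewrite /u -natr_expR_ln.
have k0 : 0 <= k%:R :> R by rewrite ler0n.
have au0 : 0 <= alpha * u by rewrite mulr_ge0// ltW.
have ku2 : k%:R <= u / 2 by lra.
have lam0 : 0 < lam by rewrite divr_gt0 ?expR_gt0.
have nlam : n%:R * lam = expR (u / 2 - 1) / 3.
  by rewrite nE /lam mulrA -expRD; congr (expR _ / 3); field.
have nlam2 : n%:R * lam * lam = expR (- 2) / 9.
  have -> : expR (- 2) = expR (u / 2 - 1) * expR (- (u / 2) - 1) :> R.
    by rewrite -expRD; congr expR; field.
  by rewrite nlam /lam; field.
have e2le : expR (- 2) <= 1 :> R by rewrite expR_le1; lra.
set s := expR (u / 2 - 1) / 3 in nlam *.
have one_u : 0 <= 1 + u by lra.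
have h8 : 1 + u <= 8 * expR (u / 8) by have := expR_ge1Dx (u / 8); lra.
have h64 : (1 + u) ^+ 2 <= 64 * expR (u / 4).
  apply: (@le_trans _ _ ((8 * expR (u / 8)) ^+ 2)).
    by rewrite lerXn2r ?nnegrE// mulr_ge0 ?expR_ge0.
  rewrite exprMn -expRM_natl (_ : 2%:R * (u / 8) = u / 4); last by field.
  by rewrite (_ : 8 ^+ 2 = 64)//; ring.
have d0 : 0 <= d%:R :> R by rewrite ler0n.
(* In multiples of (1 + u)^2, the coefficient collects 2d + 4 for L, 1 for the variance term and 5
   for the 5 + 2u that makes the tail summable. *)
have hAu : (2 * d%:R + 10) * (1 + u) ^+ 2 * (6 * expR 1) <= e * expR (u / 2).
  have -> : expR (u / 2) = expR (u / 4) * expR (u / 4) by rewrite -expRD; congr expR; field.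
  rewrite [leRHS]mulrA; apply: (@le_trans _ _ ((2 * d%:R + 10) * 64 * (6 * expR 1) * expR (u / 4))).
    have -> : (2 * d%:R + 10) * 64 * (6 * expR 1) * expR (u / 4) =
        (2 * d%:R + 10) * (64 * expR (u / 4)) * (6 * expR 1) by ring.
    apply: ler_wpM2r; first by rewrite mulr_ge0 ?expR_ge0.
    apply: ler_wpM2l => //; lra.
  by rewrite ler_wpM2r ?expR_ge0.
have e1 : 0 < expR 1 :> R := expR_gt0 _.
have sE : s * (3 * expR 1) = expR (u / 2).
  by rewrite /s mulrA divfK// -expRD; congr expR; ring.
have hAs : (2 * d%:R + 10) * (1 + u) ^+ 2 <= s * e / 2.
  rewrite -(ler_pM2r (_ : 0 < 6 * expR 1)) ?mulr_gt0//.
  rewrite (_ : s * e / 2 * (6 * expR 1) = e * (s * (3 * expR 1))); last by field.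
  by rewrite sE.
have hL : L <= (2 * d%:R + 4) * (1 + u) ^+ 2.
  have f1 : (k * d.+2).+1%:R <= (d%:R + 2) * (1 + u).
    rewrite -natr1 natrM -[d.+2%:R]natr1 -[d.+1%:R]natr1.
    have := mulr_ge0 d0 u0; have := mulr_ge0 d0 (_ : 0 <= u - k%:R); lra.
  have f2 : 2 + u <= 2 * (1 + u) by lra.
  rewrite /L (_ : (2 * d%:R + 4) * (1 + u) ^+ 2 = (d%:R + 2) * (1 + u) * (2 * (1 + u))); last by ring.
  by apply: ler_pM => //; lra.
(* Indeed e^(5 + 2u) = e^5 n^2 >= 32 n^2, which exceeds 4 (n + 1)(n + 2). *)
have cE x : x <= - (5 + 2 * u) -> expR x <= c.
  move=> xu; rewrite /c natrM -invfM.
  have q0 : 0 < n.+1%:R * n.+2%:R * 4 :> R by rewrite !mulr_gt0.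
  apply: (@le_trans _ _ (expR (- (5 + 2 * u)))); first by rewrite ler_expR.
  rewrite expRN lef_pV2 ?posrE ?expR_gt0//.
  have e32 : 32 <= expR 5 :> R.
    have -> : expR 5 = expR 1 ^+ 5 :> R by rewrite -expRM_natl mulr1.
    have e12 : 2 <= expR 1 :> R by have := expR_ge1Dx (1 : R); lra.
    apply: (@le_trans _ _ (2 ^+ 5)); last by rewrite lerXn2r ?nnegrE ?expR_ge0.
    by rewrite (_ : 2 ^+ 5 = 32)//; ring.
  have n1 : 1 <= n%:R :> R by rewrite ler1n.
  rewrite expRD -[2]/(2%:R) expRM_natl -nE -[n.+2%:R]natr1 -[n.+1%:R]natr1.
  have := ler_wpM2r (sqr_ge0 n%:R) e32; have := sqr_ge0 (n%:R - 1 : R); nra.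
split; first split => //.
- by rewrite /L mulr_ge0//; lra.
- rewrite /lam mulrCA mulfV// mulr1 -expRD -[leRHS]expR0 ler_expR /H; lra.
split.
- rewrite natrX /L expRM_natl lerXn2r ?nnegrE ?expR_ge0//.
  rewrite expRD -nE.
  have h3 : 3 <= expR 2 :> R by have := expR_ge1Dx (2 : R); lra.
  apply: (@le_trans _ _ (3 * n%:R)); last by rewrite ler_wpM2r.
  by rewrite -natrM ler_nat -(addn1 (2 * _)) (mulSn 2) addnC leq_add2r.
- apply: cE; rewrite mulrA nlam2 nlam.
  have t1 : expR (- 2) / 9 * H ^+ 2 <= (1 + u) ^+ 2.
    rewrite -[leRHS]mul1r; apply: ler_pM; rewrite ?divr_ge0 ?expR_ge0 ?sqr_ge0//; first lra.
    by rewrite lerXn2r ?nnegrE ?/H//; lra.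
  have t2 : 1 + u <= (1 + u) ^+ 2 by rewrite expr2 ler_peMr//; lra.
  have t3 := mulr_ge0 d0 (sqr_ge0 (1 + u)).
  have t4 : 0 <= s * e by rewrite mulr_ge0 ?divr_ge0 ?expR_ge0// ltW.
  lra.
- apply: cE; rewrite (_ : n%:R * lam * (2 * lam * expR H) =
    2 * (n%:R * lam * lam) * expR H); last by ring.
  rewrite nlam2 nlam.
  have t1 : 2 * (expR (- 2) / 9) * expR H <= s * e / 2.
    have a1 : expR H <= expR (u / 2 - alpha * u + 1) by rewrite ler_expR /H; lra.
    have a2 : 2 * (expR (- 2) / 9) * expR H <= expR H.
      by rewrite ler_piMl ?expR_ge0//; lra.
    apply: (le_trans a2); apply: (le_trans a1).
    rewrite -(ler_pM2r (_ : 0 < 6 * expR 1)) ?mulr_gt0//.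
    rewrite (_ : s * e / 2 * (6 * expR 1) = e * (s * (3 * expR 1))); last by field.
    rewrite sE.
    have -> : expR (u / 2 - alpha * u + 1) * (6 * expR 1) =
        6 * expR 2 * expR (u / 2 - alpha * u).
      by rewrite mulrCA -expRD -mulrA -expRD; congr (6 * expR _); ring.
    have -> : expR (u / 2) = expR (alpha * u) * expR (u / 2 - alpha * u).
      by rewrite -expRD; congr expR; ring.
    by rewrite mulrA ler_wpM2r ?expR_ge0.
  have t2 : 1 + u <= (1 + u) ^+ 2 by rewrite expr2 ler_peMr//; lra.
  have t3 := mulr_ge0 d0 (sqr_ge0 (1 + u)).
  lra.
have h1 : 1 + expR H <= 2 * (expR 1 * expR (u / 2)).
  have a1 : 1 <= expR H by rewrite -[leLHS]expR0 ler_expR /H; lra.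
  have a2 : expR H <= expR 1 * expR (u / 2) by rewrite -expRD ler_expR /H; lra.
  lra.
have h2 : k%:R * d.+2%:R + 1 <= (d%:R + 2) * (1 + u).
  rewrite -[d.+2%:R]natr1 -[d.+1%:R]natr1.
  have := mulr_ge0 d0 u0; have := mulr_ge0 d0 (_ : 0 <= u - k%:R); lra.
rewrite mulrA ler_pdivrMr// nE.
have -> : expR u = expR (u / 2) * expR (u / 2) by rewrite -expRD; congr expR; field.
apply: (@le_trans _ _ (2 * (expR 1 * expR (u / 2)) * ((d%:R + 2) * (1 + u)))).
  by apply: ler_pM; rewrite ?addr_ge0 ?mulr_ge0 ?expR_ge0.
have h3 : 2 * expR 1 * ((d%:R + 2) * (1 + u)) <= e * expR (u / 2).
  apply: le_trans hAu.
  have b1 : (d%:R + 2) * (1 + u) <= (2 * d%:R + 10) * (1 + u) ^+ 2.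
    rewrite [(1 + u) ^+ 2]expr2 mulrA.
    rewrite -[leLHS]mulr1; apply: ler_pM; rewrite ?mulr_ge0 ?addr_ge0//; last lra.
    by rewrite ler_wpM2r//; lra.
  have b2 : 0 <= (d%:R + 2) * (1 + u) by rewrite mulr_ge0// addr_ge0.
  have := ler_wpM2r (ltW e1) b1; have := mulr_ge0 b2 (ltW e1); lra.
rewrite (_ : 2 * (expR 1 * expR (u / 2)) * _ =
  2 * expR 1 * ((d%:R + 2) * (1 + u)) * expR (u / 2)); last by ring.
by rewrite [leRHS]mulrA ler_wpM2r ?expR_ge0.
Qed.

End consistency_rates.

Section strong_consistency.
Context {R : realType} {d : nat}.
Variables (P Q : probability (borel_rV R d) R).
Context {disp : measure_display} {Omega : measurableType disp}.
Variables (Pr : probability Omega R) (X Y : nat -> {RV Pr >-> borel_rV R d}).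
Hypotheses (hX : iid_from X P) (hY : iid_from Y Q).
Hypotheses (P1 : P (@unit_cube R d) = 1%E) (Q1 : Q (@unit_cube R d) = 1%E).
Variable f : borel_rV R d -> R.
Hypothesis bf : bmf f.
Hypothesis changePQ : forall g : borel_rV R d -> R, bmf g ->
  \int[P]_x g x = \int[Q]_x (expR (f x) * g x).
Variable f0 : 'rV[R]_d -> R.
Hypothesis f0_continuous : {within @unit_cube R d, continuous f0}.
Hypothesis ff0 : {ae Q, forall x, f x = f0 x}.

Let D := \int[P]_x f x.

Lemma small_gap_network (e : R) : 0 < e ->
  exists2 g : 'rV[R]_d -> R, gap P Q f g <= e &
    exists K : nat, forall k, (K <= k)%N -> NN k 1 1 1 g.
Proof.
move=> e0; have [M f0M] := continuous_cube_bounded f0_continuous.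
have M0 : 0 <= M.
  by apply: le_trans (f0M 0 _) => // j; rewrite mxE lexx ler01.
pose B := 9 * expR (3 * (M + 1)).
have B0 : 0 < B by rewrite mulr_gt0 ?expR_gt0.
(* The bound eps <= 1 keeps the network within M + 1, the constant built into B, and gives eps^2 <=
   eps, so that the gap is at most B eps <= e. *)
pose eps := Num.min 1 (e / B).
have eps0 : 0 < eps by rewrite lt_min ltr01 divr_gt0.
have [s ss sf0] := continuous_approximable f0_continuous eps0.
have [K HK] := neurons_NN ss.
exists (neurons_eval s); last by exists K.
have bg : bmf (neurons_eval s : borel_rV R d -> R) by exact: bmf_NN (HK K _).
have aeD : {ae Q, forall x, @unit_cube R d x /\ f x = f0 x}.
  by have cubeQ := ae_cube Q1; apply: (@filterS2 _ _ (ae_filter_ringOfSetsType Q) _ _ _ _ cubeQ ff0) => x xc fx; split.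
have [N [mN N0 HN]] := aeD.
have HD x : (~` N) x -> @unit_cube R d x /\ f x = f0 x.
  by move=> xN; apply: contrapT => xn; exact/xN/HN.
have nullD : Q (~` (~` N)) = 0%E by rewrite setCK.
have fgD x : (~` N) x -> `|neurons_eval s x - f x| <= eps.
  by move=> /HD[xc ->]; rewrite distrC; exact: sf0.
have eps1 : eps <= 1 by rewrite ge_min lexx.
have epse : eps <= e / B by rewrite ge_min lexx orbT.
apply: (le_trans (@gap_le _ _ _ P Q f bf changePQ _ (M + 1) _ (measurableC mN) nullD bg _ _)).
- by rewrite addr_ge0.
- move=> x xN; have := fgD _ xN; have [xc fx] := HD _ xN; have := f0M _ xc.
  rewrite -fx => fM fg; split; first by rewrite (le_trans fM)// lerDl.
  rewrite -(subrK (f x) (neurons_eval s x)) (le_trans (ler_normD _ _))// addrC lerD//.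
  exact: le_trans eps1.
rewrite -/B -ler_pdivlMl// mulrC; apply: le_trans epse.
rewrite -(Rint_cst Q eps); apply: (le_Rint_on (measurableC mN) nullD).
- exact: bmf_sqr (bmfB bg bf).
- exact: bmf_cst.
move=> x /fgD; rewrite -real_normK ?num_real// => fg.
rewrite (@le_trans _ _ (eps ^+ 2))//; first by rewrite lerXn2r ?nnegrE// ltW.
by rewrite expr2 ler_piMr// ltW.
Qed.

Variables (k : nat -> nat) (alpha : R).
Hypothesis alpha0 : 0 < alpha.
Hypothesis k_infty : k n @[n --> \oo] --> \oo.
Hypothesis k_log : \forall n \near \oo, (k n)%:R <= (2^-1 - alpha) * ln (n%:R : R).

Lemma estimator_ae_near (e : R) : 0 < e ->
  {ae Pr, forall w, exists N, forall n, (N <= n)%N ->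
    ((D - 3 * e)%:E <= KL_estimator (NN (k n) 1 1 1) n (X ^~ w) (Y ^~ w)
         <= (D + 3 * e)%:E)%E}.
Proof.
move=> e0; have [g gap_g [K HK]] := small_gap_network e0.
pose H' := K%:R + 1 : R.
have gH' x : `|g x| <= H' by rewrite (le_trans (norm_NN_le _ (HK K _)))// mulr1.
pose A := (2 * d%:R + 10) * 64 * (6 * expR 1) : R.
pose B := 6 * expR 2 : R.
have A0 : 0 <= A.
  by rewrite /A !mulr_ge0 ?expR_ge0// addr_ge0// mulr_ge0.
have B0 : 0 <= B by rewrite mulr_ge0 ?expR_ge0.
have [N1 HN1] := natr_ge_ln_eventually (4 * (A / e)).
have [N2 HN2] := natr_ge_ln_eventually (alpha^-1 * (B / e)).
have [N3 _ HN3] := k_log.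
(* This gives 2 H' = 2K + 2 <= k n + 1, the relation between the two bounds that [tail_event]
   requires, and also k n >= K. *)
have [N4 _ HN4] : \forall n \near \oo, (2 * K + 1 <= k n)%N.
  by move/cvgnyPge : k_infty; exact.
have := @as_bracket _ _ P Q _ _ Pr X Y hX hY P1 Q1 f bf changePQ k
  (fun n => expR (- (ln n%:R / 2) - 1) / 3)
  (fun n => (k n * d.+2).+1%:R * (2 + ln n%:R))
  (maxn (maxn N1 N2) (maxn N3 N4)) H' e e g e0 gH' gap_g.
have big n : (maxn (maxn N1 N2) (maxn N3 N4) <= n)%N ->
    [/\ (0 < n)%N, A <= e * expR (ln n%:R / 4), B <= e * expR (alpha * ln n%:R),
      (k n)%:R <= (2^-1 - alpha) * ln (n%:R : R) & (2 * K + 1 <= k n)%N].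
  rewrite !geq_max => /andP[/andP[/HN1[n0 h1] /HN2[_ h2]] /andP[h3 h4]]; split => //.
  - rewrite mulrC -ler_pdivrMr//; have := expR_ge1Dx (ln n%:R / 4 : R).
    by move: h1; set a := A / e; set b := ln _; lra.
  - rewrite mulrC -ler_pdivrMr//; have := expR_ge1Dx (alpha * ln n%:R : R).
    by move: h2; rewrite ler_pdivrMl//; set a := B / e; set b := alpha * _; lra.
  - exact: HN3.
  - exact: HN4.
move=> bracket; have aew := bracket _.
apply: filterS (aew _) => [w [N HN]|n /big[n0 hA hB kn Kk] H c].
  by exists N => n /HN; rewrite (_ : D - 3 * e = D - e - 2 * e)//; ring.
have [[lam0 L0 h1] [h2 h3 h4 h5]] := consistency_conditions n0 alpha0 e0 kn hA hB.
have Kkn : NN (k n) 1 1 1 g.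
  by apply: HK; apply: leq_trans Kk; rewrite mul2n -addnn -addnA leq_addr.
have HH : 2 * H' <= H.
  rewrite /H'/H (_ : 2 * _ = (2 * K + 1)%:R + 1); first by rewrite lerD2r ler_nat.
  by rewrite natrD natrM; ring.
by split; [exact: And5|exact: And5].
Qed.

(** The tolerances 1/(j+1) leave only countably many exceptional null sets. Finiteness of the
    estimator is itself only an eventual property, read off from the bracket for j = 0. *)
Lemma estimator_strong_consistency : {ae Pr, forall w,
  KL_estimator (NN (k n) 1 1 1) n (X ^~ w) (Y ^~ w) @[n --> \oo] --> D%:E}.
Proof.
have aej : {ae Pr, forall w, forall j, exists N, forall n, (N <= n)%N ->
    ((D - 3 * j.+1%:R^-1)%:E <= KL_estimator (NN (k n) 1 1 1) n (X ^~ w) (Y ^~ w)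
         <= (D + 3 * j.+1%:R^-1)%:E)%E}.
  by apply: ae_foralln => j; apply: estimator_ae_near; rewrite invr_gt0 ltr0n.
apply: filterS aej => w Hw.
pose u n := KL_estimator (NN (k n) 1 1 1) n (X ^~ w) (Y ^~ w).
have finu : \forall n \near \oo, u n \is a fin_num.
  have [N HN] := Hw 0%N; exists N => // n /HN /andP[h1 h2].
  by rewrite fin_real// (lt_le_trans _ h1) ?ltNyr// (le_lt_trans h2) ?ltry.
apply/fine_cvgP; split => //; apply/cvgrPdist_le => e e0.
have e3 : 0 < e / 3 by rewrite divr_gt0.
have [j je] : exists j : nat, j.+1%:R^-1 < e / 3.
  exists (Num.bound (e / 3)^-1); rewrite -[ltRHS]invrK ltf_pV2 ?posrE ?invr_gt0//.
  apply: (lt_trans (archi_boundP _)); first by rewrite invr_ge0 ltW.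
  by rewrite ltr_nat.
have [N HN] := Hw j.
near=> n.
have /fineK un : u n \is a fin_num by near: n.
have /HN : (N <= n)%N by near: n; exact: nbhs_infty_ge.
rewrite -/(u n) -un !lee_fin /= => /andP[h1 h2].
have close (v i r : R) : D - 3 * i <= v -> v <= D + 3 * i -> i < r / 3 -> `|D - v| <= r.
  by move=> v1 v2 ir; rewrite ler_norml; apply/andP; split; lra.
exact: close h1 h2 je.
Unshelve. all: by end_near. Qed.

End strong_consistency.

Theorem theorem4 (R : realType) (d : nat) (hd : (0 < d)%N)
    (P Q : probability (borel_rV R d) R) (hPQ : KL_pair P Q)
    (disp : measure_display) (Omega : measurableType disp)
    (Pr : probability Omega R)
    (X Y : nat -> {RV Pr >-> borel_rV R d})
    (hX : iid_from X P) (hY : iid_from Y Q)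
    (fKL : 'rV[R]_d -> R) (hfKL : is_log_ratio P Q fKL)
    (alpha : R) (halpha : 0 < alpha) :
  ({within @unit_cube R d, continuous fKL} ->
   forall k : nat -> nat,
     k n @[n --> \oo] --> \oo ->
     (\forall n \near \oo, (k n)%:R <= (2^-1 - alpha) * ln (n%:R : R)) ->
     {ae Pr, forall w,
        KL_estimator (@NN R d (k n) 1 1 1) n (X ^~ w) (Y ^~ w)
          @[n --> \oo] --> KL P Q})
  /\
  (forall M : R, @barron_ball R d M fKL ->
   forall A : R, exists C : R, forall k n : nat, (0 < k)%N -> (0 < n)%N ->
     k%:R ^+ 3 <= A * n%:R `^ (1 - alpha) ->
     (\int[Pr]_w `| KL_estimator (@NNstar R d k (2^-1 * ln k%:R)) n
                      (X ^~ w) (Y ^~ w) - KL P Q |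
      <= (C * (k%:R `^ (- 2^-1) + k%:R `^ (3 / 2) * n%:R `^ (- 2^-1)))%:E)%E).
Proof.
have [P1 Q1 _ _] := hPQ.
split=> [cf k k_infty k_log|M].
  have [M fM] := continuous_cube_bounded cf.
  have [f [bf _ ff changePQ ->]] := log_density_change hPQ hfKL fM.
  exact: (estimator_strong_consistency hX hY P1 Q1 bf changePQ cf ff halpha).
rewrite /barron_ball/= ge_max => /andP[coefM supM] A.
have fM x : unit_cube x -> `|fKL x| <= M.
  by move=> xc; rewrite -lee_fin; apply: le_trans supM; apply: ereal_sup_ubound; exists x.
have [f [bf fM' ff changePQ ->]] := log_density_change hPQ hfKL fM.
(* The infimum defining the Barron coefficient need not be attained; the slack 1 provides an actual
   extension of [fKL] with a finite Barron constant. *)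
have /ereal_inf_lt[_ [c [_ [g0 barron_g0 fg0]] <-] _] : (barron_coef fKL < (M + 1)%:E)%E.
  by apply: le_lt_trans coefM _; rewrite lte_fin ltrDl.
have fg : {ae Q, forall x, f x = g0 x}.
  have cubeQ := ae_cube Q1.
  apply: (@filterS2 _ _ (ae_filter_ringOfSetsType Q) _ _ _ _ cubeQ ff) => x xc ->.
  exact: fg0.
exact: (barron_expected_rate hd hX hY P1 Q1 bf changePQ A barron_g0 fg fM' halpha).
Qed.
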